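(* Let $N\ge 1$ and $J=(0,1)$. For every $\varepsilon\in J$, let $\rho_\varepsilon\colon \mathbb{R}^N\to[0,+\infty)$ be measurable, and let $$\mathscr{F}_\varepsilon[u]=\frac12\int_{\mathbb{R}^N\times\mathbb{R}^N}\rho_\varepsilon(y-x)\frac{|u(y)-u(x)|^2}{|y-x|^2}\,\mathrm{d}y\,\mathrm{d}x .$$ Suppose that there exists $M\ge0$ such that for every $R>0$ $$\limsup_{\varepsilon\to0}\left[\int_{B(0,R)}\rho_{\varepsilon}(z)\,\mathrm{d}z+R^2\int_{B(0,R)^c}\frac{\rho_{\varepsilon}(z)}{|z|^2}\,\mathrm{d}z\right]\le M.$$ Then there exist a sequence $\{\varepsilon_k\}\subset J$ with $\varepsilon_k\to0$ and two finite positive Radon measures $\mu$ on $\mathbb{S}^{N-1}$ and $\nu$ on $\mathbb{R}^N$, depending only on $\{\rho_{\varepsilon_k}\}$, such that for every $u\in H^1(\mathbb{R}^N)$ $$\lim_{k\to+\infty}\mathscr{F}_{\varepsilon_k}[u]=\frac12\int_{\mathbb{R}^N}\left[\int_{\mathbb{S}^{N-1}}|\nabla u(x)\cdot\sigma|^2\,\mathrm{d}\mu(\sigma)+\int_{\mathbb{R}^N\setminus\{0\}}\frac{|u(x+z)-u(x)|^2}{|z|^2}\,\mathrm{d}\nu(z)\right]\mathrm{d}x .$$ Moreover, the right-hand side is finite for every $u\in H^1(\mathbb{R}^N)$.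
   Context: Functions $u$ are real-valued. $B(0,R)$ is the open ball in $\mathbb{R}^N$ of center $0$ and radius $R$, and $B(0,R)^c$ is its complement. $\mathbb{S}^{N-1}$ is the unit sphere of $\mathbb{R}^N$. $H^1(\mathbb{R}^N)$ is the space of $u\in L^2(\mathbb{R}^N)$ whose distributional gradient is in $L^2(\mathbb{R}^N)$. The functionals $\mathscr{F}_\varepsilon$ take values in $[0,+\infty]$. In particular, the sequence $\{\varepsilon_k\}$ and the measures $\mu,\nu$ do not depend on $u$. *)

(* Defs.v *)
From HB Require Import structures.
From mathcomp Require Import all_boot all_order all_algebra.
From mathcomp Require Import all_classical all_reals all_analysis.
From mathcomp Require Import measurable_realfun.
Import Order.TTheory GRing.Theory Num.Theory.
Import numFieldNormedType.Exports.
Set Implicit Arguments.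
Unset Strict Implicit.
Unset Printing Implicit Defensive.
Local Open Scope classical_set_scope.
Local Open Scope ring_scope.

(* R^N is 'rV[R]_N, with its library topology (that of the sup norm), and is
   made a measurable space by its Borel sigma-algebra. *)
HB.instance Definition _ (R : realType) (n : nat) :=
  @isMeasurable.Build (sigma_display (@open 'rV[R]_n)) 'rV[R]_n
    <<s (@open 'rV[R]_n) >>
    (@sigma_algebra0 _ setT (@open 'rV[R]_n)) (@sigma_algebraC _ (@open 'rV[R]_n))
    (@sigma_algebra_bigcup _ setT (@open 'rV[R]_n)).

Section lebesgue_rV.
Variable R : realType.

Lemma open_measurable_rV n (U : set 'rV[R]_n) : open U -> measurable U.
Proof. by move=> oU; exact: sub_sigma_algebra. Qed.

Lemma measurable_coord_rV n (i : 'I_n) :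
  measurable_fun [set: 'rV[R]_n] (fun x => x 0 i).
Proof.
apply: (measurability _ (RGenOInfty.measurableE R)) => _ [_ [a ->] <-].
rewrite setTI; apply: open_measurable_rV.
apply: open_comp; last exact: interval_open.
by move=> x _; exact: coord_continuous.
Qed.

Lemma open_rV_bigcup n (U : set 'rV[R]_n) : open U ->
  U = \bigcup_(p in [set p : 'rV[rat]_n * nat |
         ball (map_mx ratr p.1 : 'rV[R]_n) (p.2.+1%:R^-1) `<=` U])
      ball (map_mx ratr p.1 : 'rV[R]_n) (p.2.+1%:R^-1).
Proof.
move=> oU; apply/seteqP; split => [x Ux|x [p /= pU px]]; last exact: pU.
have /nbhs_ballP[e /= e0 xeU] : nbhs x U by exact: open_nbhs_nbhs.
have [k ke] : exists k : nat, k.+1%:R^-1 < e / 2.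
  have e20 : 0 < e / 2 by rewrite divr_gt0.
  exists (Num.truncn (e / 2)^-1).
  by rewrite invf_plt ?posrE ?ltr0n// truncnS_gt.
have k0 : 0 < k.+1%:R^-1 :> R by rewrite invr_gt0.
have qP (i : 'I_n) : exists q : rat, `|ratr q - x 0 i| < k.+1%:R^-1.
  have : x 0 i - k.+1%:R^-1 < x 0 i + k.+1%:R^-1.
    by rewrite ltrBlDr -addrA ltrDl addr_gt0.
  move=> /rat_in_itvoo[q]; rewrite in_itv /= => /andP[h1 h2].
  by exists q; rewrite ltr_distl h1 h2.
pose q : 'rV[rat]_n := \row_i sval (cid (qP i)).
have qx : ball (map_mx ratr q : 'rV[R]_n) k.+1%:R^-1 x.
  split=> // i j; rewrite (ord1 i) !mxE.
  by case: cid => r /= hr; rewrite /ball/=.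
exists (q, k) => //= y qy; apply: xeU.
have -> : e = e / 2 + e / 2 by rewrite -splitr.
apply: (@ball_triangle _ _ (map_mx ratr q : 'rV[R]_n)).
  by apply/ball_sym; apply: le_ball qx; exact: ltW.
by apply: le_ball qy; exact: ltW.
Qed.

Lemma measurable_fun_rV d (T : measurableType d) n (f : T -> 'rV[R]_n) :
  (forall i, measurable_fun setT (fun t => f t 0 i)) -> measurable_fun setT f.
Proof.
move=> mf; apply: (measurability _ (erefl : measurable = <<s (@open 'rV[R]_n) >>)).
move=> _ [U oU <-]; rewrite setTI (open_rV_bigcup oU) preimage_bigcup.
rewrite bigcup_mkcond; apply: countable_bigcupT_measurable => //= p.
case: ifPn => // _.
rewrite (_ : _ @^-1` _ = \bigcap_(i in [set: 'I_n])
   ((fun t => f t 0 i) @^-1` ball (ratr (p.1 0 i) : R) p.2.+1%:R^-1)).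
  apply: fin_bigcap_measurable => // i _; rewrite -[X in measurable X]setTI.
  by apply: mf => //; exact: measurable_ball.
apply/seteqP; split => [t [_ h] i _|t h].
  by have := h 0 i; rewrite mxE.
by split=> [|i j]; [rewrite invr_gt0|rewrite (ord1 i) mxE; exact: h].
Qed.

Definition cons_rV n (p : R * 'rV[R]_n) : 'rV[R]_n.+1 :=
  row_mx (p.1)%:M p.2 : 'rV[R]_(1 + n).

Definition uncons_rV n (x : 'rV[R]_n.+1) : R * 'rV[R]_n :=
  (x 0 0, rsubmx (x : 'rV[R]_(1 + n))).

Lemma cons_rVK n : cancel (@cons_rV n) (@uncons_rV n).
Proof.
move=> [a x]; rewrite /uncons_rV /cons_rV /= row_mxKr; congr pair.
by have := row_mxEl (a%:M : 'M[R]_1) x 0 0; rewrite lshift0 => ->; rewrite mxE.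
Qed.

Lemma measurable_cons_rV n : measurable_fun setT (@cons_rV n).
Proof.
apply: measurable_fun_rV => i.
have [j ij|j ij] := splitP (i : 'I_(1 + n)).
  have -> : i = lshift n j by exact/val_inj.
  rewrite (_ : (fun _ => _) = fst); first exact: measurable_fst.
  apply/funext => p; apply: (etrans (row_mxEl _ _ _ _)).
  by rewrite (ord1 j) mxE.
have -> : i = rshift 1 j by exact/val_inj.
rewrite (_ : (fun _ => _) = (fun x : 'rV[R]_n => x 0 j) \o snd).
  by apply: measurableT_comp; [exact: measurable_coord_rV|exact: measurable_snd].
by apply/funext => p; exact: row_mxEr.
Qed.

Lemma measurable_uncons_rV n : measurable_fun setT (@uncons_rV n).
Proof.
apply/measurable_fun_pairP; split; first exact: measurable_coord_rV.
apply: measurable_fun_rV => i.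
rewrite (_ : (fun _ => _) = (fun x : 'rV[R]_n.+1 => x 0 (rshift 1 i))).
  exact: measurable_coord_rV.
by apply/funext => x; rewrite /= mxE.
Qed.

Section cons_measure.
Variables (n : nat) (m : {sigma_finite_measure set 'rV[R]_n -> \bar R}).

Definition cons_measure : set 'rV[R]_n.+1 -> \bar R :=
  pushforward (lebesgue_measure \x m)%E (@cons_rV n).

Let cons_measure0 : cons_measure set0 = 0%E.
Proof. by rewrite /cons_measure /pushforward preimage_set0 measure0. Qed.

Let cons_measure_ge0 A : (0 <= cons_measure A)%E.
Proof. by rewrite /cons_measure /pushforward; exact: measure_ge0. Qed.

Let cons_measure_semi_sigma_additive : semi_sigma_additive cons_measure.
Proof.
have := @measurable_cons_rV n => mc F mF tF mUF.
rewrite /cons_measure /pushforward preimage_bigcup.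
apply: measure_semi_sigma_additive.
- by move=> k; rewrite -[X in measurable X]setTI; exact: mc.
- apply/trivIsetP => /= i j _ _ ij; rewrite -preimage_setI.
  by move/trivIsetP : tF => /(_ _ _ _ _ ij) ->//; rewrite preimage_set0.
- by rewrite -preimage_bigcup -[X in measurable X]setTI; exact: mc.
Qed.

HB.instance Definition _ := isMeasure.Build _ _ _ cons_measure
  cons_measure0 cons_measure_ge0 cons_measure_semi_sigma_additive.

Let cons_measure_sigma_finite : sigma_finite setT cons_measure.
Proof.
have /sigma_finiteP[F [FT ndF Foo]] :=
  sigma_finiteT (@lebesgue_measure R : {sigma_finite_measure set _ -> \bar R}).
have /sigma_finiteP[G [GT ndG Goo]] := sigma_finiteT m.
exists (fun k => @uncons_rV n @^-1` (F k `*` G k)).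
  apply/seteqP; split => // x _.
  have [i _ Fi] : (\bigcup_i F i) (x 0 0) by rewrite -FT.
  have [j _ Gj] : (\bigcup_j G j) (rsubmx (x : 'rV[R]_(1 + n))) by rewrite -GT.
  exists (maxn i j) => //=; split => /=.
    by move: Fi; exact/subsetPset/ndF/leq_maxl.
  by move: Gj; exact/subsetPset/ndG/leq_maxr.
move=> k; have [mF Fk] := Foo k; have [mG Gk] := Goo k; split.
  rewrite -[X in measurable X]setTI.
  by apply: (measurable_uncons_rV measurableT); exact: measurableX.
rewrite /cons_measure /pushforward -comp_preimage.
rewrite (_ : _ \o _ = id); last by apply/funext => p; exact: cons_rVK.
rewrite preimage_id product_measure1E// lte_mul_pinfty// ge0_fin_numE//.
Qed.

HB.instance Definition _ := Measure_isSigmaFinite.Build _ _ _ cons_measure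
  cons_measure_sigma_finite.

End cons_measure.

(* N-fold product of the Lebesgue measure of R, on the Borel sets of R^N. *)
Fixpoint lebesgue_rV n : {sigma_finite_measure set 'rV[R]_n -> \bar R} :=
  if n is n'.+1 then cons_measure (lebesgue_rV n') else \d_(0 : 'rV[R]_0).

End lebesgue_rV.

Section euclidean.
Variables (R : realType) (N : nat).

Definition dot (x y : 'rV[R]_N) : R := \sum_(i < N) x 0 i * y 0 i.

(* The library norm `|x| on 'rV[R]_N is the sup norm, not the Euclidean one. *)
Definition enorm (x : 'rV[R]_N) : R := Num.sqrt (dot x x).

Definition eball (r : R) : set 'rV[R]_N := [set x | enorm x < r].

Definition sphere : set 'rV[R]_N := [set x | enorm x = 1].

End euclidean.

Arguments sphere : clear implicits.

Section sobolev.
Variables (R : realType) (N : nat).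
Local Notation V := 'rV[R]_N.
Local Notation leb := (@lebesgue_rV R N).

(* Lebesgue (not only Borel) measurability: preimages of Borel sets lie in the
   completion of the Borel sigma-algebra.  The library integral of such an f
   against leb, defined from suprema over the Borel simple functions below
   f^+ and f^-, is the usual Lebesgue integral. *)
Definition lebesgue_measurable_fun (f : V -> R) : Prop :=
  forall B : set R, measurable B -> completed_algebra_gen leb (f @^-1` B).

Definition L2 (f : V -> R) : Prop :=
  lebesgue_measurable_fun f /\ (\int[leb]_x (`|f x| ^+ 2)%:E < +oo)%E.

Definition partial (i : 'I_N) (f : V -> R) : V -> R :=
  fun x => 'D_(delta_mx 0 i) f x.

Definition smooth (f : V -> R) : Prop :=
  forall s : seq 'I_N, let g := foldr partial f s in
    continuous g /\ forall (i : 'I_N) (x : V), derivable g x (delta_mx 0 i).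

Definition test_function (phi : V -> R) : Prop :=
  smooth phi /\ compact (closure [set x | phi x != 0]).

(* g is (a representative of) the distributional gradient of u, and is in L^2 *)
Definition L2_gradient (u : V -> R) (g : V -> V) : Prop :=
  (forall i, L2 (fun x => g x 0 i)) /\
  forall phi, test_function phi -> forall i : 'I_N,
    (\int[leb]_x (u x * partial i phi x)%:E =
     - \int[leb]_x (g x 0 i * phi x)%:E)%E.

Definition H1 (u : V -> R) : Prop := L2 u /\ exists g, L2_gradient u g.

End sobolev.

Section functionals.
Variables (R : realType) (N : nat).
Local Notation V := 'rV[R]_N.
Local Notation leb := (@lebesgue_rV R N).
Local Open Scope ereal_scope.

Definition radon (mu : set V -> \bar R) : Prop :=
  [/\ forall K, compact K -> mu K < +oo,
      forall A, measurable A ->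
        mu A = ereal_inf [set mu U | U in [set U | open U /\ A `<=` U]] &
      forall A, measurable A ->
        mu A = ereal_sup [set mu K | K in [set K | compact K /\ K `<=` A]]].

(* the diagonal, where the library's division by 0 yields 0, is a null set *)
Definition energy (rho : V -> R) (u : V -> R) : \bar R :=
  (2^-1)%:E * \int[leb \x leb]_(p in [set: V * V])
     (rho (p.2 - p.1)%R * (`|u p.2 - u p.1| ^+ 2 / enorm (p.2 - p.1) ^+ 2))%:E.

Definition limit_energy (mu nu : set V -> \bar R) (u : V -> R) (g : V -> V) :
    \bar R :=
  (2^-1)%:E * \int[leb]_x
    (\int[mu]_(s in sphere R N) (`|dot (g x) s| ^+ 2)%:E +
     \int[nu]_(z in ~` [set 0%R])
        (`|u (x + z)%R - u x| ^+ 2 / enorm z ^+ 2)%:E).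

End functionals.

(* Main.v *)
(** For u in H^1 write D_u(z) = ||u(. + z) - u|| / |z|, with the L^2 norm.  By
    Tonelli, F_eps[u] is one half of the integral of rho_eps D_u^2.  The function
    D_u^2 is bounded, tends to 0 at infinity, is continuous off 0, and has the
    limit ||grad u . sigma||^2 as z tends to 0 in the direction sigma; hence it
    extends continuously to the compactification of R^N \ {0} in which the modulus
    is |z| / (1 + |z|) and the origin is replaced by the sphere of directions.
    The measures rho_eps dz have bounded mass on balls and negligible weight
    against D_u^2 outside large balls, so along a subsequence they converge
    weakly on this compactification.  The limit measure yields mu on the sphere
    at 0 and nu in between; at infinity D_u vanishes.

    The limit measure is obtained as the image of the Lebesgue measure of an
    interval [0, L) by a measurable map Y, which avoids any representation theorem
    for functionals.  The behaviour of D_u at 0 comes from an L^2 Taylor formula,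
    proved by testing the weak gradient on bumps and by density of the bumps. *)
Require Import Defs.
From HB Require Import structures.
From mathcomp Require Import all_boot all_order all_algebra.
From mathcomp Require Import all_classical all_reals all_analysis.
From mathcomp Require Import measurable_realfun.
From mathcomp Require Import ring lra zify.
Import Order.TTheory GRing.Theory Num.Theory.
Import numFieldNormedType.Exports.
Local Open Scope classical_set_scope.
Local Open Scope ring_scope.
Set Implicit Arguments.
Unset Strict Implicit.
Unset Printing Implicit Defensive.

(** * Integration on R^N *)

(** The subsequence and the measures must be fixed before any [u] is seen. Compactness is therefore
    applied to the kernels alone, and [u] enters afterwards only as a test function that is
    continuous in the chart coordinates. One choice of indices serves all radii: the kernel of index
    j satisfies the bound for the radius j+1 with M+1 in place of M. Since ||u(. + z) - u|| <=
    2||u||, its part outside the ball of radius j+1 contributes at most a multiple of ||u||^2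
    (M+1)/(j+1)^2, which vanishes along every subsequence. The other obstacle is measurability. The
    kernels, [u] and its gradient are only Lebesgue measurable, while Tonelli is applied to Borel
    functions on products, so each of them is set to 0 on a Borel null set. In the energies this
    changes the integrand on a null set of pairs only. In the limit functional [nu] may charge
    Lebesgue null sets; there it is used that a null set Z satisfies nu(Z - x) = 0 for almost every
    x. *)

Section arbitrary_integrands.
Context d (T : measurableType d) (R : realType) (mu : {measure set T -> \bar R}).
Local Open Scope ereal_scope.
Implicit Types (D Z : set T) (f g : T -> \bar R).
Import HBNNSimple.

(* The integral is a supremum over simple functions, so it is monotone and
   insensitive to null sets without any measurability of the integrands. *)
Lemma ge0_le_integral_off_null D Z f g : measurable Z -> mu Z = 0 ->
  (forall x, D x -> 0 <= f x) -> (forall x, D x -> 0 <= g x) ->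
  (forall x, D x -> ~ Z x -> f x <= g x) ->
  \int[mu]_(x in D) f x <= \int[mu]_(x in D) g x.
Proof.
move=> mZ Z0 f0 g0 fg.
rewrite integral_mkcond [leRHS]integral_mkcond.
have {}f0 x : 0 <= (f \_ D) x by rewrite erestrict_ge0.
have {}g0 x : 0 <= (g \_ D) x by rewrite erestrict_ge0.
have {}fg x : ~ Z x -> (f \_ D) x <= (g \_ D) x.
  by move=> Zx; rewrite !patchE; case: ifPn => // /set_mem Dx; exact: fg.
move: (f \_ D) (g \_ D) f0 g0 fg => {}f {}g f0 g0 fg.
rewrite !ge0_integralTE//; apply: ge_ereal_sup => _ [h /= hf <-].
have mZC : measurable (~` Z) by exact: measurableC.
(* Cutting [h] off on [Z] keeps its integral and brings it below [g] everywhere. *)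
pose h' := proj_nnsfun h mZC.
have -> : sintegral mu h = sintegral mu h'.
  rewrite -!integralT_nnsfun; apply: ge0_ae_eq_integral => //.
  - by apply/measurable_EFinP.
  - by apply/measurable_EFinP.
  - by move=> x _; rewrite lee_fin.
  - by move=> x _; rewrite lee_fin.
  - exists Z; split => // x /= /not_implyP[_]; apply: contra_notP => Zx.
    by rewrite /h' /proj_nnsfun /= mindicE mem_set// mulr1.
apply: ereal_sup_ubound; exists h' => //= x.
rewrite /h' /proj_nnsfun /= mindicE; case: (pselect (Z x)) => Zx.
  by rewrite memNset ?mulr0//; exact.
by rewrite mem_set// mulr1; apply: le_trans (hf x) _; exact: fg.
Qed.

Lemma ge0_le_integral_nonmeas D f g :
  (forall x, D x -> 0 <= f x) -> (forall x, D x -> f x <= g x) ->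
  \int[mu]_(x in D) f x <= \int[mu]_(x in D) g x.
Proof.
move=> f0 fg; apply: (@ge0_le_integral_off_null _ set0) => //.
  by move=> x Dx; apply: le_trans (fg x Dx); exact: f0.
by move=> x Dx _; exact: fg.
Qed.

Lemma eq_integral_off_null D Z f g : measurable Z -> mu Z = 0 ->
  (forall x, D x -> ~ Z x -> f x = g x) ->
  \int[mu]_(x in D) f x = \int[mu]_(x in D) g x.
Proof.
move=> mZ Z0 fg; rewrite integralE [RHS]integralE.
have H (f1 f2 : T -> \bar R) : (forall x, 0 <= f1 x) -> (forall x, 0 <= f2 x) ->
    (forall x, D x -> ~ Z x -> f1 x = f2 x) ->
    \int[mu]_(x in D) f1 x = \int[mu]_(x in D) f2 x.
  move=> f10 f20 f12; apply/eqP; rewrite eq_le; apply/andP; split;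
    apply: (ge0_le_integral_off_null mZ Z0) => // x Dx Zx; by rewrite f12.
by congr (_ - _); apply: H => // x Dx Zx; rewrite ?funeposE ?funenegE fg.
Qed.

End arbitrary_integrands.

(** * Lebesgue measurable functions made Borel off a null set *)

Section borel_representative.
Variables (R : realType) (N : nat).
Local Notation V := 'rV[R]_N.
Local Notation leb := (@lebesgue_rV R N).

(** Each superlevel set at a rational height differs from a Borel set by part of a Borel null set,
    and [Z] is the union of these countably many null sets. Allowing every larger Borel [Z'] makes
    it possible to treat several functions with one common null set. *)
Lemma lebesgue_measurable_borel (f : V -> R) : lebesgue_measurable_fun f ->
  exists Z, [/\ measurable Z, leb Z = 0%E &
    forall Z', measurable Z' -> Z `<=` Z' -> measurable_fun setT (f \_ (~` Z'))].
Proof.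
move=> mf.
have /choice[Zq HZq] : forall q : rat, exists Z, [/\ measurable Z, leb Z = 0%E &
    forall Z', measurable Z' -> Z `<=` Z' ->
     measurable ((f @^-1` `]ratr q, +oo[%classic) `&` ~` Z')].
  move=> q; have mq : measurable `](ratr q : R), +oo[%classic by [].
  have [A mA [B [C [mC C0 BC]]] ABq] := mf _ mq.
  exists C; split => // Z' mZ' CZ'; rewrite -ABq setIUl.
  rewrite [X in _ `|` X](_ : _ = set0) ?setU0.
    by apply: measurableI => //; exact: measurableC.
  by apply/seteqP; split => // x [/BC/CZ'].
exists (\bigcup_q Zq q); split.
- by apply: countable_bigcupT_measurable => // q; have [] := HZq q.
- apply/eqP; rewrite eq_le measure_ge0 andbT.
  pose F (n : nat) := if @unpickle rat n is Some q then Zq q else set0.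
  have -> : \bigcup_q Zq q = \bigcup_n F n.
    apply/seteqP; split => x [] => [q _ Zx|n _].
      by exists (pickle q); [exact: I|rewrite /F pickleK].
    by rewrite /F; case: unpickle => [q Zx|[]]; exists q.
  have mF n : measurable (F n).
    by rewrite /F; case: unpickle => [q|]; [have [] := HZq q|exact: measurable0].
  apply: le_trans (measure_sigma_subadditive _ mF _ (@subset_refl _ _)) _.
    exact: bigcupT_measurable.
  rewrite eseries0// => n _ _; rewrite /F; case: unpickle => [q|].
    by have [] := HZq q.
  exact: measure0.
move=> Z' mZ' ZZ'.
apply: (measurability _ (RGenOInfty.measurableE R)) => _ [_ [a ->] <-].
rewrite setTI.
have mq q : measurable ((f @^-1` `]ratr q, +oo[%classic) `&` ~` Z').
  have [_ _] := HZq q; apply => //.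
  by apply: subset_trans ZZ' => x; exists q.
have mU : measurable (\bigcup_(q in [set q : rat | a < ratr q])
    ((f @^-1` `]ratr q, +oo[%classic) `&` ~` Z')).
  rewrite bigcup_mkcond; apply: countable_bigcupT_measurable => // q.
  by case: ifPn.
(* On [Z'] the function is now 0, which exceeds [a] exactly when a < 0. *)
rewrite [X in measurable X](_ : _ = (\bigcup_(q in [set q : rat | a < ratr q])
    ((f @^-1` `]ratr q, +oo[%classic) `&` ~` Z')) `|`
    (if a < 0 then Z' else set0)); first by apply: measurableU => //; case: ifPn.
apply/seteqP; split => x /=.
  rewrite in_itv/= andbT patchE; case: ifPn => [/set_mem Zx afx|/negP Zx a0].
    left; have /rat_in_itvoo[q] := afx; rewrite in_itv/= => /andP[aq qf].
    by exists q => //; split => //=; rewrite in_itv/= andbT.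
  by right; rewrite a0; apply: contrapT => Z'x; apply: Zx; rewrite inE.
move=> [[q /= aq [/= + Z'x]]|].
  by rewrite !in_itv/= !andbT patchE mem_set//; exact: lt_trans.
by rewrite in_itv/= andbT; case: ifPn => // a0 Z'x; rewrite patchE memNset//; exact.
Qed.

End borel_representative.

(** The measure structure of a pushforward takes the proof of measurability as an argument; it is
    named here with that argument explicit. *)
Definition image_measure d1 d2 (T1 : measurableType d1) (T2 : measurableType d2)
    (R : realType) (m : {measure set T1 -> \bar R}) (f : T1 -> T2)
    (mf : measurable_fun setT f) : {measure set T2 -> \bar R} :=
  measure_function_pushforward__canonical__measure_function_Measure m mf.

(** * Translation invariance of the Lebesgue measure of R^N *)

Section translation.
Variable R : realType.

Lemma cons_rV_ord0 n (t : R) (x : 'rV[R]_n) : cons_rV (t, x) 0 ord0 = t.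
Proof. by have /(congr1 fst) := cons_rVK (t, x). Qed.

Lemma cons_rV_lift n (t : R) (x : 'rV[R]_n) i :
  cons_rV (t, x) 0 (lift ord0 i) = x 0 i.
Proof.
have /(congr1 snd) /(congr1 (fun x : 'rV[R]_n => x 0 i)) := cons_rVK (t, x).
by rewrite /= mxE rshift1.
Qed.

Lemma rsubmx_lift n (x : 'rV[R]_n.+1) i :
  rsubmx (x : 'rV[R]_(1 + n)) 0 i = x 0 (lift ord0 i).
Proof. by rewrite mxE rshift1. Qed.

Lemma lebesgue_measure_shift (a : R) (A : set R) : measurable A ->
  lebesgue_measure ((fun x => x + a) @^-1` A) = lebesgue_measure A.
Proof.
move=> mA.
have ms : measurable_fun setT ((fun x => x + a) : R -> measurableTypeR R).
  exact: measurable_funD.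
apply/esym; rewrite -[RHS]/(pushforward lebesgue_measure
  ((fun x => x + a) : R -> measurableTypeR R) A).
apply: lebesgue_measure_unique => // _ [[b c]] _ <-.
rewrite /pushforward /=.
transitivity (lebesgue_measure `]b - a, c - a]%classic); last first.
  congr (lebesgue_measure _).
  by apply/seteqP; split => x /=; rewrite !in_itv/= ltrBlDr lerBrDr.
rewrite [LHS]lebesgue_measure_itv [RHS]lebesgue_measure_itv /= !lte_fin ltrD2r.
by case: ifPn => // _; rewrite -!EFinB; congr EFin; ring.
Qed.

Lemma measurable_fun_addrV d (T : measurableType d) n (f g : T -> 'rV[R]_n) :
  measurable_fun setT f -> measurable_fun setT g ->
  measurable_fun setT (fun t => f t + g t).
Proof.
move=> mf mg; apply: measurable_fun_rV => i.
under eq_fun do rewrite mxE.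
apply: measurable_funD.
  by apply: (measurableT_comp (@measurable_coord_rV R n i)).
by apply: (measurableT_comp (@measurable_coord_rV R n i)).
Qed.

Lemma measurable_fun_scalerV d (T : measurableType d) n (f : T -> R) (g : T -> 'rV[R]_n) :
  measurable_fun setT f -> measurable_fun setT g ->
  measurable_fun setT (fun t => f t *: g t).
Proof.
move=> mf mg; apply: measurable_fun_rV => i.
under eq_fun do rewrite mxE.
apply: measurable_funM => //.
by apply: (measurableT_comp (@measurable_coord_rV R n i)).
Qed.

Lemma measurable_fun_opprV d (T : measurableType d) n (f : T -> 'rV[R]_n) :
  measurable_fun setT f -> measurable_fun setT (fun t => - f t).
Proof.
move=> mf; under eq_fun do rewrite -scaleN1r.
exact: measurable_fun_scalerV.
Qed.

(** By induction on the dimension. Through [cons_rV] a translation acts separately on the first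
    coordinate and on the others, so the translated product measure has the right values on
    rectangles, and uniqueness of the product measure concludes. *)
Lemma lebesgue_rV_shift n (a : 'rV[R]_n) (A : set 'rV[R]_n) : measurable A ->
  lebesgue_rV R n ((fun x => x + a) @^-1` A) = lebesgue_rV R n A.
Proof.
elim: n a A => [|n IHn] a A mA.
  have -> // : (fun x => x + a) @^-1` A = A.
  by apply/seteqP; split => x /=; rewrite [a]thinmx0 addr0.
have mc := @measurable_cons_rV R n.
rewrite /= /cons_measure /pushforward -comp_preimage.
pose a0 : R := a 0 0; pose a' : 'rV[R]_n := rsubmx (a : 'rV[R]_(1 + n)).
pose S (p : R * 'rV[R]_n) := (p.1 + a0, p.2 + a').
have -> : (fun x => x + a) \o @cons_rV R n = @cons_rV R n \o S.
  apply/funext => -[t x] /=; apply/rowP => i; rewrite mxE.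
  case: (unliftP ord0 i) => [j|] ->; first by rewrite !cons_rV_lift mxE rsubmx_lift.
  by rewrite !cons_rV_ord0.
rewrite comp_preimage.
have mS : measurable_fun setT (S : measurableTypeR R * 'rV[R]_n -> measurableTypeR R * 'rV[R]_n).
  apply/measurable_fun_pairP; split.
    by apply: (measurable_funD (f := fst) (g := cst a0)).
  by apply: (measurable_fun_addrV (f := snd) (g := cst a')).
have mB : measurable (@cons_rV R n @^-1` A).
  by rewrite -[X in measurable X]setTI; exact: mc.
apply/esym; have unique := @product_measure_unique _ _ _ _ R
  (@lebesgue_measure R : {sigma_finite_measure set _ -> \bar R})
  (lebesgue_rV R n) (image_measure (lebesgue_measure \x lebesgue_rV R n)%E mS).
apply: (unique) => // B C mB' mC; rewrite /image_measure /= /pushforward.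
have -> : S @^-1` (B `*` C) =
  ((fun x => x + a0) @^-1` B) `*` ((fun x => x + a') @^-1` C) by [].
rewrite product_measure1E//.
- by rewrite IHn//; congr (_ * _)%E; exact: lebesgue_measure_shift.
- rewrite -[X in measurable X]setTI.
  by apply: (measurable_funD (f := id) (g := cst a0)).
- rewrite -[X in measurable X]setTI.
  by apply: (measurable_fun_addrV (f := id) (g := cst a')).
Qed.

Lemma measurable_shift n (a : 'rV[R]_n) : measurable_fun setT (fun x : 'rV[R]_n => x + a).
Proof. exact: (measurable_fun_addrV (f := id) (g := cst a)). Qed.

Lemma ge0_integral_shift n (a : 'rV[R]_n) (f : 'rV[R]_n -> \bar R) :
  measurable_fun setT f -> (forall x, 0 <= f x)%E ->
  (\int[lebesgue_rV R n]_x f (x + a)%R = \int[lebesgue_rV R n]_x f x)%E.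
Proof.
move=> mf f0; have ms := measurable_shift a.
have <- := @ge0_integral_pushforward _ _ _ _ _ _ ms (lebesgue_rV R n) setT f measurableT mf.
  2: by move=> x _.
by apply: eq_measure_integral => //= A mA _; rewrite /pushforward lebesgue_rV_shift.
Qed.

Lemma integral_shift n (a : 'rV[R]_n) (f : 'rV[R]_n -> \bar R) :
  measurable_fun setT f ->
  (\int[lebesgue_rV R n]_x f (x + a)%R = \int[lebesgue_rV R n]_x f x)%E.
Proof.
move=> mf; rewrite integralE [RHS]integralE; congr (_ - _)%E.
  rewrite -(ge0_integral_shift a (f := (f^\+)%E))//; last exact: measurable_funepos.
  by apply: eq_integral => x _; rewrite !funeposE.
rewrite -(ge0_integral_shift a (f := (f^\-)%E))//; last exact: measurable_funeneg.
by apply: eq_integral => x _; rewrite !funenegE.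
Qed.

Definition box n (a b : 'I_n -> R) : set 'rV[R]_n :=
  [set x | forall i, a i < x 0 i < b i].

Lemma measurable_box n (a b : 'I_n -> R) : measurable (box a b).
Proof.
rewrite (_ : box a b = \bigcap_(i in [set: 'I_n])
   ((fun x : 'rV[R]_n => x 0 i) @^-1` `]a i, b i[%classic)).
  apply: fin_bigcap_measurable => // i _; rewrite -[X in measurable X]setTI.
  by apply: measurable_coord_rV.
apply/seteqP; split => x /= h i; first by move=> _ /=; rewrite in_itv/=; exact: h.
by have := h i Logic.I; rewrite /= in_itv/=.
Qed.

Lemma lebesgue_rV_box n (a b : 'I_n -> R) : (lebesgue_rV R n (box a b) < +oo)%E.
Proof.
elim: n a b => [|n IHn] a b; first by rewrite /= diracE ltry.
rewrite /= /cons_measure /pushforward.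
have -> : @cons_rV R n @^-1` box a b = (`]a ord0, b ord0[%classic `*`
    box (fun i => a (lift ord0 i)) (fun i => b (lift ord0 i))).
  apply/seteqP; split => -[t x] /=; rewrite /box /= in_itv/=.
    move=> h; split => [|i]; first by have := h ord0; rewrite cons_rV_ord0.
    by have := h (lift ord0 i); rewrite cons_rV_lift.
  move=> [h1 h2] i; case: (unliftP ord0 i) => [j|] ->; last by rewrite cons_rV_ord0.
  by rewrite cons_rV_lift; exact: h2.
rewrite product_measure1E//; last exact: measurable_box.
rewrite lte_mul_pinfty//.
  rewrite ge0_fin_numE//; have /= -> := @lebesgue_measure_itv R `]a ord0, b ord0[.
  by case: ifPn => // _; rewrite -EFinB ltry.
Qed.

(** In dimension 0 the measure is a Dirac mass, whence the restriction. The lemma allows the origin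
    to be discarded when N >= 1. *)
Lemma lebesgue_rV_set1 n (x : 'rV[R]_n) : (0 < n)%N -> lebesgue_rV R n [set x] = 0%E.
Proof.
case: n x => // n x _; rewrite /= /cons_measure /pushforward.
have -> : @cons_rV R n @^-1` [set x] = [set (@uncons_rV R n x).1] `*` [set (@uncons_rV R n x).2].
  apply/seteqP; split => -[t y] /=.
    by move=> <-; have [] := cons_rVK (t, y).
  move=> [-> ->]; apply/rowP => i.
  case: (unliftP ord0 i) => [j|] ->; last by rewrite cons_rV_ord0.
  by rewrite cons_rV_lift rsubmx_lift.
rewrite product_measure1E//; first by have /= -> := @lebesgue_measure_set1 R (x 0 0); rewrite mul0e.
rewrite (_ : [set _] = \bigcap_(i in [set: 'I_n])
   ((fun y : 'rV[R]_n => y 0 i) @^-1` [set (uncons_rV x).2 0 i])).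
  apply: fin_bigcap_measurable => // i _; rewrite -[X in measurable X]setTI.
  by apply: measurable_coord_rV.
apply/seteqP; split => y /= h; first by move=> i _; rewrite h.
by apply/rowP => i; exact: h.
Qed.

End translation.

(** * Finite Borel measures are Radon *)

Section radon.
Variables (R : realType) (n : nat).
Local Notation V := 'rV[R]_n.
Variable mu : {finite_measure set V -> \bar R}.

Lemma measurable_closed (F : set V) : closed F -> measurable F.
Proof.
by move=> cF; rewrite -[F]setCK; apply: measurableC; apply: open_measurable_rV; rewrite openC.
Qed.

(** The inner set is closed rather than compact so that the property passes to complements by
    exchanging the two sets. Compactness is recovered at the end by intersecting with a large closed
    cube. *)
Definition squeezed (A : set V) := forall e : R, 0 < e -> exists F U : set V,
  [/\ closed F, open U, F `<=` A, A `<=` U & (mu (U `\` F) <= e%:E)%E].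

Lemma squeezedC A : squeezed A -> squeezed (~` A).
Proof.
move=> sA e /sA[F [U [cF oU FA AU UF]]]; exists (~` U), (~` F); split.
- by rewrite closedC.
- by rewrite openC.
- exact: subsetC.
- exact: subsetC.
- by rewrite setDE setCK setIC -setDE.
Qed.

Lemma decreasing_small (B : nat -> set V) (e : R) : (forall k, measurable (B k)) ->
  (forall k m, (k <= m)%N -> B m `<=` B k) -> \bigcap_k B k = set0 -> 0 < e ->
  exists k, (mu (B k) <= e%:E)%E.
Proof.
move=> mB dB B0 e0.
have : mu (B k) @[k --> \oo] --> mu (\bigcap_k B k).
  apply: nonincreasing_cvg_mu => //.
  - by rewrite -ge0_fin_numE//; exact: fin_num_measure.
  - by apply: bigcapT_measurable.
  - by move=> k m km; apply/subsetPset; exact: dB.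
rewrite B0 measure0 => /fine_cvgP[_ /cvgrPdist_le/(_ _ e0)] [k _ /(_ k (leqnn _))] /=.
rewrite sub0r normrN => h; exists k.
rewrite -(fineK (fin_num_measure mu _ (mB k))) lee_fin.
by apply: le_trans h; exact: ler_norm.
Qed.

Lemma squeezed_open U : open U -> squeezed U.
Proof.
move=> oU e e0.
(* The points at distance at least 1/(k+1) from the complement of [U]: closed sets that exhaust
   [U]. *)
pose F k : set V := [set x | ball x (k.+1%:R^-1 : R) `<=` U].
have k0 k : 0 < k.+1%:R^-1 :> R by rewrite invr_gt0.
have cF k : closed (F k).
  rewrite -openC (_ : ~` F k = \bigcup_(y in ~` U) ball y (k.+1%:R^-1 : R)).
    by apply: bigcup_open => y _; exact: ball_open.
  apply/seteqP; split => x /=.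
    by move=> /existsNP[y /not_implyP[xy Uy]]; exists y => //; exact: ball_sym.
  by move=> [y Uy yx] h; apply: Uy; apply: h; exact: ball_sym.
have [k Hk] : exists k, (mu (U `\` F k) <= e%:E)%E.
  apply: (decreasing_small (B := fun k => U `\` F k)) => //.
  - move=> k; apply: measurableD; first exact: open_measurable_rV.
    exact: measurable_closed.
  - move=> k m km x [Ux Fx]; split => // Fk; apply: Fx => y xy; apply: Fk.
    by apply: le_ball xy; rewrite lef_pV2 ?posrE// ler_nat.
  - apply/seteqP; split => // x xU; have [Ux _] := xU 0 Logic.I.
    have /nbhs_ballP[d /= d0 dU] : nbhs x U by exact: open_nbhs_nbhs.
    have [k _ /(_ k (leqnn _)) /= kd] := near_infty_natSinv_lt (PosNum d0).
    have [_] := xU k Logic.I; apply => y xy; apply: dU.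
    by apply: le_ball xy; exact: ltW.
by exists (F k), U; split => // x; apply; exact: ballxx.
Qed.

(** The errors e/2^(k+2) add up to e/2. The union of the inner closed sets need not be closed, so it
    is truncated to finitely many of them, at the cost of the other e/2. *)
Lemma squeezed_bigcup (A : nat -> set V) : (forall k, squeezed (A k)) -> squeezed (\bigcup_k A k).
Proof.
move=> sA e e0; have e20 : 0 < e / 2 by rewrite divr_gt0.
have /choice[FU HFU] : forall k, exists FU : set V * set V,
   [/\ closed FU.1, open FU.2, FU.1 `<=` A k, A k `<=` FU.2 &
    (mu (FU.2 `\` FU.1) <= (e / 2 / (2 ^ k.+1)%:R)%:E)%E].
  move=> k; have ek : 0 < e / 2 / (2 ^ k.+1)%:R by rewrite divr_gt0// ltr0n expn_gt0.
  by have [F [U H]] := sA k _ ek; exists (F, U).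
pose U := \bigcup_k (FU k).2; pose G m := \bigcup_(k < m) (FU k).1.
have oU : open U by apply: bigcup_open => k _; have [] := HFU k.
have cG m : closed (G m).
  apply: closed_bigcup => [|k _]; first exact: finite_II.
  by have [] := HFU k.
have mF k : measurable (FU k).1 by apply: measurable_closed; have [] := HFU k.
have mU k : measurable (FU k).2 by apply: open_measurable_rV; have [] := HFU k.
have mG m : measurable (G m) by exact: measurable_closed.
pose G' := \bigcup_k (FU k).1.
have mG' : measurable G' by exact: bigcup_measurable.
have mUU : measurable U by exact: bigcup_measurable.
have [m Hm] : exists m, (mu (G' `\` G m) <= (e / 2)%:E)%E.
  apply: (decreasing_small (B := fun m => G' `\` G m)) => //.
  - by move=> k; exact: measurableD.
  - move=> k m km x [G'x Gx]; split => // -[i /= ik Fx]; apply: Gx; exists i => //=.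
    exact: leq_trans ik km.
  - apply/seteqP; split => // x xG; have [[k _ Fx] _] := xG 0 Logic.I.
    by have [_] := xG k.+1 Logic.I; apply; exists k => /=.
exists (G m), U; split => //.
- by move=> x [k _ Fx]; exists k => //; have [_ _ h _ _] := HFU k; exact: h.
- by move=> x [k _ Ax]; exists k => //; have [_ _ _ h _] := HFU k; exact: h.
apply: (@le_trans _ _ (mu (\bigcup_k ((FU k).2 `\` (FU k).1)) + mu (G' `\` G m))%E).
  apply: (@le_trans _ _ (mu ((\bigcup_k ((FU k).2 `\` (FU k).1)) `|` (G' `\` G m)))).
    apply: le_measure; rewrite ?inE.
    - exact: measurableD.
    - apply: measurableU; last exact: measurableD.
      by apply: bigcup_measurable => k _; exact: measurableD.
    - move=> x [[k _ Ux] Gx]; have [G'x|G'x] := pselect (G' x); first by right.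
      by left; exists k => //; split => // Fx; apply: G'x; exists k.
  apply: measureU2; last exact: measurableD.
  by apply: bigcup_measurable => k _; exact: measurableD.
rewrite [e]splitr EFinD; apply: leeD => //.
apply: (@le_trans _ _ (\sum_(k <oo) mu ((FU k).2 `\` (FU k).1))%E).
  apply: measure_sigma_subadditive => //.
  - by move=> k; exact: measurableD.
  - by apply: bigcup_measurable => k _; exact: measurableD.
apply: le_trans (epsilon_trick0 xpredT (ltW e20)).
by apply: lee_nneseries => k _ //; have [] := HFU k.
Qed.

Lemma measurable_squeezed A : measurable A -> squeezed A.
Proof.
move=> mA; suff : <<s (@open V) >> `<=` squeezed by apply.
apply: smallest_sub; last exact: squeezed_open.
split.
- by apply: squeezed_open; exact: open0.
- by move=> B sB; rewrite setTD; exact: squeezedC.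
- exact: squeezed_bigcup.
Qed.

Theorem finite_measure_radon : radon mu.
Proof.
have fin A : measurable A -> mu A \is a fin_num by exact: fin_num_measure.
have mcK (K : set V) : compact K -> measurable K.
  by move=> cK; apply: measurable_closed; apply: compact_closed => //; exact: norm_hausdorff.
split.
- by move=> K cK; rewrite -ge0_fin_numE//; apply: fin; exact: mcK.
- move=> A mA; apply/eqP; rewrite eq_le; apply/andP; split.
    apply: le_ereal_inf_tmp => _ [U [oU AU] <-]; apply: le_measure; rewrite ?inE//.
    exact: open_measurable_rV.
  apply/lee_addgt0Pr => e e0; have [F [U [cF oU FA AU UF]]] := measurable_squeezed mA e0.
  apply: (@le_trans _ _ (mu U)); first by apply: ereal_inf_lbound; exists U.
  have mF := measurable_closed cF; have mU := open_measurable_rV oU.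
  apply: (@le_trans _ _ (mu (A `|` (U `\` F)))).
    apply: le_measure; rewrite ?inE//; first by apply: measurableU => //; exact: measurableD.
    move=> x Ux; have [/FA|] := pselect (F x); first by left.
    by right.
  apply: le_trans (measureU2 _ _ _) _ => //; first exact: measurableD.
  exact: leeD.
- move=> A mA; apply/eqP; rewrite eq_le; apply/andP; split; last first.
    apply: ge_ereal_sup => _ [K [cK KA] <-]; apply: le_measure; rewrite ?inE//.
    exact: mcK.
  apply/lee_addgt0Pr => e e0; have e20 : 0 < e / 2 by rewrite divr_gt0.
  have [F [U [cF oU FA AU UF]]] := measurable_squeezed mA e20.
  have mF := measurable_closed cF; have mU := open_measurable_rV oU.
  pose Q (k : nat) := [set v : V | forall i, `[- k%:R, k%:R]%classic (v ord0 i)].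
  have cQ k : compact (Q k).
    apply: (@rV_compact R n (fun i => `[- k%:R, k%:R]%classic)) => i.
    exact: segment_compact.
  have [k Hk] : exists k, (mu (F `\` Q k) <= (e / 2)%:E)%E.
    apply: (decreasing_small (B := fun k => F `\` Q k)) => //.
    - by move=> k; apply: measurableD => //; exact: mcK.
    - move=> k m km x [Fx Qx]; split => // Qk; apply: Qx => i.
      have := Qk i; rewrite /= !in_itv/= -!ler_norml => /le_trans; apply.
      by rewrite ler_nat.
    - apply/seteqP; split => // x xF.
      have [_] := xF (\max_(i < n) (Num.truncn `|x ord0 i|%R).+1) Logic.I; apply => i.
      rewrite /= in_itv/= -ler_norml; apply: le_trans (ltW (truncnS_gt _)) _.
      rewrite ler_nat; exact: (leq_bigmax i).
  have mQ := mcK _ (cQ k).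
  have mFQ : measurable (F `&` Q k) by exact: measurableI.
  apply: (@le_trans _ _ (mu (F `&` Q k) + e%:E)%E); last first.
    apply: leeD => //; apply: ereal_sup_ubound; exists (F `&` Q k) => //; split.
      by rewrite setIC; apply: compact_closedI.
    by move=> x [/FA].
  apply: (@le_trans _ _ (mu ((F `&` Q k) `|` ((F `\` Q k) `|` (U `\` F))))).
    apply: le_measure; rewrite ?inE//.
      by apply: measurableU => //; apply: measurableU; exact: measurableD.
    move=> x /AU Ux; have [Fx|Fx] := pselect (F x); last by right; right.
    by have [Qx|Qx] := pselect (Q k x); [left|right; left].
  apply: le_trans (measureU2 _ _ _) _ => //; first by apply: measurableU; exact: measurableD.
  apply: leeD => //; rewrite [e]splitr EFinD.
  apply: le_trans (measureU2 _ _ _) _; [exact: measurableD|exact: measurableD|].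
  exact: leeD.
Qed.

End radon.

(** * Smooth bumps *)

Section flat_function.
Variable R : realType.
Implicit Types (P Q : {poly R}) (x y z : R).

(* Smooth functions vanishing on the negative half-line; the class is closed
   under derivation. *)
Definition flat P x : R := if 0 < x then P.[x^-1] * expR (- x^-1) else 0.

(** This is y/n <= exp(y/n) raised to the power n. *)
Lemma expr_le_expR n y : 0 <= y -> y ^+ n <= n%:R ^+ n * expR y.
Proof.
case: n => [|n] y0; first by rewrite !expr0 mul1r -expR0 ler_expR.
have n0 : 0 < n.+1%:R :> R by rewrite ltr0n.
rewrite -{1}[y](mulfVK (lt0r_neq0 n0)) exprMn mulrC ler_wpM2l ?exprn_ge0//.
rewrite -[X in _ <= expR X](mulfVK (lt0r_neq0 n0)) expRM_natr.
apply: lerXn2r; rewrite ?nnegrE ?expR_ge0 ?divr_ge0//.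
by apply: le_trans (expR_ge1Dx _); rewrite lerDr.
Qed.

Lemma horner_le_expR P : exists2 C, 0 <= C & forall y, 0 <= y -> `|P.[y]| <= C * expR y.
Proof.
exists (\sum_(i < size P) `|P`_i| * i%:R ^+ i).
  by apply: sumr_ge0 => i _; rewrite mulr_ge0// exprn_ge0.
move=> y y0; rewrite horner_coef; apply: le_trans (ler_norm_sum _ _ _) _.
rewrite mulr_suml; apply: ler_sum => i _.
rewrite normrM -mulrA ler_wpM2l// ger0_norm ?exprn_ge0//.
exact: expr_le_expR.
Qed.

(** The exponential bound is applied to the polynomial P X at 1/x, and the extra factor 1/x is moved
    to the other side. *)
Lemma flat_le P : exists2 C, 0 <= C & forall x, `|flat P x| <= C * `|x|.
Proof.
have [C C0 HC] := horner_le_expR (P * 'X).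
exists C => // x; rewrite /flat; case: ifPn => [x0|_]; last by rewrite normr0 mulr_ge0.
have xV0 : 0 <= x^-1 by rewrite invr_ge0 ltW.
have := HC _ xV0; rewrite hornerM hornerX normrM (ger0_norm xV0).
rewrite normrM (ger0_norm (expR_ge0 _)) (gtr0_norm x0) expRN => H.
rewrite ler_pdivrMr ?expR_gt0// mulrAC.
by rewrite -ler_pdivrMr.
Qed.

Lemma flat_continuous0 P : {for 0, continuous (flat P)}.
Proof.
have [C C0 HC] := flat_le P.
have E : flat P 0 = 0 by rewrite /flat ltxx.
rewrite /prop_for /continuous_at E; apply/cvgr0Pnorm_le => e e0.
have C1 : 0 < C + 1 by rewrite ltr_wpDl.
exists (e / (C + 1)); first by rewrite /= divr_gt0.
move=> x /=; rewrite sub0r normrN ltr_pdivlMr// => xe; apply: le_trans (HC x) _.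
by apply: le_trans (ltW xe); rewrite mulrC ler_wpM2l// lerDl.
Qed.

(** With y = 1/x one has dy/dx = -y^2, so P(y) exp(-y) has derivative y^2 (P(y) - P'(y)) exp(-y) in
    x. *)
Definition flat_deriv P : {poly R} := 'X^2 * (P - P^`()).

Lemma is_derive_flat P x : is_derive x 1 (flat P) (flat (flat_deriv P) x).
Proof.
have [x0|x0|->] := ltgtP x 0.
- apply: (near_eq_is_derive (f := cst 0)).
    near=> y; rewrite /flat ifN// -leNgt ltW//; near: y; exact: lt_nbhsl.
  by rewrite {1}/flat ifN; [exact: is_derive_cst|rewrite -leNgt ltW].
- apply: (near_eq_is_derive (f := fun y => P.[y^-1] * expR (- y^-1))).
    near=> y; rewrite /flat ifT//; near: y; exact: lt_nbhsr.
  have xn0 : x != 0 by rewrite gt_eqF.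
  have dV : is_derive x 1 (fun y : R => y^-1) (- x ^- 2).
    apply: is_derive_eq; first by apply: (@is_deriveV _ id x 1 1).
    by rewrite /GRing.scale/= mulr1.
  have dP : is_derive x 1 (horner P \o (fun y => y^-1)) (P^`().[x^-1] * - x ^- 2).
    by apply: is_derive1_comp.
  have dE : is_derive x 1 (expR \o (fun y => - y^-1)) (expR (- x^-1) * x ^- 2).
    apply: is_derive1_comp.
    by apply: is_derive_eq; rewrite opprK.
  have := is_deriveM dP dE.
  rewrite /flat x0 /flat_deriv => D; apply: (is_derive_eq D).
  rewrite /= /GRing.scale/= !(hornerM, hornerD, hornerN, hornerX).
  by field.
(* At the origin the difference quotient is P(1/x) exp(-1/x) / x, which is again a flat function and
   hence continuous at 0. *)
apply/is_derive1_caratheodory; exists (flat (P * 'X)); split.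
- move=> z; rewrite subr0 /flat ltxx subr0; case: ifPn => z0; last by rewrite mul0r.
  by rewrite hornerM hornerX; field; rewrite gt_eqF.
- exact: flat_continuous0.
- by rewrite /flat ltxx.
Unshelve. all: by end_near. Qed.

End flat_function.

Section bump_class.
Variables (R : realType) (a b c : R).

(** Sums are included because the Leibniz rule produces two terms. The class is then stable under
    derivation, so that continuity of its members gives derivatives of all orders. The parameter [c]
    sets the steepness of the edges at [a] and [b]. *)
Inductive bump_fun : (R -> R) -> Prop :=
| bump_base P Q : bump_fun (fun x => flat P (c * (x - a)) * flat Q (c * (b - x)))
| bump_add f g : bump_fun f -> bump_fun g -> bump_fun (f \+ g).

Lemma bump_derive f : bump_fun f -> exists2 g, bump_fun g & forall x : R, is_derive x 1 f (g x).
Proof.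
elim=> [P Q|{}f1 f2 _ [g1 b1 d1] _ [g2 b2 d2]]; last first.
  by exists (g1 \+ g2); [exact: bump_add|move=> x; exact: is_deriveD].
exists ((fun x => flat (c *: flat_deriv P) (c * (x - a)) * flat Q (c * (b - x))) \+
        (fun x => flat P (c * (x - a)) * flat (- c *: flat_deriv Q) (c * (b - x)))).
  by apply: bump_add; exact: bump_base.
move=> x.
have d1 : is_derive x 1 (fun x : R => c * (x - a)) c.
  by apply: is_derive_eq; rewrite /GRing.scale/=; ring.
have d2 : is_derive x 1 (fun x : R => c * (b - x)) (- c).
  by apply: is_derive_eq; rewrite /GRing.scale/=; ring.
have D1 : is_derive x 1 (flat P \o (fun x : R => c * (x - a))) _ :=
  is_derive1_comp (is_derive_flat P _) d1.
have D2 : is_derive x 1 (flat Q \o (fun x : R => c * (b - x))) _ :=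
  is_derive1_comp (is_derive_flat Q _) d2.
have D := is_deriveM D1 D2; apply: (is_derive_eq D).
rewrite /GRing.scale/= /flat; case: ifP => _; case: ifP => _; rewrite ?hornerZ; ring.
Qed.

Hypothesis c0 : 0 < c.

Lemma bump_out f x : bump_fun f -> ~~ (a < x < b) -> f x = 0.
Proof.
move=> bf xab; elim: bf => [P Q|f1 f2 _ h1 _ h2]; last by rewrite /= h1 h2 addr0.
rewrite /flat !pmulr_rgt0// !subr_gt0; case: ifP => h1; last by rewrite mul0r.
by case: ifP => h2; [rewrite h1 h2 in xab|rewrite mulr0].
Qed.

End bump_class.

(** * Products of one-variable functions and bumps on R^N *)

Section tensor.
Variables (R : realType) (n : nat).
Local Notation V := 'rV[R]_n.
Implicit Types (F : 'I_n -> R -> R).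

Definition tensor F (x : V) : R := \prod_(i < n) F i (x 0 i).

Lemma differentiable_tensor F : (forall i x, derivable (F i) x 1) ->
  forall x, differentiable (tensor F) x.
Proof.
move=> dF x; rewrite /tensor.
elim: (index_enum _) => [|i s IHs].
  under eq_fun do rewrite big_nil; exact: differentiable_cst.
under eq_fun do rewrite big_cons; apply: differentiableM => //.
apply: (differentiable_comp (f := fun y : V => y 0 i)).
  exact: differentiable_coord.
by apply/derivable1_diffP; exact: dF.
Qed.

Lemma is_derive_tensor F j (g : R -> R) : (forall x : R, is_derive x 1 (F j) (g x)) ->
  forall x : V, is_derive x (delta_mx 0 j : V) (tensor F)
    (tensor (fun i => if i == j then g else F i) x).
Proof.
move=> dF x.
pose C := \prod_(i < n | i != j) F i (x 0 i).
have tE (h : R) : tensor F (h *: (delta_mx 0 j : V) + x) = F j (h + x 0 j) * C.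
  rewrite /tensor (bigD1 j)//= !mxE !eqxx mulr1; congr (_ * _).
  by apply: eq_bigr => i ij; rewrite !mxE (negbTE ij) andbF mulr0 add0r.
have -> : tensor (fun i => if i == j then g else F i) x = C * g (x 0 j).
  rewrite /tensor (bigD1 j)//= eqxx mulrC; congr (_ * _).
  by apply: eq_bigr => i ij; rewrite (negbTE ij).
have D1 : is_derive (x 0 j) 1 (C *: F j) (C * g (x 0 j)).
  exact: is_deriveZ.
have E : (fun h : R => h^-1 *: ((tensor F \o shift x) (h *: (delta_mx 0 j : V)) - tensor F x)) =
         (fun h : R => h^-1 *: (((C *: F j) \o shift (x 0 j)) (h *: 1) - (C *: F j) (x 0 j))).
  apply/funext => h /=; rewrite tE.
  have -> : tensor F x = F j (x 0 j) * C by rewrite /tensor (bigD1 j).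
  by rewrite /GRing.scale/= mulr1; congr (_ * (_ - _)); rewrite mulrC.
case: D1 => d1 <-; split; first by rewrite /derivable E; exact: d1.
by rewrite /derive E.
Qed.

Lemma derive_line (phi : V -> R) (x v : V) (t : R) : differentiable phi (x + t *: v) ->
  is_derive t 1 (fun s : R => phi (x + s *: v)) ('D_v phi (x + t *: v)).
Proof.
move=> dphi.
have E : (fun h : R => h^-1 *: (((fun s : R => phi (x + s *: v)) \o shift t) (h *: 1) - phi (x + t *: v))) =
   (fun h : R => h^-1 *: ((phi \o shift (x + t *: v)) (h *: v) - phi (x + t *: v))).
  apply/funext => h /=; congr (_ *: (phi _ - _)).
  by rewrite (mulr1 h : h%:A = h) scalerDl addrCA.
have := diff_derivable (v := v) dphi; rewrite /derivable -E => d1.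
by split=> //; rewrite /derive E.
Qed.

Lemma derive_partial (phi : V -> R) (x v : V) : differentiable phi x ->
  'D_v phi x = \sum_(i < n) v 0 i * partial i phi x.
Proof.
move=> dphi; rewrite deriveE// {1}(row_sum_delta v) linear_sum; apply: eq_bigr => i _.
by rewrite linearZ /partial deriveE.
Qed.

Section bump_tensor.
Variables (a b : 'I_n -> R) (c : R).
Hypothesis c0 : 0 < c.

Definition bump_tensor F := forall i, bump_fun (a i) (b i) c (F i).

Lemma bump_tensor_partial F j : bump_tensor F -> exists2 G, bump_tensor G &
  forall x : V, is_derive x (delta_mx 0 j : V) (tensor F) (tensor G x).
Proof.
move=> bF; have [g bg dg] := bump_derive (bF j).
exists (fun i => if i == j then g else F i).
  by move=> i; case: eqP => // ->.
exact: is_derive_tensor.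
Qed.

Lemma bump_tensor_continuous F : bump_tensor F -> continuous (tensor F).
Proof.
move=> bF x; apply: differentiable_continuous; apply: differentiable_tensor => i y.
by have [g _ dg] := bump_derive (bF i); have [] := dg y.
Qed.

Lemma bump_tensor_out F x : bump_tensor F -> ~ box a b x -> tensor F x = 0.
Proof.
move=> bF /existsNP[i /negP xi]; rewrite /tensor (bigD1 i)//=.
by rewrite (bump_out c0 (bF i) xi) mul0r.
Qed.

(** Every iterated partial derivative is again a bump tensor, so induction on the list of indices
    gives smoothness; the support lies in the closed box. *)
Lemma bump_tensor_test F : bump_tensor F -> test_function (tensor F).
Proof.
move=> bF; split.
  move=> s; have [G bG ->] : exists2 G, bump_tensor G & foldr (@partial R n) (tensor F) s = tensor G.
    elim: s => [|j s [G bG IH]]; first by exists F.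
    have [G' bG' dG'] := bump_tensor_partial j bG.
    by exists G' => //=; apply/funext => x; rewrite /partial IH; have [_ ->] := dG' x.
  split; first exact: bump_tensor_continuous.
  by move=> i x; have [G' _ dG'] := bump_tensor_partial i bG; have [] := dG' x.
have cK : compact [set v : V | forall i, `[a i, b i]%classic (v ord0 i)].
  apply: (@rV_compact R n (fun i => `[a i, b i]%classic)) => i.
  exact: segment_compact.
apply: (subclosed_compact _ cK); first exact: closed_closure.
have clK : closed [set v : V | forall i, `[a i, b i]%classic (v ord0 i)].
  by apply: compact_closed => //; exact: norm_hausdorff.
rewrite ((closure_id _).1 clK); apply: closure_subset => x /=.
move=> /eqP Fx i; apply: contrapT => xi; apply: Fx.
apply: bump_tensor_out => // /(_ i) /andP[h1 h2]; apply: xi.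
by rewrite /= in_itv/= !ltW.
Qed.

End bump_tensor.
End tensor.

(** * Density of the bumps in L^2 *)

Section square_norm.
Context d (T : measurableType d) (R : realType) (mu : {measure set T -> \bar R}).
Implicit Types (f g : T -> R).
Local Open Scope ereal_scope.

Definition sqnorm f : \bar R := \int[mu]_x (f x ^+ 2)%:E.

Definition sqint f := measurable_fun setT f /\ sqnorm f < +oo.

Lemma sqnorm_ge0 f : 0 <= sqnorm f.
Proof. by apply: integral_ge0 => x _; rewrite lee_fin sqr_ge0. Qed.

Lemma sqnorm_fin f : sqint f -> sqnorm f \is a fin_num.
Proof. by move=> [_ h]; rewrite ge0_fin_numE// sqnorm_ge0. Qed.

Lemma measurable_sq f : measurable_fun setT f ->
  measurable_fun setT (fun x => (f x ^+ 2)%:E).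
Proof. by move=> mf; apply/measurable_EFinP; exact: measurable_funX. Qed.

Lemma sqnormZ k f : measurable_fun setT f ->
  sqnorm (fun x => k * f x)%R = (k ^+ 2)%:E * sqnorm f.
Proof.
move=> mf; rewrite /sqnorm -ge0_integralZl_EFin ?sqr_ge0//.
- by apply: eq_integral => x _; rewrite exprMn EFinM.
- by move=> x _; rewrite lee_fin sqr_ge0.
- exact: measurable_sq.
Qed.

Lemma sqnorm_le f g : (forall x, `|f x| <= `|g x|)%R -> sqnorm f <= sqnorm g.
Proof.
move=> fg; apply: ge0_le_integral_nonmeas => x _; rewrite lee_fin ?sqr_ge0//.
by rewrite -real_normK ?num_real// -(@real_normK _ (g x)) ?num_real// lerXn2r ?nnegrE.
Qed.

(** The pointwise defect is the square e (f - g/e)^2. The weight 1 gives the factor 2 of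
    [sqnormD_le]; a well-chosen weight gives the triangle inequality [nrmD]. *)
Lemma sqnormD_weighted (e : R) f g : (0 < e)%R ->
  measurable_fun setT f -> measurable_fun setT g ->
  sqnorm (f \+ g)%R <= (1 + e)%:E * sqnorm f + (1 + e^-1)%:E * sqnorm g.
Proof.
move=> e0 mf mg; have eV0 : (0 < e^-1)%R by rewrite invr_gt0.
have e1 : (0 <= 1 + e)%R by rewrite addr_ge0// ltW.
have eV1 : (0 <= 1 + e^-1)%R by rewrite addr_ge0// ltW.
rewrite /sqnorm -!ge0_integralZl_EFin//; [|
  by move=> x _; rewrite lee_fin sqr_ge0| exact: measurable_sq|
  by move=> x _; rewrite lee_fin sqr_ge0| exact: measurable_sq].
rewrite -ge0_integralD//; [|
  by move=> x _; rewrite -EFinM lee_fin mulr_ge0// sqr_ge0|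
  by apply: measurable_funeM; exact: measurable_sq|
  by move=> x _; rewrite -EFinM lee_fin mulr_ge0// sqr_ge0|
  by apply: measurable_funeM; exact: measurable_sq].
apply: ge0_le_integral_nonmeas => x _; first by rewrite lee_fin sqr_ge0.
rewrite -!EFinM -EFinD lee_fin -subr_ge0.
have -> : ((1 + e) * f x ^+ 2 + (1 + e^-1) * g x ^+ 2 - (f x + g x) ^+ 2 =
           e * (f x - e^-1 * g x) ^+ 2)%R.
  by field; rewrite gt_eqF.
by rewrite mulr_ge0 ?sqr_ge0 ?ltW.
Qed.

Lemma sqnormD_le f g : measurable_fun setT f -> measurable_fun setT g ->
  sqnorm (f \+ g)%R <= 2%:E * sqnorm f + 2%:E * sqnorm g.
Proof.
move=> mf mg; have := @sqnormD_weighted 1%R f g ltr01 mf mg.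
by rewrite invr1 (_ : (1 + 1 = 2 :> R)%R).
Qed.

Lemma sqint_lin k f g : sqint f -> sqint g -> sqint (fun x => k * f x + g x)%R.
Proof.
move=> [mf f2] [mg g2]; have mkf : measurable_fun setT (fun x => k * f x)%R.
  exact: measurable_funM.
split; first exact: measurable_funD.
apply: le_lt_trans (sqnormD_le mkf mg) _; rewrite sqnormZ//.
by apply: lte_add_pinfty; rewrite ?lte_mul_pinfty ?lee_fin ?sqr_ge0.
Qed.

Lemma sqint_sub f g : sqint f -> sqint g -> sqint (f \- g)%R.
Proof.
move=> sf sg; have := sqint_lin (-1)%R sg sf.
by congr sqint; apply/funext => x /=; rewrite mulN1r addrC.
Qed.

Lemma sqint_le f g : measurable_fun setT f -> (forall x, `|f x| <= `|g x|)%R ->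
  sqint g -> sqint f.
Proof. by move=> mf fg [mg g2]; split=> //; exact: le_lt_trans (sqnorm_le fg) g2. Qed.

Lemma sqnorm_cvg0 (f_ : nat -> T -> R) f g :
  (forall n, measurable_fun setT (f_ n)) -> measurable_fun setT f ->
  (forall x, (f_ n x @[n --> \oo] --> f x)%R) ->
  sqint g -> (forall n x, `|f_ n x - f x| <= `|g x|)%R ->
  sqnorm (f_ n \- f)%R @[n --> \oo] --> 0.
Proof.
move=> mf_ mf cf [mg g2] fg.
have [] := @dominated_convergence _ _ _ mu setT measurableT
  (fun n x => ((f_ n x - f x) ^+ 2)%:E) (cst 0) (fun x => (g x ^+ 2)%:E).
- by move=> n; apply: measurable_sq; exact: measurable_funB.
- exact: measurable_cst.
- apply: aeW => x _; apply: cvg_EFin; first exact: nearW.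
  have h : (f_ m x - f x @[m --> \oo] --> (0 : R))%R.
    by rewrite -[X in _ --> X](subrr (f x)); apply: cvgB => //; exact: cvg_cst.
  rewrite (_ : _ \o _ = (fun m => (f_ m x - f x) * (f_ m x - f x))%R).
    by rewrite -[X in _ --> X](mulr0 (0%R : R)); exact: cvgM.
  by apply/funext => m; rewrite /= expr2.
- apply/integrableP; split; first exact: measurable_sq.
  by under eq_integral do rewrite gee0_abs ?lee_fin ?sqr_ge0//.
- apply: aeW => x n _; rewrite gee0_abs ?lee_fin ?sqr_ge0//.
  rewrite -real_normK ?num_real// -(@real_normK _ (g x)) ?num_real//.
  by rewrite lerXn2r ?nnegrE.
by move=> _ _; rewrite integral0.
Qed.

Lemma sqnorm_indic (A : set T) : measurable A -> sqnorm \1_A = mu A.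
Proof.
move=> mA; rewrite -[A in RHS]setIT -(integral_indic mu measurableT)//.
apply: eq_integral => x _; rewrite indicE; case: (x \in A); by rewrite ?expr1n ?expr0n.
Qed.

Lemma sqint_indic (A : set T) : measurable A -> mu A < +oo -> sqint \1_A.
Proof. by move=> mA Aoo; split; [exact: measurable_indic|rewrite sqnorm_indic]. Qed.

End square_norm.

Section standard_bump.
Variables (R : realType) (n : nat) (a b : 'I_n -> R).

(** Since exp(-1/((m+1)x)) tends to 1 for every x > 0, the edges steepen with m and the tensors tend
    pointwise to the indicator of the open box. *)
Definition std_bump (m : nat) : 'I_n -> R -> R := fun i x =>
  flat 1 (m.+1%:R * (x - a i)) * flat 1 (m.+1%:R * (b i - x)).

Lemma std_bump_tensor m : bump_tensor a b m.+1%:R (std_bump m).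
Proof. by move=> i; exact: bump_base. Qed.

Lemma flat1_itv (x : R) : 0 <= flat 1 x <= 1.
Proof.
rewrite /flat; case: ifPn => x0; last by rewrite lexx ler01.
by rewrite hornerC mul1r expR_ge0 -expR0 ler_expR oppr_le0 invr_ge0 ltW.
Qed.

Lemma flat1_cvg (x : R) : 0 < x -> flat 1 (m.+1%:R * x) @[m --> \oo] --> (1 : R).
Proof.
move=> x0.
have -> : (fun m : nat => flat 1 (m.+1%:R * x)) = (fun m : nat => expR (- x^-1 * m.+1%:R^-1)).
  by apply/funext => m; rewrite /flat mulr_gt0// hornerC mul1r invfM mulrC mulNr.
have h : - x^-1 / m.+1%:R @[m --> \oo] --> (0 : R).
  rewrite -[X in _ --> X](mulr0 (- x^-1)); apply: cvgM; first exact: cvg_cst.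
  exact: cvg_harmonic.
rewrite -[X in _ --> X](expR0); apply: (cvg_comp _ (@expR R) h).
exact: continuous_expR.
Qed.

Lemma tensor_std_bump_itv m (x : 'rV[R]_n) : 0 <= tensor (std_bump m) x <= 1.
Proof.
rewrite /tensor; apply/andP; split; [apply: prodr_ge0|apply: prodr_ile1] => i _.
  have /andP[? _] := flat1_itv (m.+1%:R * (x 0 i - a i)).
  by have /andP[? _] := flat1_itv (m.+1%:R * (b i - x 0 i)); rewrite mulr_ge0.
have /andP[? ?] := flat1_itv (m.+1%:R * (x 0 i - a i)).
by have /andP[? ?] := flat1_itv (m.+1%:R * (b i - x 0 i)); rewrite mulr_ge0// mulr_ile1.
Qed.

Lemma tensor_std_bump_out m (x : 'rV[R]_n) : ~ box a b x -> tensor (std_bump m) x = 0.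
Proof. by move=> xab; apply: bump_tensor_out (@std_bump_tensor m) xab; rewrite ltr0n. Qed.

Lemma tensor_std_bump_cvg (x : 'rV[R]_n) :
  tensor (std_bump m) x @[m --> \oo] --> (\1_(box a b) x : R).
Proof.
rewrite indicE; have [xab|xab] := boolP (x \in box a b); last first.
  rewrite (_ : (fun _ => _) = cst 0); first exact: cvg_cst.
  apply/funext => m; rewrite tensor_std_bump_out//.
  by move/negP: xab; rewrite inE.
move/set_mem in xab; rewrite /tensor.
rewrite [X in _ --> X](_ : _ = \prod_(i < n) (1 * 1 : R)); last by rewrite big1// => i _; rewrite mulr1.
apply: cvg_big => [|i _]; first exact: mul_continuous.
have /andP[h1 h2] := xab i.
by apply: cvgM; apply: flat1_cvg; rewrite subr_gt0.
Qed.

End standard_bump.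

(** * From boxes to all of L^2 *)

Section boxes.
Variables (R : realType) (n : nat).
Local Notation V := 'rV[R]_n.

Definition boxes : set (set V) := [set A | exists a b, A = box a b].

Lemma boxes_setI : setI_closed boxes.
Proof.
move=> _ _ [a [b ->]] [a' [b' ->]].
exists (fun i => Num.max (a i) (a' i)), (fun i => Num.min (b i) (b' i)).
apply/seteqP; split => x /=.
  by move=> [h h'] i; rewrite gt_max lt_min; have /andP[-> ->] := h i; have /andP[-> ->] := h' i.
move=> h; split=> i; have := h i; rewrite gt_max lt_min => /andP[/andP[h1 h2] /andP[h3 h4]].
  by rewrite h1 h3.
by rewrite h2 h4.
Qed.

(** An open set is a countable union of balls of the sup norm, and these balls are boxes. *)
Lemma boxes_generate : @measurable _ V = <<s boxes >>.
Proof.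
apply/seteqP; split; apply: smallest_sub.
- exact: smallest_sigma_algebra.
- move=> U oU; rewrite (open_rV_bigcup oU).
  set S := (X in \bigcup_(p in X) _).
  pose B (p : 'rV[rat]_n * nat) := ball (map_mx ratr p.1 : V) (p.2.+1%:R^-1).
  pose F (k : nat) := if @unpickle ('rV[rat]_n * nat)%type k is Some p then
    (if p \in S then B p else set0) else set0.
  have -> : \bigcup_(p in S) B p = \bigcup_k F k.
    apply/seteqP; split => x [] => [p Sp Bx|k _].
      by exists (pickle p); [exact: I|rewrite /F pickleK mem_set].
    by rewrite /F; case: unpickle => [p|[]]; case: ifPn => [/set_mem Sp Bx|_ []]; exists p.
  apply: sigma_algebra_bigcup => k.
  have s0 : <<s boxes >> set0 by have [] := smallest_sigma_algebra setT boxes.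
  rewrite /F; case: unpickle => [p|]; last exact: s0.
  case: ifPn => [_|_]; last exact: s0.
  apply: sub_sigma_algebra.
  exists (fun i => ratr (p.1 0 i) - p.2.+1%:R^-1), (fun i => ratr (p.1 0 i) + p.2.+1%:R^-1).
  apply/seteqP; split => x; rewrite /B.
    move=> [_ h] i; have := h 0 i; by rewrite mxE /ball/= ltr_distlC.
  move=> h; split; first by rewrite invr_gt0.
  move=> i j; rewrite (ord1 i) mxE /ball/= ltr_distlC.
  by have := h j.
- exact: sigma_algebra_measurable.
- by move=> _ [a [b ->]]; exact: measurable_box.
Qed.

End boxes.

Section density.
Variables (R : realType) (n : nat).
Local Notation V := 'rV[R]_n.
Local Notation leb := (@lebesgue_rV R n).
(** Density is phrased as an induction principle, because each application establishes a linear
    property that is closed under L^2 limits. [P] climbs from bumps to boxes, then to Borel subsets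
    of a cube, to simple functions, to non-negative functions and to differences of these. *)
Variable P : (V -> R) -> Prop.
Hypothesis P_bump : forall a b m, P (tensor (std_bump a b m)).
Hypothesis P_lin : forall k f g, sqint leb f -> sqint leb g -> P f -> P g ->
  P (fun x => k * f x + g x).
Hypothesis P_lim : forall (f_ : nat -> V -> R) f, (forall m, sqint leb (f_ m)) ->
  (forall m, P (f_ m)) -> sqint leb f ->
  sqnorm leb (f_ m \- f) @[m --> \oo] --> 0%E -> P f.

Lemma sqint_box a b : sqint leb (\1_(box a b) : V -> R).
Proof. by apply: sqint_indic; [exact: measurable_box|exact: lebesgue_rV_box]. Qed.

Lemma sqint_tensor_bump a b m : sqint leb (tensor (std_bump a b m) : V -> R).
Proof.
apply: sqint_le (sqint_box a b).
  apply: (measurability _ (RGenOInfty.measurableE R)) => _ [_ [r ->] <-].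
  rewrite setTI; apply: open_measurable_rV; apply: open_comp; last exact: interval_open.
  by move=> x _; exact: bump_tensor_continuous (@std_bump_tensor R n a b m) x.
move=> x; have /andP[h1 h2] := tensor_std_bump_itv a b m x.
rewrite (ger0_norm h1) indicE; have [xab|xab] := boolP (x \in box a b).
  by rewrite normr1.
by rewrite tensor_std_bump_out ?normr0//; move/negP: xab; rewrite inE.
Qed.

Lemma P_box a b : P (\1_(box a b)).
Proof.
apply: (P_lim (f_ := fun m => tensor (std_bump a b m))).
- exact: sqint_tensor_bump.
- by move=> m; exact: P_bump.
- exact: sqint_box.
apply: (sqnorm_cvg0 (g := \1_(box a b))).
- by move=> m; have [] := sqint_tensor_bump a b m.
- by have [] := sqint_box a b.
- exact: tensor_std_bump_cvg.
- exact: sqint_box.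
move=> m x; have /andP[h1 h2] := tensor_std_bump_itv a b m x.
rewrite indicE; have [xab|xab] := boolP (x \in box a b).
  by rewrite normr1 ler_distl /=; apply/andP; split; lra.
by rewrite tensor_std_bump_out ?subr0 ?normr0//; move/negP: xab; rewrite inE.
Qed.

Lemma P_zero : P (fun=> 0).
Proof.
have b := sqint_box (fun=> 0) (fun=> 0); have Pb := P_box (fun=> 0) (fun=> 0).
have := P_lin (-1) b b Pb Pb; congr P.
by apply/funext => x /=; rewrite mulN1r addNr.
Qed.

Lemma sqint_zero : sqint leb (fun=> 0 : R).
Proof.
split; first exact: measurable_cst.
by rewrite /sqnorm; under eq_integral do rewrite expr0n; rewrite integral0 ltry.
Qed.

Lemma P_sum (I : Type) (s : seq I) (k : I -> R) (f : I -> V -> R) :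
  (forall i, sqint leb (f i)) -> (forall i, P (f i)) ->
  sqint leb (fun x => \sum_(i <- s) k i * f i x) /\ P (fun x => \sum_(i <- s) k i * f i x).
Proof.
move=> sf Pf; elim: s => [|i s [IH1 IH2]].
  under eq_fun do rewrite big_nil; split; [exact: sqint_zero|exact: P_zero].
under eq_fun do rewrite big_cons; split; [exact: sqint_lin|exact: P_lin].
Qed.

Definition cube (m : nat) : set V := box (fun=> - m%:R) (fun=> m%:R).

Lemma cube_cover x : exists m0, forall m, (m0 <= m)%N -> cube m x.
Proof.
exists (\max_(i < n) (Num.truncn `|x ord0 i|%R).+1) => m mm i.
rewrite -ltr_norml; apply: lt_le_trans (truncnS_gt _) _.
rewrite ler_nat; apply: leq_trans mm.
exact: (leq_bigmax i).
Qed.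

Lemma sqint_cubeI m A : measurable A -> sqint leb (\1_(A `&` cube m) : V -> R).
Proof.
move=> mA; have mAC : measurable (A `&` cube m).
  by apply: measurableI => //; exact: measurable_box.
apply: sqint_indic => //; apply: le_lt_trans (lebesgue_rV_box (fun=> - m%:R) (fun=> m%:R)).
by apply: le_measure; rewrite ?inE//; exact: measurable_box.
Qed.

(** Dynkin induction over the boxes, which are stable under intersection. The fixed cube keeps all
    indicators in L^2; a complement becomes the indicator of the cube minus that of the set. *)
Lemma P_cubeI m A : measurable A -> P (\1_(A `&` cube m)).
Proof.
move=> mA; have := mA; rewrite (@boxes_generate R n) => sA.
apply: (@dynkin_induction _ _ (@boxes R n) (fun A => P (\1_(A `&` cube m)))) sA.
- exact: boxes_generate.
- exact: boxes_setI.
- by rewrite setTI; exact: P_box.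
- move=> _ [a [b ->]]; have [c [d ->]] : boxes (box a b `&` cube m).
    by apply: boxes_setI; [exists a, b|exists (fun=> - m%:R), (fun=> m%:R)].
  exact: P_box.
- move=> S mS PS.
  have := P_lin (-1) (sqint_cubeI m mS) (sqint_box (fun=> - m%:R) (fun=> m%:R)) PS (P_box _ _).
  congr P; apply/funext => x; rewrite !indicE !in_setI in_setC -/(cube m).
  by case: (x \in S); case: (x \in cube m); rewrite /= ?mulr1 ?mulr0 ?addNr ?add0r.
- move=> F mF tF PF.
  have PS k := @P_sum nat (iota 0 k) (fun=> 1) (fun i => \1_(F i `&` cube m))
    (fun i => sqint_cubeI m (mF i)) PF.
  have mU : measurable (\bigcup_k F k) by exact: bigcup_measurable.
  apply: (P_lim (fun k => (PS k).1) (fun k => (PS k).2)); first exact: sqint_cubeI.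
  have S1 k x : \sum_(i <- iota 0 k) 1 * \1_(F i `&` cube m) x =
      \1_(\bigcup_(i in `I_k) F i `&` cube m) x :> R.
    elim: k => [|k IHk].
      by rewrite big_nil II0 bigcup_set0 set0I indicE in_set0.
    rewrite -addn1 iotaD big_cat/= IHk big_seq1 add0n mul1r addn1.
    have -> : \bigcup_(i < k.+1) F i = (\bigcup_(i < k) F i) `|` F k.
      apply/seteqP; split => y /=; first move=> [i /=].
        by rewrite ltnS leq_eqVlt => /orP[/eqP -> ?|ik Fi]; [right|left; exists i].
      move=> [[i /= ik Fi]|Fk]; first by exists i => //=; exact: ltnW.
      by exists k => /=.
    rewrite !indicE !in_setI in_setU.
    have := tF; case: (boolP (x \in F k)) => [xFk tF'|_ _]; last first.
      by rewrite orbF addr0.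
    case: (boolP (x \in \bigcup_(i in `I_k) F i)) => [/set_mem[i /= ik xFi]|_].
      exfalso; have /trivIsetP := tF'; move=> /(_ i k Logic.I Logic.I).
      rewrite neq_ltn ik => /(_ isT) /seteqP[+ _] => /(_ x); apply.
      by split => //; exact/set_mem.
    by rewrite /= add0r.
  apply: (sqnorm_cvg0 (g := \1_(cube m))).
  - by move=> k; have [[]] := PS k.
  - by have [] := sqint_cubeI m mU.
  - move=> x; under eq_fun do rewrite S1.
    rewrite indicE in_setI; have [/set_mem [i _ xFi]|xF] := boolP (x \in \bigcup_k F k).
      apply: cvg_near_cst; exists i.+1 => // k /= ik.
      by rewrite indicE in_setI mem_set//; exists i.
    apply: cvg_near_cst; exists 0 => // k _ /=.
    rewrite indicE in_setI memNset// => -[i _ xFi].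
    by move/negP: xF; apply; rewrite inE; exists i.
  - exact: sqint_box.
  - move=> k x; rewrite S1 !indicE !in_setI.
    by case: (x \in cube m); case: (x \in \bigcup_k F k); case: (x \in \bigcup_(i in _) F i);
      rewrite ?subrr ?subr0 ?sub0r ?normrN ?normr0 ?normr1 ?ler01.
Qed.

Import HBNNSimple.

Lemma P_nonneg f : (forall x, 0 <= f x) -> sqint leb f -> P f.
Proof.
move=> f0 sf; have [mf _] := sf.
have mEf : measurable_fun setT (EFin \o f) by exact/measurable_EFinP.
pose h k : V -> R := nnsfun_approx measurableT mEf k.
have h0 k x : 0 <= h k x by exact: fun_ge0.
have hf k x : h k x <= f x.
  rewrite -lee_fin /h nnsfun_approxE; apply: le_approx => // y _.
  by rewrite lee_fin.
have ch x : h k x @[k --> \oo] --> f x.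
  have := @cvg_nnsfun_approx _ _ _ _ measurableT _ mEf (fun x _ => f0 x) x Logic.I.
  by move=> /fine_cvg.
have mh k : measurable_fun setT (h k) by exact: measurable_funP.
(* The cut-off to the k-th cube makes [P_cubeI] applicable to the level sets. Each point lies in all
   large cubes, so the pointwise limit is unchanged. *)
pose g k x := h k x * \1_(cube k) x.
have Pg k : sqint leb (g k) /\ P (g k).
  have fin : finite_set (range (nnsfun_approx measurableT mEf k)) by [].
  have := @P_sum R (finmap.enum_fset (fset_set (range (h k)))) id
    (fun y => \1_((h k) @^-1` [set y] `&` cube k)).
  have mA y : measurable (h k @^-1` [set y]).
    by rewrite -[X in measurable X]setTI; exact: mh.
  move=> /(_ (fun y => sqint_cubeI k (mA y)) (fun y => P_cubeI k (mA y))).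
  set s := (fun x => _); suff -> : s = g k by [].
  have hE x : h k x = \sum_(y <- finmap.enum_fset (fset_set (range (h k)))) y * \1_(h k @^-1` [set y]) x.
    by rewrite {1}/h fimfunE fsbig_finite.
  apply/funext => x; rewrite /s /g hE mulr_suml.
  apply: eq_bigr => y _; rewrite -mulrA; congr (_ * _).
  by rewrite !indicE in_setI -natrM mulnb.
apply: (P_lim (fun k => (Pg k).1) (fun k => (Pg k).2) sf).
apply: (sqnorm_cvg0 (g := f)) => //.
- by move=> k; have [[]] := Pg k.
- move=> x; have [m0 Hm0] := cube_cover x.
  apply: cvg_trans (ch x); apply: near_eq_cvg; exists m0 => // k /= mk.
  by rewrite /g indicE mem_set ?mulr1//; exact: Hm0.
- move=> k x; rewrite (ger0_norm (f0 x)) /g indicE.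
  have := hf k x; have := h0 k x; have := f0 x.
  case: (x \in cube k) => *; rewrite ?mulr1 ?mulr0 ler_distl; apply/andP; split; lra.
Qed.

Theorem density f : sqint leb f -> P f.
Proof.
move=> sf; have [mf _] := sf.
have s1 : sqint leb (fun x => Num.max (f x) 0).
  apply: sqint_le sf; first exact: measurable_maxr.
  by move=> x; case: (leP (f x) 0) => h; rewrite ?normr0.
have s2 : sqint leb (fun x => Num.max (- f x) 0).
  apply: sqint_le sf; first by apply: measurable_maxr => //; exact: measurable_funN.
  by move=> x; case: (leP (- f x) 0) => h; rewrite ?normr0 ?normrN.
have P1 : P (fun x => Num.max (f x) 0) by apply: P_nonneg => // x; rewrite le_max lexx orbT.
have P2 : P (fun x => Num.max (- f x) 0) by apply: P_nonneg => // x; rewrite le_max lexx orbT.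
have := P_lin (-1) s2 s1 P2 P1; congr P; apply/funext => x; rewrite mulN1r.
by case: (leP (- f x) 0); case: (leP (f x) 0) => *; lra.
Qed.

End density.

(** * Inner product and translations in L^2 *)

Section inner_product.
Context d (T : measurableType d) (R : realType) (mu : {measure set T -> \bar R}).
Implicit Types (f g : T -> R).

Definition nsq f : R := fine (sqnorm mu f).

Lemma nsqE f : sqint mu f -> sqnorm mu f = (nsq f)%:E.
Proof. by move=> sf; rewrite /nsq fineK//; exact: sqnorm_fin. Qed.

Lemma nsq_ge0 f : 0 <= nsq f.
Proof. by rewrite /nsq fine_ge0// sqnorm_ge0. Qed.

Lemma sqintZ k f : sqint mu f -> sqint mu (fun x => k * f x).
Proof.
move=> sf; have := sqint_lin k sf (sqint_sub sf sf).
by congr sqint; apply/funext => x /=; rewrite subrr addr0.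
Qed.

Lemma sqintD f g : sqint mu f -> sqint mu g -> sqint mu (f \+ g).
Proof.
move=> sf sg; have := sqint_lin 1 sf sg.
by congr sqint; apply/funext => x /=; rewrite mul1r.
Qed.

Lemma nsqZ k f : sqint mu f -> nsq (fun x => k * f x) = k ^+ 2 * nsq f.
Proof.
move=> sf; apply: EFin_inj; rewrite -nsqE; last exact: sqintZ.
by rewrite sqnormZ ?EFinM ?nsqE//; have [] := sf.
Qed.

Lemma nsqD_weighted e f g : 0 < e -> sqint mu f -> sqint mu g ->
  nsq (f \+ g) <= (1 + e) * nsq f + (1 + e^-1) * nsq g.
Proof.
move=> e0 sf sg; rewrite -lee_fin EFinD !EFinM -!nsqE//; last exact: sqintD.
by apply: sqnormD_weighted => //; [have [] := sf|have [] := sg].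
Qed.

Lemma nsqD_le f g : sqint mu f -> sqint mu g -> nsq (f \+ g) <= 2 * nsq f + 2 * nsq g.
Proof. by move=> sf sg; have := nsqD_weighted ltr01 sf sg; rewrite invr1. Qed.

Lemma nsq_cvg0 (f_ : nat -> T -> R) f (e : R) : (forall m, sqint mu (f_ m)) -> sqint mu f ->
  sqnorm mu (f_ m \- f) @[m --> \oo] --> 0%E -> 0 < e ->
  exists m, nsq (f_ m \- f) < e.
Proof.
move=> sf_ sf cf e0.
have /fine_cvgP[_ /cvgrPdist_lt/(_ _ e0)] := cf.
move=> [m _ /(_ m (leqnn _))]; rewrite /= sub0r normrN => h; exists m.
by apply: le_lt_trans h; exact: ler_norm.
Qed.

Definition ip f g : R := fine (\int[mu]_x (f x * g x)%:E).

Lemma sqint_mul_integrable f g : sqint mu f -> sqint mu g ->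
  mu.-integrable setT (fun x => (f x * g x)%:E).
Proof.
move=> [mf f2] [mg g2].
have mfg : measurable_fun setT (fun x => (f x * g x)%:E).
  by apply/measurable_EFinP; exact: measurable_funM.
apply/integrableP; split => //.
apply: (@le_lt_trans _ _ (sqnorm mu f + sqnorm mu g)%E); last exact: lte_add_pinfty.
rewrite /sqnorm -ge0_integralD//; [|
  by move=> x _; rewrite lee_fin sqr_ge0| exact: measurable_sq|
  by move=> x _; rewrite lee_fin sqr_ge0| exact: measurable_sq].
apply: ge0_le_integral_nonmeas => x _; first exact: abse_ge0.
rewrite -EFinD lee_fin /= ler_norml; apply/andP; split.
  by have := sqr_ge0 (f x + g x); have := sqr_ge0 (f x); have := sqr_ge0 (g x); nra.
by have := sqr_ge0 (f x - g x); have := sqr_ge0 (f x); have := sqr_ge0 (g x); nra.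
Qed.

Lemma ipE f g : sqint mu f -> sqint mu g ->
  (\int[mu]_x (f x * g x)%:E = (ip f g)%:E)%E.
Proof.
by move=> sf sg; rewrite /ip fineK//; apply: integrable_fin_num => //;
  exact: sqint_mul_integrable.
Qed.

Lemma ipC f g : ip f g = ip g f.
Proof. by rewrite /ip; congr fine; apply: eq_integral => x _; rewrite mulrC. Qed.

Lemma ip_lin k f1 f2 g : sqint mu f1 -> sqint mu f2 -> sqint mu g ->
  ip (fun x => k * f1 x + f2 x) g = k * ip f1 g + ip f2 g.
Proof.
move=> s1 s2 sg; apply: EFin_inj; rewrite -ipE//; last exact: sqint_lin.
rewrite EFinD EFinM -!ipE// -integralZl//; last exact: sqint_mul_integrable.
rewrite -integralD//.
- by apply: eq_integral => x _; rewrite -EFinM -EFinD; congr EFin; ring.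
- by apply: integrableZl => //; exact: sqint_mul_integrable.
- exact: sqint_mul_integrable.
Qed.

Lemma ipBl f1 f2 g : sqint mu f1 -> sqint mu f2 -> sqint mu g ->
  ip (f1 \- f2) g = ip f1 g - ip f2 g.
Proof.
move=> s1 s2 sg; have := ip_lin (-1) s2 s1 sg; rewrite mulN1r addrC => <-.
by congr ip; apply/funext => x /=; rewrite mulN1r addrC.
Qed.

Lemma ip_self f : ip f f = nsq f.
Proof. by rewrite /ip /nsq /sqnorm; congr fine; apply: eq_integral => x _; rewrite expr2. Qed.

Lemma ip_self_ge0 f : 0 <= ip f f.
Proof. by rewrite ip_self nsq_ge0. Qed.

(** A weighted substitute for Cauchy-Schwarz, from the non-negativity of the squared norms of e f +
    g and e f - g. *)
Lemma ip_bound e f g : 0 < e -> sqint mu f -> sqint mu g ->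
  `|ip f g| <= e * ip f f + e^-1 * ip g g.
Proof.
move=> e0 sf sg; have eV0 : 0 < e^-1 by rewrite invr_gt0.
have h s : sqint mu (fun x => e * f x + s * g x) by apply: sqint_lin => //; exact: sqintZ.
have sg' s : sqint mu (fun x => s * g x) by exact: sqintZ.
have ipZ s k : sqint mu k -> ip (fun x => s * g x) k = s * ip g k.
  move=> sk; have := ip_lin s sg (sqint_sub sg sg) sk.
  by rewrite (ipBl sg sg sk) subrr addr0 => <-; congr ip; apply/funext => x /=; rewrite subrr addr0.
have E s : e^-1 * ip (fun x => e * f x + s * g x) (fun x => e * f x + s * g x) =
   e * ip f f + 2 * s * ip f g + e^-1 * s ^+ 2 * ip g g.
  rewrite ip_lin// (ipZ s _ (h s)) [ip f _]ipC [ip g _]ipC !ip_lin// !ipZ// [ip g f]ipC.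
  by field; rewrite gt_eqF.
have P1 := ip_self_ge0 (fun x => e * f x + 1 * g x).
have P2 := ip_self_ge0 (fun x => e * f x + (-1) * g x).
have := mulr_ge0 (ltW eV0) P1; have := mulr_ge0 (ltW eV0) P2; rewrite !E.
have := mulr_ge0 (ltW e0) (ip_self_ge0 f); have := mulr_ge0 (ltW eV0) (ip_self_ge0 g).
by rewrite ler_norml => *; apply/andP; split; lra.
Qed.

Lemma ip_lim0 (f_ : nat -> T -> R) f g : (forall m, sqint mu (f_ m)) ->
  sqint mu f -> sqint mu g -> sqnorm mu (f_ m \- f) @[m --> \oo] --> 0%E ->
  (forall m, ip (f_ m) g = 0) -> ip f g = 0.
Proof.
move=> sf_ sf sg cf f_0; apply/eqP; rewrite -normr_le0; apply/ler_addgt0Pl => e e0.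
rewrite addr0.
(* This weight brings the term in [g] below e/2, and the summand 1 keeps it positive; the index [m]
   then controls the other term. *)
pose k := (ip g g + 1) / (e / 2).
have g1 : 0 < ip g g + 1 by rewrite ltr_wpDl// ip_self_ge0.
have k0 : 0 < k by rewrite divr_gt0// divr_gt0.
have ek0 : 0 < e / 2 / k by rewrite !divr_gt0.
have [m Hm] := nsq_cvg0 sf_ sf cf ek0.
have sm : sqint mu (f_ m \- f) by exact: sqint_sub.
have := ip_bound k0 sm sg; rewrite ipBl// f_0 sub0r normrN ip_self.
have h1 : k * nsq (f_ m \- f) <= e / 2 by rewrite mulrC -ler_pdivlMr// ltW.
have h2 : k^-1 * ip g g <= e / 2.
  rewrite mulrC ler_pdivrMr// /k mulrCA divff ?mulr1 ?lerDl//.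
  by rewrite gt_eqF// divr_gt0.
by move=> h; apply: le_trans h _; rewrite [leRHS]splitr lerD.
Qed.

End inner_product.

(** * Continuity of translations in L^2 *)

Section translates.
Variables (R : realType) (n : nat).
Local Notation V := 'rV[R]_n.
Local Notation leb := (@lebesgue_rV R n).
Implicit Types (f w : V -> R) (h z : V).

Lemma measurable_shiftf f h : measurable_fun setT f -> measurable_fun setT (fun x : V => f (x + h)).
Proof. by move=> mf; apply: (measurableT_comp mf); exact: measurable_shift. Qed.

Lemma sqnorm_shift f h : measurable_fun setT f ->
  sqnorm leb (fun x : V => f (x + h)) = sqnorm leb f.
Proof.
move=> mf; rewrite /sqnorm.
rewrite -(@ge0_integral_shift _ _ h (fun x : V => (f x ^+ 2)%:E))//.
  exact: measurable_sq.
by move=> x; rewrite lee_fin sqr_ge0.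
Qed.

Lemma sqint_shift f h : sqint leb f -> sqint leb (fun x : V => f (x + h)).
Proof.
by move=> [mf f2]; split; [exact: measurable_shiftf|rewrite sqnorm_shift].
Qed.

Lemma row_cvg (h_ : nat -> V) x :
  (forall i, h_ m 0 i @[m --> \oo] --> (0 : R)) -> x + h_ m @[m --> \oo] --> x.
Proof.
move=> ch; apply/cvg_ballP => e e0.
have : \forall m \near \oo, forall i : 'I_n, `|h_ m 0 i| < e.
  apply: filter_forall => i; have /cvgr0Pnorm_lt := ch i; exact.
apply: filterS => m hm; split => // i j; rewrite (ord1 i) /ball/= mxE.
by rewrite opprD addrA subrr sub0r normrN.
Qed.

Lemma nsq_shift f h : sqint leb f -> nsq leb (fun x : V => f (x + h)) = nsq leb f.
Proof. by move=> [mf _]; rewrite /nsq sqnorm_shift. Qed.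

Definition translation_continuous f := forall e : R, 0 < e ->
  exists2 eta : R, 0 < eta & forall h, (forall i, `|h 0 i| < eta) ->
    nsq leb (fun x => f (x + h) - f x) <= e.

Lemma sqint_diff f h : sqint leb f -> sqint leb (fun x => f (x + h) - f x).
Proof. by move=> sf; apply: (sqint_sub (sqint_shift h sf) sf). Qed.

(** A failure provides shifts tending to 0, to which dominated convergence applies: shifts of size
    less than 1 keep the supports in the box enlarged by 1 on every side. *)
Lemma translation_continuous_bump a b m :
  translation_continuous (tensor (std_bump a b m)).
Proof.
set f := tensor _; move=> e e0; apply: contrapT => no.
have /choice[h_ Hh] : forall k : nat, exists h : V, (forall i, `|h 0 i| < k.+1%:R^-1) /\
    e < nsq leb (fun x => f (x + h) - f x).
  move=> k; apply: contrapT => noh; apply: no; exists k.+1%:R^-1; first by rewrite invr_gt0.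
  move=> h hk; rewrite leNgt; apply/negP => he; apply: noh; exists h; split => // i; exact: hk.
have cf : continuous f by apply: bump_tensor_continuous; exact: std_bump_tensor.
have sf : sqint leb f by exact: sqint_tensor_bump.
pose f_ k (x : V) := f (x + h_ k).
have cv : sqnorm leb (f_ k \- f) @[k --> \oo] --> 0%E.
  apply: (sqnorm_cvg0 (g := \1_(box (fun i => a i - 1) (fun i => b i + 1)))).
  - by move=> k; apply: measurable_shiftf; have [] := sf.
  - by have [] := sf.
  - move=> x; apply: (cvg_comp _ f); last exact: cf.
    apply: row_cvg => i; apply/cvgr0Pnorm_lt => d d0; near=> k.
    have [hk _] := Hh k; apply: lt_trans (hk i) _.
    near: k; exact: near_infty_natSinv_lt (PosNum d0).
  - exact: sqint_box.
  - move=> k x; rewrite indicE; have [hk _] := Hh k.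
    have /andP[h1 h2] := tensor_std_bump_itv a b m x.
    have /andP[h3 h4] := tensor_std_bump_itv a b m (x + h_ k).
    have [xb|xb] := boolP (x \in _).
      by rewrite normr1 ler_distl /f_ /f; apply/andP; split; lra.
    have out (y : V) : (forall i, `|y 0 i - x 0 i| < 1) -> f y = 0.
      move=> yx; apply: tensor_std_bump_out => yab; move/negP: xb; apply; rewrite inE => i.
      have /andP[] := yab i; have := yx i; rewrite ltr_norml => /andP[] *; apply/andP; split; lra.
    rewrite /f_ !out ?subrr// => i; first by rewrite subrr normr0.
    rewrite mxE [x 0 i + _]addrC addrK; apply: lt_le_trans (hk i) _.
    by rewrite invf_le1// ler1n.
have [k] := nsq_cvg0 (fun k => sqint_shift (h_ k) sf) sf cv e0.
by have [_ h1] := Hh k => /(lt_trans h1); rewrite ltxx.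
Unshelve. all: by end_near. Qed.

Theorem sqint_translation_continuous f : sqint leb f -> translation_continuous f.
Proof.
apply: density => {f}.
- exact: translation_continuous_bump.
- move=> k f g sf sg cf cg e e0.
  (* Then 2 k^2 e1 <= e/2, also when k = 0; the other half of [e] is left to [g]. *)
  pose e1 := e / (4 * (k ^+ 2 + 1)).
  have k1 : 0 < k ^+ 2 + 1 by rewrite ltr_wpDl// sqr_ge0.
  have e10 : 0 < e1 by rewrite divr_gt0// mulr_gt0.
  have e40 : 0 < e / 4 by rewrite divr_gt0.
  have [d1 d10 H1] := cf e1 e10; have [d2 d20 H2] := cg (e / 4) e40.
  exists (Num.min d1 d2); first by rewrite lt_min d10.
  move=> h hd.
  have hd1 i : `|h 0 i| < d1 by have := hd i; rewrite lt_min => /andP[].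
  have hd2 i : `|h 0 i| < d2 by have := hd i; rewrite lt_min => /andP[].
  have sdf := sqint_diff h sf; have sdg := sqint_diff h sg.
  rewrite (_ : (fun x => _) = (fun x : V => k * (f (x + h) - f x)) \+ (fun x : V => g (x + h) - g x)).
    apply: le_trans (nsqD_le (sqintZ k sdf) sdg) _; rewrite nsqZ//.
    have {}H1 := H1 h hd1.
    have {}H2 := H2 h hd2.
    have h1 : k ^+ 2 * nsq leb (fun x : V => f (x + h) - f x) <= e / 4.
      apply: (@le_trans _ _ ((k ^+ 2 + 1) * e1)).
        by apply: ler_pM; rewrite ?sqr_ge0 ?nsq_ge0// lerDl.
      by rewrite /e1 le_eqVlt; apply/orP; left; apply/eqP; field; rewrite gt_eqF.
    lra.
  by apply/funext => x /=; ring.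
- move=> f_ f sf_ cf_ sf cv e e0.
  (* The increment of f - f_m has squared norm at most 4 ||f - f_m||^2 <= e/4. After the factor 2 of
     [nsqD_le] it takes e/2, as does the increment of f_m. *)
  have e16 : 0 < e / 16 by rewrite divr_gt0.
  have e40 : 0 < e / 4 by rewrite divr_gt0.
  have [m Hm] := nsq_cvg0 sf_ sf cv e16.
  have [d d0 Hd] := cf_ m _ e40; exists d => // h hd.
  have {}Hd := Hd h hd.
  have sr : sqint leb (f \- f_ m) by exact: sqint_sub.
  have Hm' : nsq leb (f \- f_ m) < e / 16.
    rewrite (_ : f \- f_ m = fun x => (-1) * (f_ m \- f) x).
      by rewrite nsqZ; [rewrite sqrrN expr1n mul1r|exact: sqint_sub].
    by apply/funext => x /=; ring.
  rewrite (_ : (fun x => _) = (fun x : V => (f \- f_ m) (x + h) - (f \- f_ m) x) \+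
     (fun x : V => f_ m (x + h) - f_ m x)); last by apply/funext => x /=; ring.
  apply: le_trans (nsqD_le (sqint_diff h sr) (sqint_diff h (sf_ m))) _.
  have h1 : nsq leb (fun x : V => (f \- f_ m) (x + h) - (f \- f_ m) x) <= 4 * nsq leb (f \- f_ m).
    rewrite (_ : (fun x => _) = (fun x : V => (f \- f_ m) (x + h)) \+ (fun x : V => (-1) * (f \- f_ m) x)).
      apply: le_trans (nsqD_le (sqint_shift h sr) (sqintZ (-1) sr)) _.
      by rewrite nsq_shift// nsqZ// sqrrN expr1n mul1r; lra.
    by apply/funext => x /=; ring.
  lra.
Qed.

End translates.

(** * Taylor formula for weak gradients *)

Section bounded_bumps.
Variable R : realType.

Lemma flat_bounded (P : {poly R}) : exists2 C, 0 <= C & forall x, `|flat P x| <= C.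
Proof.
have [C C0 HC] := horner_le_expR P; exists C => // x; rewrite /flat.
case: ifPn => x0; last by rewrite normr0.
have xV0 : 0 <= x^-1 by rewrite invr_ge0 ltW.
rewrite normrM (ger0_norm (expR_ge0 _)) expRN ler_pdivrMr ?expR_gt0//.
exact: HC.
Qed.

Lemma bump_bounded (a b c : R) f : bump_fun a b c f -> exists2 C, 0 <= C & forall x, `|f x| <= C.
Proof.
elim=> [P Q|f1 f2 _ [C1 C10 H1] _ [C2 C20 H2]].
  have [C1 C10 H1] := flat_bounded P; have [C2 C20 H2] := flat_bounded Q.
  by exists (C1 * C2) => [|x]; rewrite ?mulr_ge0// normrM ler_pM.
exists (C1 + C2) => [|x]; first exact: addr_ge0.
by apply: le_trans (ler_normD _ _) _; rewrite lerD.
Qed.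

Variable n : nat.
Local Notation V := 'rV[R]_n.
Local Notation leb := (@lebesgue_rV R n).

Lemma continuous_measurable_rV (f : V -> R) : continuous f -> measurable_fun setT f.
Proof.
move=> cf; apply: (measurability _ (RGenOInfty.measurableE R)) => _ [_ [r ->] <-].
rewrite setTI; apply: open_measurable_rV; apply: open_comp; last exact: interval_open.
by move=> x _; exact: cf.
Qed.

Lemma sqint_bump (a b : 'I_n -> R) c F : 0 < c -> bump_tensor a b c F -> sqint leb (tensor F).
Proof.
move=> c0 bF.
have /choice[C HC] : forall i, exists C, 0 <= C /\ forall x, `|F i x| <= C.
  by move=> i; have [C C0 HC] := bump_bounded (bF i); exists C.
apply: (sqint_le _ _ (sqintZ (\prod_(i < n) C i) (sqint_box a b))).
  by apply: continuous_measurable_rV; exact: bump_tensor_continuous bF.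
move=> x; rewrite indicE; have [xb|xb] := boolP (x \in _).
  have C0 : 0 <= \prod_(i < n) C i by apply: prodr_ge0 => i _; have [] := HC i.
  rewrite mulr1 (ger0_norm C0).
  rewrite /tensor normr_prod; apply: ler_prod => i _.
  by rewrite normr_ge0; have [_ ->] := HC i.
rewrite (bump_tensor_out c0 bF) ?normr0//.
by move/negP: xb; rewrite inE.
Qed.

Lemma sqint_sum (k : 'I_n -> R) (f : 'I_n -> V -> R) : (forall i, sqint leb (f i)) ->
  sqint leb (fun x => \sum_(i < n) k i * f i x).
Proof.
move=> sf; elim: (index_enum _) => [|i s IHs].
  by under eq_fun do rewrite big_nil; exact: sqint_zero.
by under eq_fun do rewrite big_cons; exact: sqint_lin.
Qed.

Lemma ip_sum (k : 'I_n -> R) (f : 'I_n -> V -> R) g : (forall i, sqint leb (f i)) ->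
  sqint leb g -> ip leb (fun x => \sum_(i < n) k i * f i x) g = \sum_(i < n) k i * ip leb (f i) g.
Proof.
move=> sf sg.
suff : sqint leb (fun x => \sum_(i < n) k i * f i x) /\
  ip leb (fun x => \sum_(i < n) k i * f i x) g = \sum_(i < n) k i * ip leb (f i) g by case.
elim: (index_enum _) => [|i s [IH1 IH2]].
  under eq_fun do rewrite big_nil; split; first exact: sqint_zero.
  rewrite big_nil /ip; under eq_integral do rewrite mul0r.
  by rewrite integral0.
under eq_fun do rewrite big_cons; rewrite big_cons; split; first exact: sqint_lin.
by rewrite ip_lin// IH2.
Qed.

Lemma ip_shift (f g : V -> R) h : sqint leb f -> sqint leb g ->
  ip leb (fun x => f (x + h)) (fun x => g (x + h)) = ip leb f g.
Proof.
move=> [mf _] [mg _]; rewrite /ip -(@integral_shift _ _ h (fun x : V => (f x * g x)%:E))//.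
by apply/measurable_EFinP; exact: measurable_funM.
Qed.

End bounded_bumps.

(** * Segments of translates as functions on [0, 1] x R^N *)

Section slide.
Variables (R : realType) (n : nat).
Local Notation V := 'rV[R]_n.
Local Notation leb := (@lebesgue_rV R n).
Local Notation prodm := (lebesgue_measure \x leb)%E.
Implicit Types (f g w : V -> R) (z : V).

(* Lifting to [0, 1] x V turns the weak form of
   u (x + z) - u x = \int_0^1 g (x + t z) . z dt into an orthogonality relation. *)
Definition slide w z (p : R * V) : R := \1_`[0, 1]%classic p.1 * w (p.2 + p.1 *: z).

Lemma measurable_slide w z : measurable_fun setT w -> measurable_fun setT (slide w z).
Proof.
move=> mw; apply: measurable_funM.
  have mI : measurable_fun setT (\1_`[0, 1]%classic : R -> R).
    by apply: measurable_indic; exact: measurable_itv.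
  by apply: (measurableT_comp mI); exact: measurable_fst.
apply: (measurableT_comp mw); apply: measurable_fun_addrV; first exact: measurable_snd.
apply: measurable_fun_scalerV; first exact: measurable_fst.
exact: measurable_cst.
Qed.

Lemma sqnorm_prod_le (F : R * V -> R) (e : R) : measurable_fun setT F -> 0 <= e ->
  (forall t : R, (0 <= t <= 1)%R -> sqnorm leb (fun x => F (t, x)) <= e%:E)%E ->
  (sqnorm prodm (fun p => \1_`[0, 1]%classic p.1 * F p)%R <= e%:E)%E.
Proof.
move=> mF e0 Fe.
have mI : measurable_fun setT (\1_`[0, 1]%classic : R -> R).
  by apply: measurable_indic; exact: measurable_itv.
have mG : measurable_fun setT (fun p : R * V => \1_`[0, 1]%classic p.1 * F p).
  apply: measurable_funM => //.
  by apply: (measurableT_comp mI); exact: measurable_fst.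
rewrite /sqnorm fubini_tonelli1/=; [|exact: measurable_sq|by move=> p; rewrite lee_fin sqr_ge0].
rewrite /fubini_F.
apply: (@le_trans _ _ (\int[lebesgue_measure]_(t in `[0%R, 1%R]) e%:E)%E).
  rewrite [leRHS]integral_mkcond; apply: ge0_le_integral_nonmeas => t _ /=.
    by apply: integral_ge0 => x _; rewrite lee_fin sqr_ge0.
  rewrite patchE; case: ifPn => tI.
    have := tI; rewrite inE /= in_itv/= => /Fe; apply: le_trans.
    rewrite le_eqVlt; apply/orP; left; apply/eqP; apply: eq_integral => x _.
    by rewrite indicE tI mul1r.
  under eq_integral do rewrite indicE (negbTE tI) mul0r expr0n.
  by rewrite integral0.
rewrite integral_cst//=.
have /= -> := @lebesgue_measure_itv R `[0, 1].
by rewrite lte_fin ltr01 oppr0 adde0 mule1.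
Qed.

Lemma sqnorm_slide w z : sqint leb w -> sqnorm prodm (slide w z) = sqnorm leb w.
Proof.
move=> sw; have [mw _] := sw.
have ms := measurable_slide z mw.
rewrite {1}/sqnorm fubini_tonelli1/=; [|exact: measurable_sq|by move=> p; rewrite lee_fin sqr_ge0].
transitivity (\int[lebesgue_measure]_(t in `[0%R, 1%R]) sqnorm leb w)%E.
  rewrite [RHS]integral_mkcond; apply: eq_integral => t _; rewrite patchE /fubini_F /slide /=.
  case: ifPn => tI.
    rewrite -(sqnorm_shift (t *: z) mw); apply: eq_integral => x _.
    by rewrite indicE tI mul1r.
  under eq_integral do rewrite indicE (negbTE tI) mul0r expr0n.
  by rewrite integral0.
rewrite (nsqE sw) integral_cst//=.
have /= -> := @lebesgue_measure_itv R `[0, 1].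
by rewrite lte_fin ltr01 oppr0 adde0 mule1.
Qed.

Lemma sqint_slide w z : sqint leb w -> sqint prodm (slide w z).
Proof.
move=> sw; split; first by apply: measurable_slide; have [] := sw.
by rewrite sqnorm_slide//; have [] := sw.
Qed.

Lemma slideB f g z : slide (f \- g) z = slide f z \- slide g z.
Proof. by apply/funext => p; rewrite /slide /= mulrBr. Qed.

Lemma slide_lin k f g z : slide (fun x => k * f x + g x) z = (fun p => k * slide f z p + slide g z p).
Proof. by apply/funext => p; rewrite /slide /=; ring. Qed.

(** By polarisation, since [slide] is linear and preserves norms. *)
Lemma ip_slide f g z : sqint leb f -> sqint leb g ->
  ip prodm (slide f z) (slide g z) = ip leb f g.
Proof.
move=> sf sg.
have pol d (T : measurableType d) (mu : {measure set T -> \bar R}) (a b : T -> R) :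
    sqint mu a -> sqint mu b -> ip mu a b = (nsq mu a + nsq mu b - nsq mu (a \- b)) / 2.
  move=> sa sb; rewrite -!ip_self ipBl//; last exact: sqint_sub.
  rewrite [ip mu a (a \- b)]ipC [ip mu b (a \- b)]ipC !ipBl// [ip mu b a]ipC; by field.
rewrite !pol//; [|exact: sqint_slide|exact: sqint_slide].
by rewrite -slideB /nsq !sqnorm_slide//; exact: sqint_sub.
Qed.

End slide.

Section weak_gradient.
Variables (R : realType) (n : nat).
Local Notation V := 'rV[R]_n.
Local Notation leb := (@lebesgue_rV R n).
Local Notation prodm := (lebesgue_measure \x leb)%E.
Variables (u : V -> R) (g : V -> V).
Hypothesis su : sqint leb u.
Hypothesis sg : forall i, sqint leb (fun x => g x 0 i).
Hypothesis ug : forall phi, test_function phi -> forall i : 'I_n,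
  (\int[leb]_x (u x * partial i phi x)%:E = - \int[leb]_x (g x 0 i * phi x)%:E)%E.

Lemma dotE (x z : V) : dot x z = \sum_(i < n) z 0 i * x 0 i.
Proof. by apply: eq_bigr => i _; rewrite mulrC. Qed.

Lemma sqint_dot z : sqint leb (fun x => dot (g x) z).
Proof.
by under eq_fun do rewrite dotE; exact: sqint_sum.
Qed.

Section against_bump.
Variables (a b : 'I_n -> R) (m : nat) (z : V).
Let phi := tensor (std_bump a b m).

Let sphi : sqint leb phi.
Proof. exact: sqint_tensor_bump. Qed.

(** A translated bump is the bump of the translated box, hence admissible in the definition of the
    weak gradient. *)
Lemma phi_shift (t : R) (x : V) : phi (x + t *: - z) =
  tensor (std_bump (fun i => a i + t * z 0 i) (fun i => b i + t * z 0 i) m) x.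
Proof.
rewrite /phi /tensor; apply: eq_bigr => i _; rewrite /std_bump !mxE.
by congr (flat _ (_ * _) * flat _ (_ * _)); ring.
Qed.

Lemma partial_phi i : exists2 G, bump_tensor a b m.+1%:R G & partial i phi = tensor G.
Proof.
have [G bG dG] := bump_tensor_partial i (@std_bump_tensor R n a b m).
by exists G => //; apply/funext => x; have [_ <-] := dG x.
Qed.

Lemma sqint_partial i : sqint leb (partial i phi).
Proof.
have [G bG ->] := partial_phi i; apply: (sqint_bump (c := m.+1%:R)) bG.
by rewrite ltr0n.
Qed.

Lemma continuous_partial i : continuous (partial i phi).
Proof. by have [G bG ->] := partial_phi i; exact: bump_tensor_continuous bG. Qed.

Lemma partial_shift i (f : V -> R) (h x : V) :
  partial i (fun y => f (y + h)) x = partial i f (x + h).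
Proof.
have E : (fun s : R => s^-1 *: (((fun y => f (y + h)) \o shift x) (s *: (delta_mx 0 i : V)) - f (x + h))) =
  (fun s : R => s^-1 *: ((f \o shift (x + h)) (s *: (delta_mx 0 i : V)) - f (x + h))).
  by apply/funext => s /=; rewrite addrA.
by rewrite /partial /derive E.
Qed.

(** The derivative of [phi] in the direction -z, by [derive_partial]. *)
Let psi x := \sum_(i < n) (- z) 0 i * partial i phi x.

Let spsi : sqint leb psi.
Proof. by apply: sqint_sum => i; exact: sqint_partial. Qed.

Lemma phi_differentiable x : differentiable phi x.
Proof.
apply: differentiable_tensor => i y.
by have [f _ df] := bump_derive (@std_bump_tensor R n a b m i); have [] := df y.
Qed.

Lemma psi_line_continuous (x : V) : continuous (fun t : R => psi (x + t *: - z)).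
Proof.
move=> t; rewrite /psi.
elim: (index_enum _) => [|i s IHs].
  rewrite (_ : (fun _ => _) = cst 0); first exact: cst_continuous.
  by apply/funext => y; rewrite big_nil.
rewrite (_ : (fun _ => _) = (fun t : R => (- z) 0 i * partial i phi (x + t *: - z)) \+
  (fun t : R => \sum_(j <- s) (- z) 0 j * partial j phi (x + t *: - z))); last first.
  by apply/funext => y; rewrite big_cons.
apply: continuousD => //; apply: continuousM; first exact: cst_continuous.
apply: (@continuous_comp _ _ _ (fun t : R => x + t *: - z) (partial i phi)).
  apply: continuousD; first exact: cst_continuous.
  exact: scalel_continuous.
exact: continuous_partial.
Qed.

Lemma phi_line (x : V) : (\int[lebesgue_measure]_(t in `[0%R, 1%R]) (psi (x + t *: - z)%R)%:E =
  (phi (x - z) - phi x)%:E)%E.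
Proof.
have dF (t : R) : is_derive t 1 (fun s : R => phi (x + s *: - z)) (psi (x + t *: - z)).
  have dt := phi_differentiable (x + t *: - z).
  by have := derive_line dt; rewrite derive_partial.
have cF : continuous (fun s : R => phi (x + s *: - z)).
  move=> t; apply: differentiable_continuous; apply/derivable1_diffP.
  by have [] := dF t.
have := @continuous_FTC2 R (fun t => psi (x + t *: - z)) (fun t => phi (x + t *: - z)) 0 1 ltr01.
rewrite scale1r scale0r addr0 EFinB; apply.
- by apply: continuous_subspaceT; exact: psi_line_continuous.
- split; first by move=> t _; have [] := dF t.
    by apply: cvg_at_right_filter; exact: cF.
  by apply: cvg_at_left_filter; exact: cF.
- by move=> t _; rewrite derive1E; have [_ ->] := dF t.
Qed.

(** The weak gradient is tested on the translated bump; the sign from the integration by parts is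
    absorbed by the direction -z of [psi]. *)
Lemma weak_gradient_shift t : ip leb (fun x => phi (x + t *: - z)) (fun x => dot (g x) z) =
  ip leb u (fun x => psi (x + t *: - z)).
Proof.
pose phit := fun x : V => phi (x + t *: - z).
have sphit : sqint leb phit by exact: sqint_shift.
have tphit : test_function phit.
  rewrite /phit (_ : (fun x => _) = tensor (std_bump (fun i => a i + t * z 0 i)
     (fun i => b i + t * z 0 i) m)); last by apply/funext => x; rewrite phi_shift.
  by apply: bump_tensor_test (@std_bump_tensor R n _ _ m); rewrite ltr0n.
have spt i : sqint leb (fun x => partial i phi (x + t *: - z)).
  by apply: sqint_shift; exact: sqint_partial.
rewrite ipC; under [X in ip leb X _]eq_fun do rewrite dotE.
rewrite ip_sum// [RHS]ipC /psi ip_sum//.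
apply: eq_bigr => i _; rewrite mxE mulNr -mulrN; congr (_ * _).
have := ug tphit i; under eq_integral do rewrite partial_shift.
rewrite !ipE// -EFinN => -[E].
by rewrite [ip leb _ u]ipC E opprK.
Qed.

(** The Taylor formula holds when tested on a bump, because everything can be moved onto the bump:
    the increment of u becomes an increment of [phi], which is the integral of [psi] along a
    segment, and for each t the weak gradient turns [psi] back into g. *)
Lemma slide_weak : ip prodm (slide phi 0)
  (slide (fun x => u (x + z) - u x) 0 \- slide (fun x => dot (g x) z) z) = 0.
Proof.
have sG := sqint_dot z; have sd := sqint_diff z su.
have sl w v : sqint leb w -> sqint prodm (slide w v) by exact: sqint_slide.
rewrite ipC ipBl//; [|exact: sl|exact: sl|exact: sl].
rewrite ip_slide//; apply/eqP; rewrite subr_eq0; apply/eqP.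
transitivity (ip leb u (fun x => phi (x - z) - phi x)).
  have sh := sqint_shift z su; have sphi' := sqint_shift (- z) sphi.
  rewrite [RHS]ipC (ipBl (f1 := fun x : V => phi (x - z)) sphi' sphi su).
  rewrite (ipBl (f1 := fun x : V => u (x + z)) sh su sphi) [ip leb phi u]ipC; congr (_ - _).
  rewrite -(ip_shift (- z) sh sphi) ipC; congr ip.
  by apply/funext => x; rewrite subrK.
(* For fixed x the integral in t is computed by [phi_line]. *)
transitivity (ip prodm (slide u 0) (slide psi (- z))).
  apply: EFin_inj; rewrite -(ipE (sl _ _ su) (sl _ _ spsi)).
  rewrite -integral21_prod_meas1; last first.
    exact: sqint_mul_integrable (sl _ _ su) (sl _ _ spsi).
  rewrite -ipE//; last exact: (sqint_sub (sqint_shift (- z) sphi) sphi).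
  apply: eq_integral => x _; rewrite EFinM -phi_line /fubini_G /slide /=.
  rewrite -integralZl//.
    rewrite integral_mkcond; apply: eq_integral => t _; rewrite patchE indicE.
    by case: ifPn => tI; rewrite ?mul0r// !mul1r scaler0 addr0.
  apply: continuous_compact_integrable; first exact: segment_compact.
  by apply: continuous_subspaceT; exact: psi_line_continuous.
(* The order of integration is now reversed: for fixed t the integrals in x agree by
   [weak_gradient_shift]. *)
apply: EFin_inj; rewrite -(ipE (sl _ _ su) (sl _ _ spsi)) ipC -(ipE (sl _ _ sphi) (sl _ _ sG)).
rewrite -!integral12_prod_meas1; [|
  exact: sqint_mul_integrable (sl _ _ sphi) (sl _ _ sG)|
  exact: sqint_mul_integrable (sl _ _ su) (sl _ _ spsi)].
apply: eq_integral => t _; rewrite /fubini_F /slide /= indicE.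
have [tI|tI] := boolP (t \in `[0, 1]%classic); last first.
  by under eq_integral do rewrite !mul0r; under [RHS]eq_integral do rewrite !mul0r.
under eq_integral do rewrite !mul1r scaler0 addr0.
under [RHS]eq_integral do rewrite !mul1r scaler0 addr0.
have spt := sqint_shift (t *: - z) spsi; have sGt := sqint_shift (t *: z) sG.
rewrite !ipE// -weak_gradient_shift; congr EFin.
have sphit := sqint_shift (t *: - z) sphi.
rewrite -(ip_shift (t *: z) sphit sG); congr ip; apply/funext => x.
by rewrite scalerN addrK.
Qed.

End against_bump.

(** The extension from bumps to L^2 allows the Taylor remainder itself to serve as test function. *)
Theorem slide_weak_L2 z phi : sqint leb phi -> ip prodm (slide phi 0)
  (slide (fun x => u (x + z) - u x) 0 \- slide (fun x => dot (g x) z) z) = 0.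
Proof.
have sG := sqint_dot z; have sd := sqint_diff z su.
have sl w v : sqint leb w -> sqint prodm (slide w v) by exact: sqint_slide.
have sS : sqint prodm (slide (fun x => u (x + z) - u x) 0 \- slide (fun x => dot (g x) z) z).
  by apply: sqint_sub; exact: sl.
move: phi; apply: density.
- by move=> a b m; exact: slide_weak.
- move=> k f1 f2 s1 s2 e1 e2; rewrite slide_lin ip_lin//; [|exact: sl|exact: sl].
  by rewrite e1 e2 mulr0 addr0.
- move=> f_ f sf_ e_ sf cf.
  have s_ m := sl (f_ m) 0 (sf_ m); have s0 := sl f 0 sf.
  apply: (ip_lim0 s_ s0 sS _ e_).
  apply: cvg_trans cf; apply: near_eq_cvg; apply: nearW => m.
  by rewrite -slideB sqnorm_slide//; exact: sqint_sub.
Qed.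

(* With h the remainder, H (t, x) = h x and K (t, x) = g (x + t z) . z - g x . z,
   the relation against h reads H _|_ H - K, so ||H||^2 + ||H - K||^2 = ||K||^2. *)
Theorem taylor_remainder z (e : R) : 0 <= e ->
  (forall t, 0 <= t <= 1 ->
    nsq leb (fun x => dot (g (x + t *: z)) z - dot (g x) z) <= e) ->
  nsq leb (fun x => u (x + z) - u x - dot (g x) z) <= e.
Proof.
move=> e0 He; have sG := sqint_dot z; have sd := sqint_diff z su.
have sl w v : sqint leb w -> sqint prodm (slide w v) by exact: sqint_slide.
pose G x := dot (g x) z.
pose h x := u (x + z) - u x - G x.
have sh : sqint leb h by exact: (sqint_sub sd sG).
pose H := slide h 0; pose K := slide G z \- slide G 0.
have sH : sqint prodm H by exact: sl.
have sK : sqint prodm K by apply: sqint_sub; exact: sl.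
have HK : ip prodm H (H \- K) = 0.
  rewrite -(slide_weak_L2 z sh); congr ip; apply/funext => p.
  rewrite /H /K /slide /h /G /= scaler0 addr0; ring.
pose D := H \- K; have sD : sqint prodm D by exact: sqint_sub.
have KH : K = (fun p => (-1) * D p + H p) by apply/funext => p; rewrite /D /=; ring.
have ipK X : sqint prodm X -> ip prodm K X = - ip prodm D X + ip prodm H X.
  by move=> sX; rewrite KH ip_lin// mulN1r.
have nK : nsq prodm K = nsq prodm D + nsq prodm H.
  rewrite -!ip_self ipK// [ip prodm D K]ipC [ip prodm H K]ipC !ipK//.
  by rewrite [ip prodm D H]ipC HK; ring.
have nH : nsq prodm H = nsq leb h by rewrite /nsq sqnorm_slide.
rewrite -nH; apply: (@le_trans _ _ (nsq prodm K)); first by rewrite nK lerDr nsq_ge0.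
rewrite -lee_fin -nsqE//.
have -> : K = (fun p => \1_`[0, 1]%classic p.1 * (G (p.2 + p.1 *: z) - G p.2)).
  by apply/funext => p; rewrite /K /slide /= scaler0 addr0 mulrBr.
have mG : measurable_fun setT G by have [] := sG.
apply: (@sqnorm_prod_le _ _ (fun p => G (p.2 + p.1 *: z) - G p.2)) => //.
  apply: measurable_funB; last by apply: (measurableT_comp mG); exact: measurable_snd.
  apply: (measurableT_comp mG); apply: measurable_fun_addrV; first exact: measurable_snd.
  by apply: measurable_fun_scalerV; [exact: measurable_fst|exact: measurable_cst].
move=> t tI; rewrite nsqE ?lee_fin; first exact: He.
exact: (sqint_sub (sqint_shift (t *: z) sG) sG).
Qed.

End weak_gradient.

(** * Difference quotients *)

Section minkowski.
Context d (T : measurableType d) (R : realType) (mu : {measure set T -> \bar R}).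
Implicit Types (f g : T -> R).

Definition nrm f : R := Num.sqrt (nsq mu f).

Lemma nrm_ge0 f : 0 <= nrm f.
Proof. exact: sqrtr_ge0. Qed.

Lemma nrm_sq f : nrm f ^+ 2 = nsq mu f.
Proof. by rewrite sqr_sqrtr// nsq_ge0. Qed.

Lemma nrm_le f M : 0 <= M -> (nrm f <= M) = (nsq mu f <= M ^+ 2).
Proof. by move=> M0; rewrite -nrm_sq ler_pXn2r// nnegrE nrm_ge0. Qed.

Lemma nrmD f g : sqint mu f -> sqint mu g -> nrm (f \+ g) <= nrm f + nrm g.
Proof.
move=> sf sg; rewrite nrm_le ?addr_ge0 ?nrm_ge0//.
set a := nrm f; set b := nrm g.
have a0 : 0 <= a by exact: nrm_ge0.
have b0 : 0 <= b by exact: nrm_ge0.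
apply/ler_addgt0Pr => e e0.
(* The optimal weight would be b/a. Adding [t] to both terms avoids a zero denominator and costs t
   (a + b) <= e in the squared inequality. *)
pose t := e / (a + b + 1).
have ab1 : 0 < a + b + 1 by lra.
have t0 : 0 < t by rewrite divr_gt0.
have at0 : 0 < a + t by lra.
have bt0 : 0 < b + t by lra.
have d0 : 0 < (b + t) / (a + t) by rewrite divr_gt0.
apply: le_trans (nsqD_weighted d0 sf sg) _; rewrite -!nrm_sq -/a -/b invf_div.
have h1 : (b + t) / (a + t) * a ^+ 2 <= (b + t) * a.
  rewrite mulrAC ler_pdivrMr// expr2 -mulrA ler_wpM2l ?(ltW bt0)//.
  by rewrite ler_wpM2l// lerDl ltW.
have h2 : (a + t) / (b + t) * b ^+ 2 <= (a + t) * b.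
  rewrite mulrAC ler_pdivrMr// expr2 -mulrA ler_wpM2l ?(ltW at0)//.
  by rewrite ler_wpM2l// lerDl ltW.
have h3 : t * (a + b) <= e.
  rewrite /t mulrAC ler_pdivrMr//; apply: ler_wpM2l; first exact: ltW.
  by rewrite lerDl.
lra.
Qed.

Lemma nrmZ k f : sqint mu f -> nrm (fun x => k * f x) = `|k| * nrm f.
Proof. by move=> sf; rewrite /nrm nsqZ// sqrtrM ?sqr_ge0// sqrtr_sqr. Qed.

Lemma nrmN f : sqint mu f -> nrm (fun x => - f x) = nrm f.
Proof.
move=> sf; rewrite -[RHS]mul1r -(normrN1 R) -nrmZ//; congr nrm.
by apply/funext => x; rewrite mulN1r.
Qed.

Lemma nrm_dist f g : sqint mu f -> sqint mu g -> `|nrm f - nrm g| <= nrm (f \- g).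
Proof.
move=> sf sg; have sfg := sqint_sub sf sg; have sgf := sqint_sub sg sf.
rewrite ler_norml; apply/andP; split.
  rewrite lerNl opprB lerBlDr -(nrmN sfg).
  rewrite {1}(_ : g = (fun x => - (f \- g) x) \+ f); last by apply/funext => x /=; ring.
  by apply: nrmD => //; move: sgf; congr sqint; apply/funext => x /=; ring.
rewrite lerBlDr {1}(_ : f = (f \- g) \+ g); last by apply/funext => x /=; ring.
exact: nrmD.
Qed.

End minkowski.

Section euclidean_norm.
Variables (R : realType) (n : nat).
Local Notation V := 'rV[R]_n.
Implicit Types z : V.

Lemma enorm_ge0 z : 0 <= enorm z.
Proof. exact: sqrtr_ge0. Qed.

Lemma coord_le_enorm z i : `|z 0 i| <= enorm z.
Proof.
rewrite -sqrtr_sqr; apply: ler_wsqrtr; rewrite /dot (bigD1 i)//= -expr2 lerDl.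
by apply: sumr_ge0 => j _; rewrite -expr2 sqr_ge0.
Qed.

Lemma enormZ k z : enorm (k *: z) = `|k| * enorm z.
Proof.
rewrite /enorm (_ : dot (k *: z) (k *: z) = k ^+ 2 * dot z z).
  by rewrite sqrtrM ?sqr_ge0// sqrtr_sqr.
by rewrite /dot mulr_sumr; apply: eq_bigr => i _; rewrite !mxE; ring.
Qed.

Lemma enorm0_eq0 z : enorm z = 0 -> z = 0.
Proof.
move=> z0; apply/rowP => i; rewrite mxE; apply/eqP; rewrite -normr_le0 -z0.
exact: coord_le_enorm.
Qed.

Lemma enorm0 : enorm (0 : V) = 0.
Proof. by rewrite -(scale0r (0 : V)) enormZ normr0 mul0r. Qed.

Lemma enorm_gt0 z : z <> 0 -> 0 < enorm z.
Proof. by move=> z0; rewrite lt_def enorm_ge0 andbT; apply/eqP => /enorm0_eq0. Qed.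

Lemma cvg_sumr (I : Type) (s : seq I) (f : I -> nat -> R) (l : I -> R) :
  (forall i, f i k @[k --> \oo] --> l i) ->
  \sum_(i <- s) f i k @[k --> \oo] --> \sum_(i <- s) l i.
Proof.
by move=> fl; apply: (@cvg_big _ _ +%R) => [|i _]; [exact: add_continuous|exact: fl].
Qed.

Lemma cvg_enorm (z_ : nat -> V) z : (forall i, z_ k 0 i @[k --> \oo] --> z 0 i) ->
  enorm (z_ k) @[k --> \oo] --> enorm z.
Proof.
move=> zz; have h : dot (z_ k) (z_ k) @[k --> \oo] --> dot z z.
  by apply: cvg_sumr => i; apply: cvgM; exact: zz.
by apply: (cvg_comp _ _ h); exact: sqrt_continuous.
Qed.

Lemma measurable_enorm : measurable_fun setT (@enorm R n).
Proof.
apply: (measurableT_comp (f := @Num.sqrt R)).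
  by apply: continuous_measurable_fun; exact: sqrt_continuous.
by apply: measurable_sum => i; apply: measurable_funM; exact: measurable_coord_rV.
Qed.

End euclidean_norm.

(** * The quotient ||u(. + z) - u|| / |z| and its limits *)

Section difference_quotient.
Variables (R : realType) (n : nat).
Local Notation V := 'rV[R]_n.
Local Notation leb := (@lebesgue_rV R n).
Variables (u : V -> R) (g : V -> V).
Hypothesis su : sqint leb u.
Hypothesis sg : forall i, sqint leb (fun x => g x 0 i).
Hypothesis ug : forall phi, test_function phi -> forall i : 'I_n,
  (\int[leb]_x (u x * partial i phi x)%:E = - \int[leb]_x (g x 0 i * phi x)%:E)%E.

Let A := \sum_(i < n) nrm leb (fun x => g x 0 i).

Let A0 : 0 <= A.
Proof. by apply: sumr_ge0 => i _; exact: nrm_ge0. Qed.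

Lemma nrm_sum (f : 'I_n -> V -> R) (z : V) (M : R) : (forall i, sqint leb (f i)) ->
  (forall i, `|z 0 i| <= M) ->
  nrm leb (fun x => \sum_(i < n) z 0 i * f i x) <= M * \sum_(i < n) nrm leb (f i).
Proof.
move=> sf zM.
suff : sqint leb (fun x => \sum_(i < n) z 0 i * f i x) /\
  nrm leb (fun x => \sum_(i < n) z 0 i * f i x) <= M * \sum_(i < n) nrm leb (f i) by case.
elim: (index_enum _) => [|i s [IH1 IH2]].
  under eq_fun do rewrite big_nil; rewrite big_nil mulr0; split; first exact: sqint_zero.
  rewrite nrm_le// /nsq /sqnorm; under eq_integral do rewrite expr0n.
  by rewrite integral0 expr0n.
under eq_fun do rewrite big_cons; rewrite big_cons; split; first exact: sqint_lin.
apply: le_trans (nrmD (sqintZ _ (sf i)) IH1) _; rewrite mulrDr lerD// nrmZ//.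
by rewrite ler_wpM2r// nrm_ge0.
Qed.

Lemma nrm_dot (z : V) (M : R) : (forall i, `|z 0 i| <= M) ->
  nrm leb (fun x => dot (g x) z) <= M * A.
Proof. by move=> zM; under eq_fun do rewrite dotE; exact: nrm_sum. Qed.

Lemma dotBl (x y z : V) : dot x z - dot y z = dot (x - y) z.
Proof.
by rewrite /dot -sumrB; apply: eq_bigr => i _; rewrite !mxE mulrBl.
Qed.

Definition remainder z : R := nrm leb (fun x => u (x + z) - u x - dot (g x) z).

(** The scalar product with z costs a factor |z|, as each coordinate is at most |z|; what is left is
    the L^2 oscillation of the gradient along the segment. *)
Lemma remainder_le (z : V) (e : R) : 0 <= e ->
  (forall t : R, 0 <= t <= 1 ->
    \sum_(i < n) nrm leb (fun x => g (x + t *: z) 0 i - g x 0 i) <= e) ->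
  remainder z <= enorm z * e.
Proof.
move=> e0 He; rewrite /remainder nrm_le ?mulr_ge0 ?enorm_ge0//.
apply: (taylor_remainder su sg ug); first by rewrite sqr_ge0.
move=> t tI; rewrite -nrm_le ?mulr_ge0 ?enorm_ge0//.
under eq_fun do rewrite dotBl dotE.
apply: (@le_trans _ _ (enorm z * \sum_(i < n) nrm leb (fun x => g (x + t *: z) 0 i - g x 0 i))); last first.
  by rewrite ler_wpM2l ?enorm_ge0//; exact: He.
under eq_fun do under eq_bigr do rewrite mxE [X in _ + X]mxE.
apply: nrm_sum; last exact: coord_le_enorm.
by move=> i; exact: (sqint_diff (t *: z) (sg i)).
Qed.

Lemma remainder_bound z : remainder z <= enorm z * (2 * A).
Proof.
apply: remainder_le; first by rewrite mulr_ge0.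
move=> t _; rewrite /A mulr_sumr; apply: ler_sum => i _.
have sgt := sqint_shift (t *: z) (sg i).
rewrite (_ : (fun x => _) = (fun x : V => g (x + t *: z) 0 i) \+ (fun x => - g x 0 i))//.
have sgN : sqint leb (fun x => - g x 0 i).
  by have := sqintZ (-1) (sg i); congr sqint; apply/funext => x; rewrite mulN1r.
apply: le_trans (nrmD sgt sgN) _; rewrite nrmN//.
by rewrite {1}/nrm (nsq_shift _ (sg i)) -/(nrm _ _) mulr_natl mulr2n.
Qed.

Lemma remainder_small (e : R) : 0 < e -> exists2 eta, 0 < eta &
  forall z : V, (forall i, `|z 0 i| < eta) -> remainder z <= enorm z * e.
Proof.
move=> e0; pose e1 := e / n.+1%:R.
have e10 : 0 < e1 by rewrite divr_gt0.
have /choice[eta Heta] : forall i : 'I_n, exists eta : R, 0 < eta /\ forall h : V,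
    (forall j, `|h 0 j| < eta) -> nsq leb (fun x => g (x + h) 0 i - g x 0 i) <= e1 ^+ 2.
  move=> i; have e20 : 0 < e1 ^+ 2 by rewrite exprn_gt0.
  by have [eta ? ?] := sqint_translation_continuous (sg i) e20; exists eta.
(* 1/S is below every [eta i], and it stays positive when there are no coordinates. *)
pose S := 1 + \sum_(i < n) (eta i)^-1.
have S0 : 0 < S.
  rewrite ltr_wpDr//; apply: sumr_ge0 => i _; rewrite invr_ge0 ltW//.
  by have [] := Heta i.
exists S^-1; first by rewrite invr_gt0.
move=> z zS; apply: remainder_le; first exact: ltW.
move=> t /andP[t0 t1].
apply: (@le_trans _ _ (\sum_(i < n) e1)); last first.
  rewrite sumr_const card_ord -mulr_natr /e1 mulrAC ler_pdivrMr//.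
  by rewrite ler_wpM2l ?(ltW e0)// ler_nat.
apply: ler_sum => i _; rewrite nrm_le ?(ltW e10)//.
have [etai0 ->//] := Heta i => j; rewrite mxE normrM (ger0_norm t0).
apply: (@le_lt_trans _ _ `|z 0 j|); first by rewrite ler_piMl.
apply: lt_le_trans (zS j) _; rewrite invf_ple ?posrE//.
rewrite /S (bigD1 i)//= addrCA lerDl addr_ge0//.
by apply: sumr_ge0 => k _; rewrite invr_ge0 ltW//; have [] := Heta k.
Qed.

Definition incr z : R := nrm leb (fun x => u (x + z) - u x).

(** The remainder contributes 2A and the linear term A. *)
Lemma incr_lipschitz z : incr z <= 3 * A * enorm z.
Proof.
have sd := sqint_diff z su; have sG := sqint_dot sg z.
have sr : sqint leb (fun x => u (x + z) - u x - dot (g x) z) := sqint_sub sd sG.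
rewrite /incr (_ : (fun x => _) = (fun x => u (x + z) - u x - dot (g x) z) \+ (fun x => dot (g x) z)).
  apply: le_trans (nrmD sr sG) _.
  have := remainder_bound z; have := nrm_dot (@coord_le_enorm _ _ z); rewrite /remainder => *; lra.
by apply/funext => x /=; ring.
Qed.

Lemma incr_bound z : incr z <= 2 * nrm leb u.
Proof.
have suz := sqint_shift z su.
have suN : sqint leb (fun x => - u x).
  by have := sqintZ (-1) su; congr sqint; apply/funext => x; rewrite mulN1r.
rewrite /incr; apply: le_trans (nrmD suz suN) _.
by rewrite nrmN// {1}/nrm nsq_shift// -/(nrm _ _) mulr_natl mulr2n.
Qed.

(** The reverse triangle inequality leaves the norm of u(. + z) - u(. + z'), which by translation
    invariance is the increment at z - z'. *)
Lemma incr_dist z z' : `|incr z - incr z'| <= 3 * A * enorm (z - z').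
Proof.
have sd := sqint_diff z su; have sd' := sqint_diff z' su.
apply: le_trans (nrm_dist sd sd') _; apply: le_trans (incr_lipschitz (z - z')).
rewrite /incr /nrm -(nsq_shift z' (sqint_diff (z - z') su)).
rewrite le_eqVlt; apply/orP; left; apply/eqP; congr (Num.sqrt (nsq _ _)).
apply/funext => x /=.
have -> : x + z' + (z - z') = x + z by rewrite -addrA; congr (x + _); rewrite addrC subrK.
ring.
Qed.

Definition dq z : R := incr z / enorm z.

Lemma dq_ge0 z : 0 <= dq z.
Proof. by rewrite divr_ge0 ?nrm_ge0 ?enorm_ge0. Qed.

Lemma dq_bound z : dq z <= 3 * A.
Proof.
rewrite /dq; have [->|/eqP z0] := eqVneq z 0.
  by rewrite enorm0 invr0 mulr0 mulr_ge0.
by rewrite ler_pdivrMr ?enorm_gt0// incr_lipschitz.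
Qed.

(* The value of [dq] at the point of modulus s = |z| / (1 + |z|) and direction
   sigma of the compactification. *)
Definition dq_lim (s : R) (sigma : V) : R :=
  if s <= 0 then nrm leb (fun x => dot (g x) sigma)
  else if 1 <= s then 0 else dq ((s / (1 - s)) *: sigma).

Lemma incr_linear_dist z : `|incr z - nrm leb (fun x => dot (g x) z)| <= remainder z.
Proof. exact: nrm_dist (sqint_diff z su) (sqint_dot sg z). Qed.

Lemma nrm_dot_scale k z :
  nrm leb (fun x => dot (g x) (k *: z)) = `|k| * nrm leb (fun x => dot (g x) z).
Proof.
rewrite -nrmZ; last exact: sqint_dot.
congr nrm; apply/funext => x; rewrite /dot mulr_sumr; apply: eq_bigr => i _.
by rewrite mxE; ring.
Qed.

Lemma nrm_dot_dist z z' : `|nrm leb (fun x => dot (g x) z) - nrm leb (fun x => dot (g x) z')| <=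
  A * \sum_(i < n) `|z 0 i - z' 0 i|.
Proof.
apply: le_trans (nrm_dist (sqint_dot sg z) (sqint_dot sg z')) _; rewrite mulrC.
rewrite (_ : _ \- _ = (fun x => dot (g x) (z - z'))); last first.
  apply/funext => x; rewrite /dot /= -sumrB; apply: eq_bigr => i _.
  by rewrite !mxE mulrBr.
apply: nrm_dot => i; rewrite !mxE (bigD1 i)//= lerDl.
by apply: sumr_ge0 => j _.
Qed.

(** At s = 0 the increment is replaced by its linear part, whose quotient depends continuously on
    the direction. At s = 1 the quotient is at most 2||u||/|z|. In between, z_k converges to a
    non-zero vector, near which the increment is Lipschitz. *)
Lemma dq_cvg (z_ : nat -> V) (s : R) (sigma : V) :
  (forall k, z_ k <> 0) ->
  enorm (z_ k) / (1 + enorm (z_ k)) @[k --> \oo] --> s ->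
  (forall i, (enorm (z_ k))^-1 * z_ k 0 i @[k --> \oo] --> sigma 0 i) ->
  dq (z_ k) @[k --> \oo] --> dq_lim s sigma.
Proof.
move=> z0 cs ct; pose r k := enorm (z_ k); pose S k := r k / (1 + r k).
have r0 k : 0 < r k by exact: enorm_gt0.
have r1 k : 0 < 1 + r k by rewrite ltr_wpDr// ltW.
have S0 k : 0 < S k by rewrite divr_gt0.
have S1 k : S k < 1 by rewrite ltr_pdivrMr// mul1r ltrDr.
have s0 : 0 <= s by apply: (cvgr_to_ge cs); apply: nearW => k; exact: ltW (S0 k).
have s1 : s <= 1 by apply: (cvgr_to_le cs); apply: nearW => k; exact: ltW (S1 k).
have rS k : r k = S k / (1 - S k).
  rewrite /S; have r10 : 1 + r k != 0 by rewrite gt_eqF.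
  have -> : 1 - r k / (1 + r k) = (1 + r k)^-1 by field.
  by rewrite invrK mulfVK.
have cr : s < 1 -> r k @[k --> \oo] --> s / (1 - s).
  move=> s1'; rewrite (_ : r = fun k => S k / (1 - S k)); last by apply/funext.
  apply: cvgM => //; apply: cvgV; first by rewrite gt_eqF// subr_gt0.
  by apply: cvgB => //; exact: cvg_cst.
rewrite /dq_lim; case: (leP s 0) => [s0'|sp].
  have {s0 s1 s0'} E : s = 0 by apply/eqP; rewrite eq_le s0 s0'.
  have {}cr : r k @[k --> \oo] --> (0 : R).
    by have := cr; rewrite E ltr01 mul0r; apply.
  apply/cvgrPdist_le => e e0.
  have e20 : 0 < e / 2 by rewrite divr_gt0.
  have [eta eta0 Heta] := remainder_small e20.
  have csum : A * \sum_(i < n) `|(r k)^-1 * z_ k 0 i - sigma 0 i| @[k --> \oo] --> (0 : R).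
    rewrite -[X in _ --> X](mulr0 A); apply: cvgM; first exact: cvg_cst.
    rewrite [X in _ --> X](_ : _ = \sum_(i < n) (0 : R)); last by rewrite big1.
    apply: cvg_sumr => i; rewrite -[X in _ --> X](normr0 R) -[X in `|X|](subrr (sigma 0 i)).
    by apply: cvg_norm; apply: cvgB; [exact: ct|exact: cvg_cst].
  near=> k.
  have h1 : r k < eta.
    near: k; move/cvgrPdist_lt : cr => /(_ _ eta0); apply: filterS => k.
    by rewrite sub0r normrN; apply: le_lt_trans; exact: ler_norm.
  have h2 : A * \sum_(i < n) `|(r k)^-1 * z_ k 0 i - sigma 0 i| <= e / 2.
    near: k; move/cvgrPdist_le : csum => /(_ _ e20); apply: filterS => k.
    by rewrite sub0r normrN; apply: le_trans; exact: ler_norm.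
  have h3 : remainder (z_ k) <= r k * (e / 2).
    by apply: Heta => i; apply: le_lt_trans (coord_le_enorm _ _) h1.
  have h4 : `|dq (z_ k) - nrm leb (fun x => dot (g x) ((r k)^-1 *: z_ k))| <= e / 2.
    have rV : `|(r k)^-1| = (r k)^-1 by rewrite gtr0_norm// invr_gt0.
    rewrite nrm_dot_scale rV [(r k)^-1 * _]mulrC /dq -/(r k) -mulrBl normrM rV.
    rewrite ler_pdivrMr// mulrC.
    exact: le_trans (incr_linear_dist _) h3.
  have := nrm_dot_dist ((r k)^-1 *: z_ k) sigma; under eq_bigr do rewrite mxE.
  move=> /le_trans/(_ h2) h5.
  move: h4 h5; rewrite !ler_distl => /andP[? ?] /andP[? ?]; apply/andP; split; lra.
case: (leP 1 s) => [s1'|sl1].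
  have {s0 s1 s1'} E : s = 1 by apply/eqP; rewrite eq_le s1 s1'.
  apply: (@squeeze_cvgr _ _ _ _ (cst 0) (fun k => 2 * nrm leb u * ((1 - S k) / S k))).
  - apply: nearW => k; rewrite dq_ge0 /dq -/(r k) rS invf_div /=.
    rewrite ler_wpM2r ?incr_bound// divr_ge0// ?(ltW (S0 k))// subr_ge0.
    exact: ltW.
  - exact: cvg_cst.
  - rewrite -[X in _ --> X](mulr0 (2 * nrm leb u)); apply: cvgM; first exact: cvg_cst.
    rewrite -[X in _ --> X](mul0r 1^-1); apply: cvgM.
      by rewrite -[X in _ --> X](subrr s) {1}E; apply: cvgB => //; exact: cvg_cst.
    by rewrite -E; apply: cvgV => //; rewrite E oner_neq0.
have {}cr := cr sl1; set rho := s / (1 - s) in cr *.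
have rho0 : 0 < rho by rewrite divr_gt0// subr_gt0.
have cz i : z_ k 0 i @[k --> \oo] --> (rho *: sigma) 0 i.
  rewrite mxE (_ : (fun k => _) = (fun k => r k * ((r k)^-1 * z_ k 0 i))).
    by apply: cvgM => //; exact: ct.
  by apply/funext => k; rewrite mulVKf// gt_eqF.
have ce := cvg_enorm cz.
(* Both sides are limits of |z_k|; in particular the denominator has a non-zero limit. *)
have En : enorm (rho *: sigma) = rho by apply: cvg_unique ce cr.
apply: cvgM; last by apply: cvgV => //; rewrite En gt_eqF.
have c0 : 3 * A * enorm (z_ k - rho *: sigma) @[k --> \oo] --> (0 : R).
  rewrite -[X in _ --> X](mulr0 (3 * A)); apply: cvgM; first exact: cvg_cst.
  rewrite -(enorm0 R n); apply: cvg_enorm => i.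
  rewrite mxE -(subrr ((rho *: sigma) 0 i)).
  under eq_fun do rewrite mxE [X in _ + X]mxE.
  by apply: cvgB; [exact: cz|exact: cvg_cst].
apply/cvgrPdist_le => e e0; near=> k; rewrite distrC.
apply: le_trans (incr_dist _ _) _.
near: k; move/cvgrPdist_le : c0 => /(_ _ e0); apply: filterS => k.
by rewrite sub0r normrN; apply: le_trans; exact: ler_norm.
Unshelve. all: by end_near. Qed.

End difference_quotient.

(** * Weak compactness of bounded densities *)

Section common_subsequence.
Variable R : realType.

Lemma ultra_bounded_limit (U : set_system nat) (m : nat -> R) (C : R) :
  UltraFilter U -> (forall k, 0 <= m k <= C) ->
  exists p, forall e, 0 < e -> U [set k | `|m k - p| < e].
Proof.
move=> FU mC; have PU : ProperFilter U by exact: ultra_proper.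
have [p [_ clp]] : `[0, C]%classic `&` cluster (m @ U) !=set0.
  apply: (@segment_compact R 0 C).
  apply: (@filterS _ U _ setT) => [k _|]; last exact: filterT.
  by rewrite /= in_itv/=; exact: mC.
exists p => e e0; have [//|UC] := in_ultra_setVsetC [set k | `|m k - p| < e] FU.
have [||x []] := clp (m @` [set k | `|m k - p| >= e]) (ball p e).
- have : U (m @^-1` (m @` [set k | `|m k - p| >= e])); last by [].
  by apply: filterS UC => k /= h; exists k => //=; rewrite leNgt; exact/negP.
- exact: nbhsx_ballx.
by move=> [k /= h <-]; rewrite /ball /= distrC ltNge h.
Qed.

(** An ultrafilter finer than the neighbourhoods of infinity gives limits for all the sequences at
    once, in place of a diagonal extraction. The index [kap j] is then picked in a finite
    intersection of its members: at least j, and with the entries n, i < j within 1/(j+1) of their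
    limits. *)
Lemma common_subsequence (m : nat -> nat -> nat -> R) (C : R) :
  (forall k n i, 0 <= m k n i <= C) ->
  exists (kap : nat -> nat) (p : nat -> nat -> R), (forall j, (j <= kap j)%N) /\
    forall n i, m (kap j) n i @[j --> \oo] --> p n i.
Proof.
move=> mC.
have [U [FU ooU]] := @ultraFilterLemma _ \oo%classic _.
have PU : ProperFilter U by exact: ultra_proper.
have /choice[p Hp] : forall ni : nat * nat, exists p, forall e, 0 < e ->
    U [set k | `|m k ni.1 ni.2 - p| < e].
  by move=> [n i]; apply: (@ultra_bounded_limit _ (fun k => m k n i) C).
have /choice[kap Hkap] : forall j : nat, exists k, (j <= k)%N /\
    forall n i, (n < j)%N -> (i < j)%N -> `|m k n i - p (n, i)| < j.+1%:R^-1.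
  move=> j; have Uj : U [set k | (j <= k)%N] := ooU _ (nbhs_infty_ge j).
  apply: (@filter_ex _ U); apply: filterI; first exact: Uj.
  have : U [set k | forall ni : 'I_j * 'I_j,
      `|m k ni.1 ni.2 - p (nat_of_ord ni.1, nat_of_ord ni.2)| < j.+1%:R^-1].
    by apply: filter_forall => -[n i]; apply: (Hp (_, _)); rewrite invr_gt0.
  by apply: filterS => k h n i nj ij; exact: (h (Ordinal nj, Ordinal ij)).
exists kap, (fun n i => p (n, i)); split => [j|n i]; first by have [] := Hkap j.
apply/cvgrPdist_lt => e e0; near=> j.
rewrite distrC; apply: lt_trans (_ : j.+1%:R^-1 < e).
  have [_] := Hkap j; apply.
    by near: j; exact: nbhs_infty_gt.
  by near: j; exact: nbhs_infty_gt.
near: j; exact: near_infty_natSinv_lt (PosNum e0).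
Unshelve. all: by end_near. Qed.

End common_subsequence.

Section separating_bits.
Variables (R : realType) (d : _) (T : measurableType d) (n : nat).
Variables (X : T -> 'rV[R]_n) (D : set T).
Hypothesis mX : measurable_fun setT X.
Hypothesis XD : forall z, D z -> forall i, `|X z 0 i| <= 1.

(* The bits are the half-spaces with rational thresholds. *)
Lemma separating_bits : exists bit : nat -> T -> bool,
  (forall m, measurable [set z | bit m z]) /\
  forall e : R, 0 < e -> exists m, forall z z', D z -> D z' ->
    (forall k, (k < m)%N -> bit k z = bit k z') -> forall i, `|X z 0 i - X z' 0 i| <= e.
Proof.
pose c (iq : 'I_n * rat) z : bool := X z 0 iq.1 < ratr iq.2.
have [e eK] : exists e : nat -> option ('I_n * rat), forall iq, exists m, e m = Some iq.
  by exists unpickle => iq; exists (pickle iq); exact: pickleK.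
pose bit m z := if e m is Some iq then c iq z else false.
exists bit; split.
  rewrite /bit => m; case: (e m) => [[i q]|]; last first.
    by rewrite (_ : [set _ | _] = set0)//; apply/seteqP; split.
  rewrite (_ : mkset _ = X @^-1` ((fun x => x 0 i) @^-1` `]-oo, (ratr q : R)[%classic)).
    rewrite -[X in measurable X]setTI; apply: mX => //.
    by rewrite -[X in measurable X]setTI; apply: measurable_coord_rV.
  by apply/seteqP; split => z /=; rewrite in_itv.
move=> eps eps0.
have [K [K0 Ke]] : exists K : nat, (0 < K)%N /\ K%:R^-1 < eps.
  exists (Num.truncn eps^-1).+1; split => //.
  by rewrite invf_plt ?posrE ?ltr0n// truncnS_gt.
(* A grid of mesh 1/K on [-1, 1]. The indices run up to 2K+1, so that some threshold lies strictly
   above the value 1. *)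
pose q (j : nat) : rat := j%:R / K%:R - 1.
have /choice[r Hr] := eK.
pose m := (\max_(iq : 'I_n * 'I_(2 * K).+2) r (iq.1, q iq.2)).+1.
exists m => z z' Dz Dz' zz'.
have H x x' i : D x -> D x' -> (forall k, (k < m)%N -> bit k x = bit k x') ->
   X x 0 i - X x' 0 i <= eps.
  move=> Dx Dx' xx'; rewrite leNgt; apply/negP => lt_eps.
  (* The first threshold strictly above the value at x'. It exceeds that value by at most 1/K < eps,
     hence lies below the value at x, and its bit separates the two points. *)
  pose j := (Num.truncn ((X x' 0 i + 1) * K%:R)).+1.
  have KR0 : 0 < K%:R :> R by rewrite ltr0n.
  have /andP[h1 h2] : - 1 <= X x' 0 i <= 1 by rewrite -ler_norml; exact: XD.
  have pos : 0 <= (X x' 0 i + 1) * K%:R by rewrite mulr_ge0// ?ler0n//; lra.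
  have /andP[t1 t2] := Num.Theory.truncn_itv pos.
  have jK : (j < (2 * K).+2)%N.
    rewrite /j !ltnS -(ler_nat R); apply: le_trans t1 _.
    by rewrite natrM ler_pM2r//; lra.
  have := xx' (r (i, q j)).
  rewrite /bit Hr /c /=.
  have -> : ratr (q j) = j%:R / K%:R - 1 :> R.
    by rewrite /q rmorphB rmorph1 fmorph_div !rmorph_nat.
  have -> : X x' 0 i < j%:R / K%:R - 1 by rewrite ltrBrDr ltr_pdivlMr.
  have -> : (X x 0 i < j%:R / K%:R - 1) = false.
    apply/negbTE; rewrite -leNgt lerBlDr ler_pdivrMr//.
    have t1' : j%:R <= (X x' 0 i + 1) * K%:R + 1 by rewrite /j -natr1; lra.
    apply: le_trans t1' _.
    have : 1 < eps * K%:R by rewrite -ltr_pdivrMr// mul1r.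
    nra.
  have rm : (r (i, q j) < m)%N.
    rewrite /m ltnS; exact: (leq_bigmax (i, Ordinal jK)).
  by move=> /(_ rm).
move=> i; rewrite ler_norml; apply/andP; split; last exact: H.
by rewrite lerNl opprB; apply: H => // k km; rewrite zz'.
Qed.

End separating_bits.

(** * Intervals with prescribed dyadic lengths *)

Section nested_intervals.
Variables (R : realType) (p : nat -> nat -> R).
Hypothesis p0 : forall n i, 0 <= p n i.
Hypothesis pD : forall n i, p n i = p n.+1 i.*2 + p n.+1 i.*2.+1.

Definition cum n i := \sum_(0 <= j < i) p n j.

(** Half-open, so that a vanishing mass gives an empty cell and each point of the total interval has
    exactly one cell at every level. *)
Definition cell n i : set R := `[cum n i, cum n i.+1[%classic.

Lemma cumS n i : cum n i.+1 = cum n i + p n i.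
Proof. by rewrite /cum big_nat_recr. Qed.

Lemma cum_double n i : cum n.+1 i.*2 = cum n i.
Proof.
elim: i => [|i IHi]; first by rewrite /cum !big_geq.
by rewrite doubleS !cumS IHi -addrA -pD.
Qed.

Lemma cum_total n : cum n (2 ^ n) = p 0 0.
Proof.
elim: n => [|n IHn]; first by rewrite expn0 cumS /cum big_geq// add0r.
by rewrite expnS mul2n cum_double.
Qed.

Lemma cum_le n i k : (i <= k)%N -> cum n i <= cum n k.
Proof.
elim: k => [|k IHk]; first by rewrite leqn0 => /eqP ->.
rewrite leq_eqVlt => /orP[/eqP -> //|]; rewrite ltnS => /IHk h.
by rewrite cumS (le_trans h)// lerDl.
Qed.

Lemma cell_uniq n i k t : cell n i t -> cell n k t -> i = k.
Proof.
rewrite /cell /= !in_itv/= => /andP[i1 i2] /andP[k1 k2].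
apply/eqP; rewrite eqn_leq; apply/andP; split; rewrite leqNgt; apply/negP.
- by move=> /(cum_le n); rewrite leNgt (le_lt_trans i1 k2).
- by move=> /(cum_le n); rewrite leNgt (le_lt_trans k1 i2).
Qed.

Lemma cell_half n k t : cell n.+1 k t -> cell n k./2 t.
Proof.
rewrite /cell /= !in_itv/= -!(cum_double n) => /andP[k1 k2]; apply/andP; split.
  by apply: le_trans k1; apply: cum_le; lia.
by apply: lt_le_trans k2 _; apply: cum_le; lia.
Qed.

Lemma cell_exists n t : 0 <= t < p 0 0 -> exists2 i, (i < 2 ^ n)%N & cell n i t.
Proof.
move=> /andP[t0]; rewrite -(cum_total n).
elim: (2 ^ n)%N => [|m IHm]; first by rewrite /cum big_geq// ltNge t0.
move=> tm; have [tm'|mt] := ltP t (cum n m).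
  by have [i im it] := IHm tm'; exists i => //; exact: ltnW.
by exists m => //; rewrite /cell/= in_itv/= mt.
Qed.

Lemma cell_sub n i t : (i < 2 ^ n)%N -> cell n i t -> 0 <= t < p 0 0.
Proof.
move=> i2; rewrite /cell /= in_itv/= -(cum_total n) => /andP[i1 k2].
apply/andP; split; last by apply: lt_le_trans k2 _; exact: cum_le.
by apply: le_trans i1; rewrite /cum sumr_ge0.
Qed.

Lemma measure_cell n i : lebesgue_measure (cell n i) = (p n i)%:E.
Proof.
rewrite /cell lebesgue_measure_itv/= lte_fin cumS ltrDl.
have [pn|] := ltP 0 (p n i); first by rewrite -EFinB addrC addKr.
by move=> pn; congr EFin; apply/eqP; rewrite eq_le p0 pn.
Qed.

Lemma integral_steps n (h : nat -> R) : (forall i, 0 <= h i) ->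
  (\int[lebesgue_measure]_(t in `[0%R, (p 0 0)[)
     (\sum_(i < 2 ^ n) h i * \1_(cell n i) t)%:E =
   (\sum_(i < 2 ^ n) h i * p n i)%:E)%E.
Proof.
move=> h0; under eq_integral do rewrite -sumEFin.
rewrite ge0_integral_sum//; last 2 first.
- move=> i; apply/measurable_EFinP; apply: measurable_funM => //.
  by apply: measurable_indic; exact: measurable_itv.
- by move=> j t _; rewrite lee_fin mulr_ge0.
rewrite -sumEFin; apply: eq_bigr => i _.
under eq_integral do rewrite EFinM.
rewrite ge0_integralZl_EFin//.
- rewrite integral_indic//; last exact: measurable_itv.
  rewrite setIidl; first by rewrite EFinM; congr (_ * _)%E; exact: measure_cell.
  by move=> t /(cell_sub (ltn_ord i)); rewrite /= in_itv.
- by apply/measurable_EFinP; apply: measurable_indic; exact: measurable_itv.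
Qed.

End nested_intervals.

Lemma seq_cvg_unique (R : realType) (u : nat -> R) (a b : R) :
  u @ \oo --> a -> u @ \oo --> b -> a = b.
Proof. by move=> ua ub; rewrite -(cvg_lim _ ua)//; exact: cvg_lim. Qed.

(** First n is fixed with both bounds close to l in the limit, and only then j grows, so no
    uniformity in n enters. *)
Lemma squeeze_double (R : realType) (a : nat -> R) (lo hi : nat -> nat -> R)
    (lo_ hi_ : nat -> R) (l : R) :
  (forall n j, lo n j <= a j <= hi n j) ->
  (forall n, lo n j @[j --> \oo] --> lo_ n) -> lo_ n @[n --> \oo] --> l ->
  (forall n, hi n j @[j --> \oo] --> hi_ n) -> hi_ n @[n --> \oo] --> l ->
  a j @[j --> \oo] --> l.
Proof.
move=> ha clo clo_ chi chi_; apply/cvgrPdist_le => e e0.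
have e20 : 0 < e / 2 by rewrite divr_gt0.
have [n [nlo nhi]] : exists n, `|l - lo_ n| < e / 2 /\ `|l - hi_ n| < e / 2.
  apply: (@filter_ex _ \oo); apply: filterI.
    by move/cvgrPdist_lt : clo_; exact.
  by move/cvgrPdist_lt : chi_; exact.
have [/cvgrPdist_lt/(_ _ e20) jlo /cvgrPdist_lt/(_ _ e20) jhi] := (clo n, chi n).
near=> j.
have hlo : `|lo_ n - lo n j| < e / 2 by near: j.
have hhi : `|hi_ n - hi n j| < e / 2 by near: j.
have /andP[h1 h2] := ha n j.
move: nlo nhi hlo hhi; rewrite !ltr_norml ler_norml.
move=> /andP[? ?] /andP[? ?] /andP[? ?] /andP[? ?]; apply/andP; split; lra.
Unshelve. all: by end_near. Qed.

(** * Weak limits of densities along an embedding *)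

Section weak_limit.
Variables (R : realType) (d : _) (T : measurableType d).
Variables (mu : {measure set T -> \bar R}) (n : nat) (X : T -> 'rV[R]_n).
Variables (D : set T) (rho : nat -> T -> R) (C : R).
Hypothesis mX : measurable_fun setT X.
Hypothesis mD : measurable D.
Hypothesis XD : forall z, D z -> forall i, `|X z 0 i| <= 1.
Hypothesis mrho : forall j, measurable_fun setT (rho j).
Hypothesis rho0 : forall j z, 0 <= rho j z.
Hypothesis rhoC : forall j, (\int[mu]_(z in D) (rho j z)%:E <= C%:E)%E.

Section code.
Variable bit : nat -> T -> bool.
Hypothesis mbit : forall m, measurable [set z | bit m z].

(** The first m bits read as a binary number with the newest bit last: forgetting that bit is
    halving, and the piece i splits into the pieces 2i and 2i+1. *)
Fixpoint code m z : nat :=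
  if m is m'.+1 then ((code m' z).*2 + bit m' z)%N else 0.

Lemma code_lt m z : (code m z < 2 ^ m)%N.
Proof.
elim: m => //= m IHm; rewrite expnS mul2n.
by case: (bit m z); rewrite ?addn1 ?addn0 ?ltn_double// -doubleS leq_double.
Qed.

Lemma code_half m z : (code m.+1 z)./2 = code m z.
Proof. by rewrite /= addnC half_bit_double. Qed.

Lemma code_bit m z z' : code m z = code m z' ->
  forall k, (k < m)%N -> bit k z = bit k z'.
Proof.
elim: m => // m IHm cc k; rewrite ltnS leq_eqVlt => /orP[/eqP ->|].
  by have := congr1 odd cc; rewrite /= !oddD !odd_double /= !oddb.
by move=> km; apply: (IHm _ k km); rewrite -code_half cc code_half.
Qed.

Definition piece m i : set T := D `&` [set z | code m z = i].

Lemma measurable_piece m i : measurable (piece m i).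
Proof.
apply: measurableI => //; elim: m i => [|m IHm] i /=.
  case: i => [|i]; first by rewrite (_ : mkset _ = setT)//; apply/seteqP; split.
  by rewrite (_ : mkset _ = set0)//; apply/seteqP; split.
rewrite (_ : mkset _ = [set z | code m z = i./2] `&`
   (if odd i then [set z | bit m z] else ~` [set z | bit m z])).
  by apply: measurableI => //; case: ifPn => _; [exact: mbit|apply: measurableC; exact: mbit].
apply/seteqP; split => z /=.
  move=> <-; rewrite addnC half_bit_double; split => //.
  by rewrite oddD odd_double addbF oddb; case: ifPn => //= /negP.
move=> [-> ]; case: ifPn => oi /=; case: (bit m z) => // _.
  by rewrite -[RHS]odd_double_half oi addnC.
by rewrite -[RHS]odd_double_half (negbTE oi) addnC.
Qed.

Lemma piece_half m i z : piece m.+1 i z -> piece m i./2 z.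
Proof. by move=> [Dz /= <-]; split => //=; rewrite addnC half_bit_double. Qed.

Definition mass j m i : R := fine (\int[mu]_(z in piece m i) (rho j z)%:E).

Lemma massE j m i : (\int[mu]_(z in piece m i) (rho j z)%:E = (mass j m i)%:E)%E.
Proof.
rewrite /mass fineK// ge0_fin_numE; last by apply: integral_ge0 => z _; rewrite lee_fin.
apply: le_lt_trans (ltry C); apply: le_trans (rhoC j).
apply: ge0_subset_integral => //.
- exact: measurable_piece.
- by apply/measurable_EFinP; apply: measurable_funTS; exact: mrho.
- by move=> z _; rewrite lee_fin.
- by move=> z [].
Qed.

Lemma mass_bound j m i : 0 <= mass j m i <= C.
Proof.
rewrite -!lee_fin -massE integral_ge0 /=; last by move=> z _; rewrite lee_fin.
apply: le_trans (rhoC j); apply: ge0_subset_integral => //.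
- exact: measurable_piece.
- by apply/measurable_EFinP; apply: measurable_funTS; exact: mrho.
- by move=> z _; rewrite lee_fin.
- by move=> z [].
Qed.

Lemma massD j m i : mass j m i = mass j m.+1 i.*2 + mass j m.+1 i.*2.+1.
Proof.
apply: EFin_inj; rewrite EFinD -!massE -ge0_integral_setU//.
- congr (integral _ _ _); apply/seteqP; split => z.
    move=> [Dz /= ci]; rewrite /piece/= ci; case: (bit m z); [right|left];
    by split => //; rewrite ?addn1 ?addn0.
  by move=> [|] [Dz /= ci]; split => //=;
    have := congr1 half ci; rewrite addnC half_bit_double => ->; lia.
- exact: measurable_piece.
- exact: measurable_piece.
- by apply/measurable_EFinP; apply: measurable_funTS; exact: mrho.
- by move=> z _; rewrite lee_fin.
- by apply/disj_set2P; apply/seteqP; split => // z [[_ /= e1] [_ /= e2]]; lia.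
Qed.

Lemma integral_pieces j m (h : nat -> R) : (forall i, 0 <= h i) ->
  (\int[mu]_(z in D) (rho j z * h (code m z))%:E =
   (\sum_(i < 2 ^ m) h i * mass j m i)%:E)%E.
Proof.
move=> h0.
transitivity (\int[mu]_(z in D)
    (\sum_(i < 2 ^ m) (h i * (rho j z * \1_(piece m i) z))%:E))%E.
  apply: eq_integral => z /set_mem Dz; rewrite sumEFin; congr EFin.
  rewrite (bigD1 (Ordinal (code_lt m z)))//= big1 => [|i im].
    by rewrite indicE mem_set// mulr1 addr0 mulrC.
  rewrite indicE memNset ?mulr0// => -[_ /= ci].
  by move/eqP: im; apply; apply/val_inj.
have m1 i : measurable_fun D (fun z => (rho j z * \1_(piece m i) z)%:E).
  apply/measurable_EFinP; apply: measurable_funM.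
    by apply: measurable_funTS; exact: mrho.
  by apply: measurable_indic; exact: measurable_piece.
rewrite ge0_integral_sum//; last 2 first.
- by move=> i; under eq_fun do rewrite EFinM; apply: measurable_funeM.
- by move=> i z _; rewrite lee_fin !mulr_ge0.
rewrite -sumEFin; apply: eq_bigr => i _.
under eq_integral do rewrite EFinM.
rewrite ge0_integralZl_EFin//; last by move=> z _; rewrite lee_fin mulr_ge0.
rewrite EFinM -massE; congr (_ * _)%E.
rewrite [RHS]integral_mkcond [LHS]integral_mkcond; apply: eq_integral => z _.
rewrite !patchE /= indicE; have [zp|zp] := boolP (z \in piece m i).
  by rewrite mulr1 ifT//; move/set_mem : zp => [Dz _]; exact/mem_set.
by rewrite mulr0; case: ifP.
Qed.

Variables (kap : nat -> nat) (p : nat -> nat -> R).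
Hypothesis cvp : forall m i, mass (kap j) m i @[j --> \oo] --> p m i.
Hypothesis sep : forall e : R, 0 < e -> exists m, forall z z', D z -> D z' ->
  (forall k, (k < m)%N -> bit k z = bit k z') -> forall i, `|X z 0 i - X z' 0 i| <= e.

Lemma limit_mass_ge0 m i : 0 <= p m i.
Proof.
apply: (@cvgr_to_ge _ \oo _ _ _ _ _ (@cvp m i)); near=> j.
by have /andP[] := mass_bound (kap j) m i.
Unshelve. all: by end_near. Qed.

Lemma limit_massD m i : p m i = p m.+1 i.*2 + p m.+1 i.*2.+1.
Proof.
apply: (seq_cvg_unique (@cvp m i)).
under eq_fun do rewrite massD.
by apply: cvgD; exact: cvp.
Qed.

Local Notation cell := (cell p).
Let cell_uniq := cell_uniq limit_mass_ge0.
Let cell_half := cell_half limit_mass_ge0 limit_massD.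

(** A cell with a point in it has positive length, whereas an empty piece has mass 0 for every j and
    hence in the limit. *)
Lemma piece_nonempty m i t : cell m i t -> exists z, piece m i z.
Proof.
move=> ct; have pmi : 0 < p m i.
  by move: ct; rewrite /cell/= in_itv/= cumS => /andP[h1 h2]; move: (le_lt_trans h1 h2); rewrite ltrDl.
apply: contrapT => /forallNP no.
have m0 j : mass j m i = 0.
  apply: EFin_inj; rewrite -massE (_ : piece m i = set0) ?integral_set0//.
  by apply/seteqP; split => // z /no.
have : p m i = 0.
  apply: (seq_cvg_unique (@cvp m i)).
  by under eq_fun do rewrite m0; exact: cvg_cst.
by move=> pmi0; rewrite pmi0 ltxx in pmi.
Qed.

Lemma piece_nested m0 m i0 i t z : (m0 <= m)%N -> cell m0 i0 t -> cell m i t ->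
  piece m i z -> piece m0 i0 z.
Proof.
elim: m i => [|m IHm] i.
  by rewrite leqn0 => /eqP -> c1 c2; rewrite (cell_uniq c1 c2).
rewrite leq_eqVlt => /orP[/eqP -> c1 c2|]; first by rewrite (cell_uniq c1 c2).
rewrite ltnS => mm c0 /cell_half c1 /piece_half; exact: IHm c1.
Qed.

Lemma piece_oscillation t e : 0 <= t < p 0 0 -> 0 < e -> exists m0, forall m m' i i' z z',
  (m0 <= m)%N -> (m0 <= m')%N -> cell m i t -> cell m' i' t ->
  piece m i z -> piece m' i' z' -> forall k, `|X z 0 k - X z' 0 k| <= e.
Proof.
move=> tL e0; have [m0 sep0] := sep e0; exists m0 => m m' i i' z z' mm mm' ct ct' pz pz'.
have [i0 _ ct0] := cell_exists limit_massD m0 tL.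
have [Dz cz] := piece_nested mm ct0 ct pz.
have [Dz' cz'] := piece_nested mm' ct0 ct' pz'.
by apply: sep0 => //; apply: code_bit; rewrite cz cz'.
Qed.

Definition steps (h : nat -> nat -> R) m t := \sum_(i < 2 ^ m) h m i * \1_(cell m i) t.

Lemma stepsE h m i t : (i < 2 ^ m)%N -> cell m i t -> steps h m t = h m i.
Proof.
move=> im ct; rewrite /steps (bigD1 (Ordinal im))//= big1 => [|j ji].
  by rewrite indicE mem_set// mulr1 addr0.
rewrite indicE memNset ?mulr0// => cj.
by move/eqP: ji; apply; apply/val_inj => /=; exact: cell_uniq cj ct.
Qed.

Lemma steps_out h m t : ~~ (0 <= t < p 0 0) -> steps h m t = 0.
Proof.
move=> tL; rewrite /steps big1// => i _; rewrite indicE memNset ?mulr0// => ct.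
by move/negP: tL; apply; exact: (cell_sub limit_mass_ge0 limit_massD _ ct).
Qed.

Lemma measurable_steps h m : measurable_fun setT (steps h m).
Proof.
apply: measurable_sum => i; apply: measurable_funM => //.
by apply: measurable_indic; exact: measurable_itv.
Qed.

(** The pieces whose cells contain t have oscillation tending to 0, so sampled values of [X] on them
    form a Cauchy sequence. In t the samples are step functions, which makes the limit
    measurable. *)
Lemma limit_point : exists Y : R -> 'rV[R]_n, measurable_fun setT Y /\
  forall t e, 0 <= t < p 0 0 -> 0 < e -> exists m0, forall m i z,
   (m0 <= m)%N -> cell m i t -> piece m i z -> forall k, `|X z 0 k - Y t 0 k| <= e.
Proof.
(* One sample per piece; the default 0 on an empty piece is never met, by [piece_nonempty]. *)
have /choice[x Hx] : forall mi, exists x, (exists z, piece mi.1 mi.2 z) ->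
    exists2 z, piece mi.1 mi.2 z & x = X z.
  move=> [m i]; have [[z pz]|no] := pselect (exists z, piece m i z).
    by exists (X z) => _; exists z.
  by exists 0 => /no.
pose y k m t := steps (fun m i => x (m, i) 0 k) m t.
have osc t e : 0 <= t < p 0 0 -> 0 < e -> exists m0, forall m i z m',
    (m0 <= m)%N -> (m0 <= m')%N -> cell m i t -> piece m i z ->
    forall k, `|X z 0 k - y k m' t| <= e.
  move=> tL e0; have [m0 Hm0] := piece_oscillation tL e0.
  exists m0 => m i z m' mm mm' ct pz k.
  have [i' i'm ct'] := cell_exists limit_massD m' tL.
  rewrite /y (stepsE _ i'm ct').
  have [z' pz' ->] := Hx (m', i') (piece_nonempty ct').
  exact: (Hm0 m m' i i').
have cvy k t : cvg (y k m t @[m --> \oo]).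
  (* Outside the interval all step functions vanish, so the limit exists on the whole line. *)
  have [tL|tL] := boolP (0 <= t < p 0 0); last first.
    by rewrite /y; under eq_fun do rewrite steps_out//; exact: is_cvg_cst.
  apply/cauchy_cvgP; apply: cauchy_exP => e e0.
  have e20 : 0 < e / 2 by rewrite divr_gt0.
  have [m0 Hm0] := osc t _ tL e20.
  have [i0 _ ct0] := cell_exists limit_massD m0 tL.
  have [z pz] := piece_nonempty ct0.
  exists (X z 0 k); exists m0 => // m /= mm.
  rewrite /ball /=; apply: le_lt_trans (Hm0 _ _ z m (leqnn _) mm ct0 pz k) _.
  by rewrite ltr_pdivrMr// ltr_pMr// ltr1n.
exists (fun t => \row_k lim (y k m t @[m --> \oo])); split.
  apply: measurable_fun_rV => k; under eq_fun do rewrite mxE.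
  apply: (@measurable_fun_cvg _ _ _ _ (y k)) => [m|t _]; last exact: cvy.
  exact: measurable_steps.
move=> t e tL e0; have [m0 Hm0] := osc t e tL e0.
exists m0 => m i z mm ct pz k; rewrite mxE.
apply: (@cvgr_to_le _ \oo _ _ (fun m' => `|X z 0 k - y k m' t|)).
  by apply: cvg_norm; apply: cvgB; [exact: cvg_cst|exact: cvy].
by exists m0 => // m' mm' /=; exact: (Hm0 m i).
Unshelve. all: by end_near. Qed.

End code.

(** Membership in the closure of the image of [D]; for the chart this closure is the
    compactification. *)
Definition adherent (y : 'rV[R]_n) :=
  forall e, 0 < e -> exists2 z, D z & forall i, `|X z 0 i - y 0 i| < e.

(* The limit masses of the nested binary pieces are laid out as nested
   subintervals of [0, L[, and [Y t] is the limit of the values of [X] on the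
   pieces whose interval contains [t]. *)
Theorem weak_limit : exists (kap : nat -> nat) (L : R) (Y : R -> 'rV[R]_n),
  [/\ forall j, (j <= kap j)%N, 0 <= L, measurable_fun setT Y,
    forall t, 0 <= t < L -> adherent (Y t) &
    forall (f : T -> R) (Phi : 'rV[R]_n -> R) (B : R), measurable_fun D f -> 0 <= B ->
    (forall z, D z -> 0 <= f z <= B) ->
    (forall y, adherent y -> forall e, 0 < e -> exists2 eta, 0 < eta &
       forall z, D z -> (forall i, `|X z 0 i - y 0 i| < eta) -> `|f z - Phi y| <= e) ->
    measurable_fun `[0, L[%classic (Phi \o Y) /\
    (\int[mu]_(z in D) (rho (kap j) z * f z)%:E @[j --> \oo] -->
      \int[lebesgue_measure]_(t in `[0%R, L[) (Phi (Y t))%:E)%E].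
Proof.
have [bit [mbit sep]] := separating_bits mX XD.
have [kap [p [kapj cvp]]] := common_subsequence (mass_bound mbit).
have [Y [mY HY]] := limit_point mbit cvp sep.
have p0 := limit_mass_ge0 mbit cvp.
have pD := limit_massD mbit cvp.
have Ycell t : 0 <= t < p 0 0 -> adherent (Y t).
  move=> tL e e0; have e20 : 0 < e / 2 by rewrite divr_gt0.
  have [m0 Hm0] := HY t _ tL e20.
  have [i _ ct] := cell_exists pD m0 tL.
  have [z pz] := piece_nonempty mbit cvp ct.
  exists z => [|k]; first by case: pz.
  apply: le_lt_trans (Hm0 m0 i z (leqnn _) ct pz k) _.
  by rewrite ltr_pdivrMr// ltr_pMr// ltr1n.
exists kap, (p 0 0), Y; split => //.
move=> f Phi B mf B0 fB fPhi.
(* Upper and lower sums of [f] over the pieces squeeze the integrals. At fixed m they involve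
   finitely many masses, so they converge along [kap]; as m grows, both limits tend to the integral
   of [Phi] along [Y] by dominated convergence. *)
pose Fs m i := sup (f @` piece bit m i).
pose Fi m i := inf (f @` piece bit m i).
have hs m i : has_ubound (f @` piece bit m i).
  by exists B => _ [z [Dz _] <-]; have /andP[] := fB z Dz.
have hi m i : has_lbound (f @` piece bit m i).
  by exists 0 => _ [z [Dz _] <-]; have /andP[] := fB z Dz.
have Fsf m i z : piece bit m i z -> f z <= Fs m i.
  by move=> pz; apply: ub_le_sup => //; exists z.
have Fif m i z : piece bit m i z -> Fi m i <= f z.
  by move=> pz; apply: ge_inf => //; exists z.
(* On an empty piece the supremum and the infimum take the default value 0, which satisfies the same
   bounds. *)
have bnd F0 : (forall m i, (exists z, piece bit m i z) -> 0 <= F0 m i <= B) ->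
    (forall m i, ~ (exists z, piece bit m i z) -> F0 m i = 0) -> forall m i, 0 <= F0 m i <= B.
  move=> h1 h2 m i; have [/h1 //|/h2 ->] := pselect (exists z, piece bit m i z).
  by rewrite lexx B0.
have Fs0 : forall m i, 0 <= Fs m i <= B.
  apply: bnd => m i.
    move=> [z pz]; have [Dz _] := pz; have /andP[f0 _] := fB z Dz.
    rewrite (le_trans f0 (Fsf _ _ _ pz))/=; apply: ge_sup; first by exists (f z), z.
    by move=> _ [z' [Dz' _] <-]; have /andP[] := fB z' Dz'.
  move=> no; suff -> : Fs m i = sup set0 by exact: sup0.
  by congr (sup _); apply/seteqP; split => // y [z pz _]; apply: no; exists z.
have Fi0 : forall m i, 0 <= Fi m i <= B.
  apply: bnd => m i.
    move=> [z pz]; have [Dz _] := pz; have /andP[_ f0] := fB z Dz.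
    rewrite (le_trans (Fif _ _ _ pz) f0)/= andbT; apply: lb_le_inf; first by exists (f z), z.
    by move=> _ [z' [Dz' _] <-]; have /andP[] := fB z' Dz'.
  move=> no; suff -> : Fi m i = inf set0 by exact: inf0.
  by congr (inf _); apply/seteqP; split => // y [z pz _]; apply: no; exists z.
have cvF t F0 : 0 <= t < p 0 0 ->
    (forall m i e, (exists z, piece bit m i z) ->
      (forall z, piece bit m i z -> `|f z - Phi (Y t)| <= e) -> `|F0 m i - Phi (Y t)| <= e) ->
    steps p F0 m t @[m --> \oo] --> Phi (Y t).
  move=> tL HF; apply/cvgrPdist_le => e e0.
  have [eta eta0 Heta] := fPhi _ (Ycell t tL) e e0.
  have eta20 : 0 < eta / 2 by rewrite divr_gt0.
  have [m0 Hm0] := HY t _ tL eta20.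
  exists m0 => // m /= mm; have [i im ct] := cell_exists pD m tL.
  rewrite (stepsE mbit cvp _ im ct) distrC; apply: HF.
    exact: (piece_nonempty mbit cvp ct).
  move=> z pz; apply: Heta; first by case: pz.
  move=> k; apply: le_lt_trans (Hm0 m i z mm ct pz k) _.
  by rewrite ltr_pdivrMr// ltr_pMr// ltr1n.
have cvs t : 0 <= t < p 0 0 -> steps p Fs m t @[m --> \oo] --> Phi (Y t).
  move=> tL; apply: cvF => // m i e [z pz] H.
  rewrite ler_distl; apply/andP; split.
    by apply: le_trans (Fsf _ _ _ pz); have := H _ pz; rewrite ler_distl => /andP[].
  apply: ge_sup; first by exists (f z), z.
  by move=> _ [z' /H + <-]; rewrite ler_distl => /andP[].
have cvi t : 0 <= t < p 0 0 -> steps p Fi m t @[m --> \oo] --> Phi (Y t).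
  move=> tL; apply: cvF => // m i e [z pz] H.
  rewrite ler_distl; apply/andP; split; last first.
    by apply: le_trans (Fif _ _ _ pz) _; have := H _ pz; rewrite ler_distl => /andP[].
  apply: lb_le_inf; first by exists (f z), z.
  by move=> _ [z' /H + <-]; rewrite ler_distl => /andP[].
have mPhi : measurable_fun `[0, p 0 0[%classic (Phi \o Y).
  apply: (@measurable_fun_cvg _ _ _ _ (steps p Fs)) => [m|t].
    by apply: measurable_funTS; exact: measurable_steps.
  by rewrite /= in_itv/=; exact: cvs.
split => //.
have dct F0 : (forall m i, 0 <= F0 m i <= B) ->
    (forall t, 0 <= t < p 0 0 -> steps p F0 m t @[m --> \oo] --> Phi (Y t)) ->
  (\int[lebesgue_measure]_(t in `[0%R, (p 0 0)%N[) (Phi (Y t))%:E \is a fin_num)%E /\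
  ((\sum_(i < 2 ^ m) F0 m i * p m i)%:E @[m --> \oo] -->
      \int[lebesgue_measure]_(t in `[0%R, (p 0 0)%N[) (Phi (Y t))%:E)%E.
  move=> F0B cvF0.
  have [] := @dominated_convergence _ _ R lebesgue_measure `[0, p 0 0[%classic
    (measurable_itv _) (fun m t => (steps p F0 m t)%:E) (EFin \o (Phi \o Y)) (cst B%:E).
  - by move=> m; apply/measurable_EFinP; apply: measurable_funTS; exact: measurable_steps.
  - exact/measurable_EFinP.
  - apply: aeW => t /=; rewrite in_itv/= => tL.
    by apply: cvg_EFin; [exact: nearW|exact: cvF0].
  - apply/integrableP; split; first exact: measurable_cst.
    rewrite integral_cst//=; have /= -> := @lebesgue_measure_itv R `[0, (p 0%N 0%N)[.
    by case: ifP => _; rewrite ?mule0// -EFinB -EFinM ltry.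
  - apply: aeW => t m /=; rewrite in_itv/= => tL.
    have [i im ct] := cell_exists pD m tL.
    rewrite (stepsE mbit cvp _ im ct) lee_fin.
    by have /andP[h1 h2] := F0B m i; rewrite ger0_norm.
  move=> i1 _ cv; split.
    by apply: (integrable_fin_num _ i1); exact: measurable_itv.
  move: cv.
  rewrite [X in X @ _](_ : _ = fun m => (\sum_(i < 2 ^ m) F0 m i * p m i)%:E)//.
  apply/funext => m; rewrite -integral_steps//.
  by move=> i; have /andP[] := F0B m i.
have [Ifin cs] := dct Fs Fs0 cvs.
have [_ ci] := dct Fi Fi0 cvi.
rewrite -(fineK Ifin) /=; set I := fine _.
have mrj j : measurable_fun D (fun z => (rho j z)%:E).
  by apply/measurable_EFinP; apply: measurable_funTS; exact: mrho.
have up j m : (\int[mu]_(z in D) (rho j z * f z)%:E <=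
     (\sum_(i < 2 ^ m) Fs m i * mass bit j m i)%:E)%E.
  rewrite -(integral_pieces mbit); last by move=> i; have /andP[] := Fs0 m i.
  apply: ge0_le_integral_nonmeas => z Dz; rewrite lee_fin.
    by rewrite mulr_ge0//; have /andP[] := fB z Dz.
  by apply: ler_wpM2l => //; exact: Fsf.
have lo j m : ((\sum_(i < 2 ^ m) Fi m i * mass bit j m i)%:E <=
    \int[mu]_(z in D) (rho j z * f z)%:E)%E.
  rewrite -(integral_pieces mbit); last by move=> i; have /andP[] := Fi0 m i.
  apply: ge0_le_integral_nonmeas => z Dz; rewrite lee_fin.
    by rewrite mulr_ge0//; have /andP[] := Fi0 m (code bit m z).
  by apply: ler_wpM2l => //; exact: Fif.
have afin j : (\int[mu]_(z in D) (rho j z * f z)%:E \is a fin_num)%E.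
  rewrite fin_numE; apply/andP; split.
    by apply/eqP => E; have := lo j 0; rewrite E.
  by apply/eqP => E; have := up j 0; rewrite E.
under eq_fun do rewrite -(fineK (afin _)).
apply: cvg_EFin; first exact: nearW.
apply: (@squeeze_double _ _
   (fun m j => \sum_(i < 2 ^ m) Fi m i * mass bit (kap j) m i)
   (fun m j => \sum_(i < 2 ^ m) Fs m i * mass bit (kap j) m i)
   (fun m => \sum_(i < 2 ^ m) Fi m i * p m i)
   (fun m => \sum_(i < 2 ^ m) Fs m i * p m i)).
- by move=> m j; rewrite -!lee_fin fineK// lo up.
- move=> m; apply: (@cvg_big _ _ +%R) => [|i _]; first exact: add_continuous.
  by apply: cvgM; [exact: cvg_cst|exact: cvp].
- by move: ci; rewrite -(fineK Ifin) => /fine_cvg.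
- move=> m; apply: (@cvg_big _ _ +%R) => [|i _]; first exact: add_continuous.
  by apply: cvgM; [exact: cvg_cst|exact: cvp].
- by move: cs; rewrite -(fineK Ifin) => /fine_cvg.
Qed.

End weak_limit.

(** * Limit functional *)

Section image_of_restriction.
Context d1 d2 (T1 : measurableType d1) (T2 : measurableType d2) (R : realType).
Variables (m : {measure set T1 -> \bar R}) (S : set T1) (mS : measurable S).
Hypothesis Soo : (m S < +oo)%E.
Variables (f : T1 -> T2) (mf : measurable_fun setT f).

Definition restricted_image : set T2 -> \bar R := image_measure (mfrestr mS Soo) mf.

Let restricted_image0 : restricted_image set0 = 0%E.
Proof. exact: measure0. Qed.

Let restricted_image_ge0 A : (0 <= restricted_image A)%E.
Proof. exact: measure_ge0. Qed.

Let restricted_image_sigma_additive : semi_sigma_additive restricted_image.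
Proof. exact: measure_semi_sigma_additive. Qed.

HB.instance Definition _ := isMeasure.Build _ _ _ restricted_image
  restricted_image0 restricted_image_ge0 restricted_image_sigma_additive.

Let restricted_image_fin : fin_num_fun restricted_image.
Proof.
move=> A mA; rewrite /restricted_image /= /pushforward; apply: fin_num_measure.
by rewrite -[X in measurable X]setTI; apply: (mf measurableT).
Qed.

HB.instance Definition _ := Measure_isFinite.Build _ _ _ restricted_image
  restricted_image_fin.

Lemma restricted_imageE A : restricted_image A = m (f @^-1` A `&` S).
Proof. by []. Qed.

Lemma integral_restricted_image (h : T2 -> \bar R) : measurable_fun setT h ->
  (forall x, 0 <= h x)%E ->
  (\int[restricted_image]_x h x = \int[m]_(t in S) h (f t))%E.
Proof.
move=> mh h0; pose m0 := mfrestr mS Soo.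
transitivity (\int[pushforward m0 f]_x h x)%E; first by [].
rewrite (@ge0_integral_pushforward _ _ _ _ _ _ mf)//.
rewrite preimage_setT.
have mSC : measurable (~` S) by exact: measurableC.
have m0SC : m0 (~` S) = 0%E.
  by rewrite /m0 /mfrestr /mrestr setICl measure0.
rewrite (@eq_integral_off_null _ _ _ m0 setT (~` S) (h \o f) ((h \o f) \_ S))//; last first.
  by move=> x _ /contrapT Sx; rewrite patchE mem_set.
rewrite -integral_mkcond.
apply: eq_measure_integral => A mA AS.
by rewrite /m0 /= /mfrestr /mrestr setIidl.
Qed.

End image_of_restriction.

(** * Null sets and Borel representatives *)

Section representatives.
Variables (R : realType) (N : nat).
Local Notation V := 'rV[R]_N.
Local Notation leb := (@lebesgue_rV R N).

Definition null_borel (Z : set V) := measurable Z /\ leb Z = 0%E.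

Lemma null_borelU (Z Z' : set V) : null_borel Z -> null_borel Z' -> null_borel (Z `|` Z').
Proof.
by move=> [mZ Z0] [mZ' Z'0]; split; [exact: measurableU|exact: null_set_setU].
Qed.

Lemma null_borel_seq (I : eqType) (Z_ : I -> set V) (s : seq I) :
  (forall i, null_borel (Z_ i)) ->
  exists2 Z, null_borel Z & forall i, i \in s -> Z_ i `<=` Z.
Proof.
move=> nZ; elim: s => [|a s [Z Z0 IH]].
  by exists set0 => //; split => //; exact: measure0.
exists (Z_ a `|` Z); first exact: null_borelU.
move=> i; rewrite inE => /predU1P[->|/IH iZ]; first by move=> x; left.
by move=> x /iZ; right.
Qed.

(* [vanish Z f] turns a Lebesgue measurable [f] into a Borel one for a
   suitable null set [Z]. *)
Definition vanish (W : zmodType) (Z : set V) (f : V -> W) x := if x \in Z then 0 else f x.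

Lemma vanish_out (W : zmodType) (Z : set V) (f : V -> W) x : ~ Z x -> vanish Z f x = f x.
Proof. by move=> Zx; rewrite /vanish memNset. Qed.

Lemma borel_representative (f : V -> R) : lebesgue_measurable_fun f ->
  exists2 Z, null_borel Z & forall Z', measurable Z' -> Z `<=` Z' ->
    measurable_fun setT (vanish Z' f).
Proof.
move=> /lebesgue_measurable_borel[Z [mZ Z0 HZ]]; exists Z => // Z' mZ' ZZ'.
rewrite (_ : vanish Z' f = f \_ (~` Z')); first exact: HZ.
by apply/funext => x; rewrite /vanish patchE in_setC; case: (x \in Z').
Qed.

Lemma sqint_vanish (f : V -> R) Z : L2 f -> null_borel Z ->
  measurable_fun setT (vanish Z f) -> sqint leb (vanish Z f).
Proof.
move=> [_ fi] [mZ Z0] mv; split => //; apply: le_lt_trans fi.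
apply: (ge0_le_integral_off_null mZ Z0) => [x _|x _|x _ Zx].
- by rewrite lee_fin sqr_ge0.
- by rewrite lee_fin sqr_ge0.
- by rewrite vanish_out// lee_fin real_normK ?num_real.
Qed.

Lemma H1_representative (u : V -> R) (g : V -> V) : H1 u -> L2_gradient u g ->
  exists Z, [/\ null_borel Z, sqint leb (vanish Z u),
    forall i, sqint leb (fun x => vanish Z g x 0 i) &
    forall phi, test_function phi -> forall i : 'I_N,
    (\int[leb]_x (vanish Z u x * partial i phi x)%:E =
     - \int[leb]_x (vanish Z g x 0 i * phi x)%:E)%E].
Proof.
move=> [u2 _] [g2 ug].
(* [None] stands for [u] and [Some i] for a component of the gradient, so that one null set serves
   them all. *)
pose f (o : option 'I_N) x := if o is Some i then g x 0 i else u x.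
have f2 o : L2 (f o) by case: o => [i|]; [exact: g2|exact: u2].
have /choice[Z_ HZ] : forall o, exists Z, null_borel Z /\ forall Z', measurable Z' -> Z `<=` Z' ->
    measurable_fun setT (vanish Z' (f o)).
  by move=> o; have [Z ? ?] := borel_representative (f2 o).1; exists Z.
have [Z nZ ZZ] := null_borel_seq (enum {: option 'I_N}) (fun o => (HZ o).1).
have sf o : sqint leb (vanish Z (f o)).
  apply: sqint_vanish => //; apply: (HZ o).2; first by case: nZ.
  by apply: ZZ; rewrite mem_enum.
have gE i : (fun x => vanish Z g x 0 i) = vanish Z (f (Some i)).
  by apply/funext => x; rewrite /vanish; case: ifP => // _; rewrite mxE.
have [mZ Z0] := nZ.
exists Z; split => //; first exact: (sf None).
  by move=> i; rewrite gE.
move=> phi tphi i; have := ug phi tphi i.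
rewrite (eq_integral_off_null mZ Z0 (g := fun x => (vanish Z u x * partial i phi x)%:E)).
  rewrite (eq_integral_off_null mZ Z0 (f := fun x => (g x 0 i * phi x)%:E)
    (g := fun x => (vanish Z g x 0 i * phi x)%:E))// => x _ Zx.
  by rewrite vanish_out.
by move=> x _ Zx; rewrite vanish_out.
Qed.

(** By Tonelli the integral of nu(Z - x) over x is the [nu]-integral of the Lebesgue measures of the
    sets Z - z, all of which are 0. *)
Lemma null_shift (nu : {finite_measure set V -> \bar R}) Z : null_borel Z ->
  exists2 W, null_borel W & forall x, ~ W x -> nu [set z | Z (x + z)] = 0%E.
Proof.
move=> [mZ Z0].
pose f (p : V * V) : \bar R := (\1_Z (p.1 + p.2))%:E.
have f0 p : (0 <= f p)%E by rewrite lee_fin.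
have mf : measurable_fun setT f.
  apply/measurable_EFinP.
  apply: (measurableT_comp (f := \1_Z : V -> R)); first exact: measurable_indic.
  by apply: (measurable_fun_addrV (f := fst) (g := snd)).
have mI : measurable_fun setT (fun x => (\1_Z x)%:E : \bar R).
  by apply/measurable_EFinP; exact: measurable_indic.
have := @fubini_tonelli _ _ _ _ _ leb nu f mf f0.
rewrite [RHS]integral0_eq; last first.
  move=> z _; rewrite /f /=.
  rewrite (@ge0_integral_shift _ _ z (fun x => (\1_Z x)%:E))//.
  by rewrite integral_indic// setIT.
pose F x := (\int[nu]_z f (x, z))%E.
have F0 x : (0 <= F x)%E by exact: integral_ge0.
have mF : measurable_fun setT F by exact: (@measurable_fun_fubini_tonelli_F _ _ _ _ _ nu f mf f0).
move=> IF; have : (\int[leb]_x `|F x| = 0)%E.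
  by rewrite -[RHS]IF; apply: eq_integral => x _; rewrite gee0_abs.
move=> /(ae_eq_integral_abs leb measurableT mF)[W [mW W0 HW]].
exists W => // x Wx.
have : F x = 0%E by apply: contrapT => Fx; apply: Wx; apply: HW => /=; apply/not_implyP; split.
rewrite /F /f /= => <-.
have mZx : measurable [set z | Z (x + z)].
  rewrite -[X in measurable X]setTI.
  by apply: (measurable_fun_addrV (f := cst x) (g := id)).
rewrite -[X in nu X](setIT [set z | Z (x + z)]) -integral_indic//.
Qed.

End representatives.

(** * The energy as an integral over increments *)

Section energy_formula.
Variables (R : realType) (N : nat).
Local Notation V := 'rV[R]_N.
Local Notation leb := (@lebesgue_rV R N).

Lemma measurable_enormV : measurable_fun setT (fun z : V => (enorm z)^-1).
Proof.
rewrite (_ : (fun z => _) = (fun z : V => enorm z `^ (-1))).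
  by apply: (measurableT_comp (measurable_powR _)); exact: measurable_enorm.
by apply/funext => z; rewrite powR_inv1// enorm_ge0.
Qed.

Lemma measurable_preimage d d' (T : measurableType d) (T' : measurableType d') (f : T -> T') A :
  measurable_fun setT f -> measurable A -> measurable (f @^-1` A).
Proof. by move=> mf mA; rewrite -[X in measurable X]setTI; apply: (mf measurableT). Qed.

Lemma measurable_diff2 (w : V -> R) : measurable_fun setT w ->
  measurable_fun setT (fun p : V * V => (w (p.1 + p.2) - w p.1) ^+ 2).
Proof.
move=> mw; apply: measurable_funX; apply: measurable_funB.
  by apply: (measurableT_comp mw); apply: (measurable_fun_addrV (f := fst) (g := snd)).
by apply: (measurableT_comp mw).
Qed.

Lemma measurable_sqnorm_incr (w : V -> R) : measurable_fun setT w ->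
  measurable_fun setT (fun z => sqnorm leb (fun x => w (x + z) - w x)).
Proof.
move=> mw.
pose f (p : V * V) := ((w (p.1 + p.2)%R - w p.1) ^+ 2)%:E.
have mf : measurable_fun setT f by apply/measurable_EFinP; exact: measurable_diff2.
apply: (@measurable_fun_fubini_tonelli_G _ _ _ _ _ leb f mf) => p.
by rewrite lee_fin sqr_ge0.
Qed.

Lemma dq_sq (w : V -> R) z : dq w z ^+ 2 = nsq leb (fun x => w (x + z) - w x) * ((enorm z)^-1) ^+ 2.
Proof. by rewrite /dq exprMn /incr nrm_sq. Qed.

Lemma measurable_dq_sq (w : V -> R) : measurable_fun setT w ->
  measurable_fun setT (fun z => dq w z ^+ 2).
Proof.
move=> mw; rewrite (_ : (fun z => _) = (fun z => nsq leb (fun x => w (x + z) - w x) * ((enorm z)^-1) ^+ 2)).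
  apply: measurable_funM; last by apply: measurable_funX; exact: measurable_enormV.
  by apply: (measurableT_comp (@fine_measurable R setT measurableT)); exact: measurable_sqnorm_incr.
by apply/funext => z; rewrite dq_sq.
Qed.

Lemma null_diagonal (Z : set V) : null_borel Z ->
  (leb \x leb)%E [set p | Z (p.2 - p.1)] = 0%E.
Proof.
move=> [mZ Z0]; rewrite /= /product_measure1; apply: integral0_eq => x _ /=.
rewrite (_ : xsection _ _ = (fun y => y + - x) @^-1` Z) ?lebesgue_rV_shift//.
by apply/seteqP; split => y; rewrite /xsection /= inE.
Qed.

Lemma energyE (rho u : V -> R) (Zr Zu : set V) : (forall z, 0 <= rho z) ->
  null_borel Zr -> null_borel Zu ->
  measurable_fun setT (vanish Zr rho) -> sqint leb (vanish Zu u) ->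
  energy rho u =
    ((2^-1)%:E * \int[leb]_z (vanish Zr rho z * dq (vanish Zu u) z ^+ 2)%:E)%E.
Proof.
move=> rho0 nZr nZu mr sw; have [mw _] := sw.
have r0 z : 0 <= vanish Zr rho z by rewrite /vanish; case: ifP.
set r := vanish Zr rho in mr r0 *; set w := vanish Zu u in sw mw *.
rewrite /energy; congr (_ * _)%E.
have [[mZr _] [mZu Zu0]] := (nZr, nZu).
pose F (p : V * V) := (r (p.2 - p.1) * ((w p.2 - w p.1) ^+ 2 * ((enorm (p.2 - p.1))^-1) ^+ 2))%:E.
pose E := [set p : V * V | Zr (p.2 - p.1)] `|` (Zu `*` setT `|` setT `*` Zu).
have msub : measurable_fun setT (fun p : V * V => p.2 - p.1).
  apply: (@measurable_fun_addrV R _ (V * V)%type N snd (fun p => - p.1)) => //.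
  exact: (@measurable_fun_opprV R _ (V * V)%type N fst).
have mE1 : measurable [set p : V * V | Zr (p.2 - p.1)] by exact: (measurable_preimage msub).
have mE2 : measurable (Zu `*` [set: V]) by exact: measurableX.
have mE3 : measurable ([set: V] `*` Zu) by exact: measurableX.
have mE : measurable E by do ![apply: measurableU => //].
have H2 : (leb \x leb)%E (Zu `*` [set: V]) = 0%E by rewrite product_measure1E// [X in (X * _)%E]Zu0 mul0e.
have H3 : (leb \x leb)%E ([set: V] `*` Zu) = 0%E by rewrite product_measure1E// [X in (_ * X)%E]Zu0 mule0.
have E0 : (leb \x leb)%E E = 0%E.
  apply: null_set_setU => //; first exact: measurableU.
    exact: null_diagonal.
  by apply: null_set_setU.
rewrite (eq_integral_off_null mE E0 (g := F)); last first.
  move=> -[x y] _ /= /not_orP[Ex /not_orP[Ex1 Ey1]].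
  rewrite /F /= /r vanish_out// /w !vanish_out; last 2 first.
  - by move=> ?; apply: Ex1.
  - by move=> ?; apply: Ey1.
  by rewrite real_normK ?num_real// exprVn.
have F0 p : (0 <= F p)%E by rewrite lee_fin mulr_ge0// mulr_ge0// sqr_ge0.
have mF : measurable_fun setT F.
  apply/measurable_EFinP; apply: measurable_funM; first exact: measurableT_comp.
  apply: measurable_funM.
    by apply: measurable_funX; apply: measurable_funB; exact: (measurableT_comp mw).
  by apply: measurable_funX; exact: (measurableT_comp measurable_enormV).
rewrite (@fubini_tonelli1 _ _ _ _ _ leb leb F mF F0).
pose G (p : V * V) := (r p.2 * ((w (p.1 + p.2) - w p.1) ^+ 2 * ((enorm p.2)^-1) ^+ 2))%:E.
have G0 p : (0 <= G p)%E by rewrite lee_fin mulr_ge0// mulr_ge0// sqr_ge0.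
have mG : measurable_fun setT G.
  apply/measurable_EFinP; apply: measurable_funM; first exact: measurableT_comp.
  apply: measurable_funM; first exact: measurable_diff2.
  by apply: measurable_funX; exact: (measurableT_comp measurable_enormV).
(* The substitution y = x + z, for fixed x. *)
transitivity (\int[leb]_x \int[leb]_z G (x, z))%E.
  apply: eq_integral => x _; rewrite /fubini_F.
  rewrite -(@ge0_integral_shift _ _ x (fun y => F (x, y)))//; last first.
    by apply: (measurableT_comp mF); exact: measurable_fun_pair.
  by apply: eq_integral => z _; rewrite /F /G /= addrK (addrC z).
rewrite (@fubini_tonelli _ _ _ _ _ leb leb G mG G0).
apply: eq_integral => z _; rewrite dq_sq mulrCA EFinM -nsqE; last exact: sqint_diff.
rewrite muleC /sqnorm -ge0_integralZl_EFin//; last 3 first.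
- by move=> x _; rewrite lee_fin sqr_ge0.
- by apply: measurable_sq; have [] := sqint_diff z sw.
- by rewrite mulr_ge0// sqr_ge0.
by apply: eq_integral => x _; rewrite /G /= -EFinM; congr EFin; ring.
Qed.

End energy_formula.

(** * The compactification and the extended quotient *)

Section chart.
Variables (R : realType) (N : nat).
Local Notation V := 'rV[R]_N.
Local Notation leb := (@lebesgue_rV R N).

(* Compactification of V \ {0}: the modulus is mapped to [0, 1], and the
   direction is kept as the modulus tends to 0. *)
Definition chart (z : V) : 'rV[R]_N.+1 :=
  cons_rV (enorm z / (1 + enorm z), (enorm z)^-1 *: z).

Lemma chart_modulus z : chart z 0 0 = enorm z / (1 + enorm z).
Proof. exact: cons_rV_ord0. Qed.

Lemma chart_direction z i : chart z 0 (lift ord0 i) = (enorm z)^-1 * z 0 i.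
Proof. by rewrite /chart cons_rV_lift mxE. Qed.

Lemma chart_le1 z i : `|chart z 0 i| <= 1.
Proof.
have e0 := enorm_ge0 z.
case: (unliftP ord0 i) => [j|] ->.
  rewrite chart_direction; have [->|/eqP z0] := eqVneq z 0; first by rewrite mxE mulr0 normr0.
  have ez := enorm_gt0 z0.
  rewrite normrM (ger0_norm (x := _^-1)) ?invr_ge0// mulrC ler_pdivrMr// mul1r.
  exact: coord_le_enorm.
rewrite chart_modulus ger0_norm; first by rewrite ler_pdivrMr; lra.
by rewrite divr_ge0; lra.
Qed.

Lemma measurable_chart : measurable_fun setT chart.
Proof.
apply: (measurableT_comp (@measurable_cons_rV R N)); apply/measurable_fun_pairP; split => /=.
  rewrite (_ : _ \o _ = (fun z : V => enorm z * (1 + enorm z) `^ (-1))).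
    apply: measurable_funM; first exact: measurable_enorm.
    apply: (measurableT_comp (measurable_powR _)).
    by apply: measurable_funD => //; exact: measurable_enorm.
  by apply/funext => z /=; rewrite powR_inv1// addr_ge0// enorm_ge0.
apply: (measurable_fun_scalerV (f := fun z : V => (enorm z)^-1) (g := id)) => //.
exact: measurable_enormV.
Qed.

(** The directions of non-zero vectors have norm 1, a closed condition that survives when the
    modulus tends to 0 or 1. *)
Lemma adherent_direction y : adherent chart (~` [set 0]) y ->
  enorm (rsubmx (y : 'rV[R]_(1 + N))) = 1.
Proof.
move=> ady.
have /choice[z_ Hz] : forall k : nat, exists z : V, z <> 0 /\
    forall i, `|chart z 0 i - y 0 i| < k.+1%:R^-1.
  by move=> k; have [|z z0 hz] := ady k.+1%:R^-1; [rewrite invr_gt0|exists z].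
have cz i : chart (z_ k) 0 i @[k --> \oo] --> y 0 i.
  apply/cvgrPdist_le => e e0; near=> k; rewrite distrC ltW//.
  apply: lt_trans (proj2 (Hz k) i) _.
  by near: k; exact: near_infty_natSinv_lt (PosNum e0).
have : enorm ((enorm (z_ k))^-1 *: z_ k) @[k --> \oo] --> enorm (rsubmx (y : 'rV[R]_(1 + N))).
  apply: cvg_enorm => i; rewrite rsubmx_lift.
  under eq_fun do rewrite mxE.
  by have := cz (lift ord0 i); under eq_fun do rewrite chart_direction.
move=> ce; have := seq_cvg_unique ce; apply.
under eq_fun do rewrite enormZ.
rewrite (_ : (fun k => _) = cst 1); first exact: cvg_cst.
apply/funext => k; have ez := enorm_gt0 (proj1 (Hz k)).
by rewrite /= gtr0_norm ?invr_gt0// mulVf// gt_eqF.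
Unshelve. all: by end_near. Qed.

Section limit_quotient.
Variables (u : V -> R) (g : V -> V).
Hypothesis su : sqint leb u.
Hypothesis sg : forall i, sqint leb (fun x => g x 0 i).
Hypothesis ug : forall phi, test_function phi -> forall i : 'I_N,
  (\int[leb]_x (u x * partial i phi x)%:E = - \int[leb]_x (g x 0 i * phi x)%:E)%E.

Definition limit_quotient (y : 'rV[R]_N.+1) : R :=
  dq_lim u g (y 0 0) (rsubmx (y : 'rV[R]_(1 + N))) ^+ 2.

(** A failure for every eta = 1/(k+1) gives a sequence whose chart coordinates converge to y, which
    contradicts [dq_cvg]. *)
Lemma dq_sq_near (y : 'rV[R]_N.+1) (e : R) : 0 < e -> exists2 eta, 0 < eta &
  forall z, z <> 0 -> (forall i, `|chart z 0 i - y 0 i| < eta) ->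
    `|dq u z ^+ 2 - limit_quotient y| <= e.
Proof.
move=> e0; apply: contrapT => noeta.
have /choice[z_ Hz] : forall k : nat, exists z : V, [/\ z <> 0,
    forall i, `|chart z 0 i - y 0 i| < k.+1%:R^-1 & e < `|dq u z ^+ 2 - limit_quotient y| ].
  move=> k; apply: contrapT => noz; apply: noeta; exists k.+1%:R^-1; first by rewrite invr_gt0.
  move=> z z0 hz; rewrite leNgt; apply/negP => ez; apply: noz; by exists z.
have cz i : chart (z_ k) 0 i @[k --> \oo] --> y 0 i.
  apply/cvgrPdist_le => d d0; near=> k; rewrite distrC ltW//.
  have [_ hz _] := Hz k; apply: lt_trans (hz i) _.
  by near: k; exact: near_infty_natSinv_lt (PosNum d0).
have : dq u (z_ k) @[k --> \oo] --> dq_lim u g (y 0 0) (rsubmx (y : 'rV[R]_(1 + N))).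
  apply: dq_cvg => //; first by move=> k; have [] := Hz k.
    by have := cz 0; under eq_fun do rewrite chart_modulus.
  move=> i; rewrite rsubmx_lift.
  by have := cz (lift ord0 i); under eq_fun do rewrite chart_direction.
move=> cd; have : dq u (z_ k) * dq u (z_ k) @[k --> \oo] --> limit_quotient y by exact: (cvgM cd).
move=> /cvgrPdist_le/(_ e e0)[k0 _ /(_ k0 (leqnn _))]/=.
rewrite distrC -!expr2 => hk.
by have [_ _] := Hz k0; rewrite ltNge => /negP; apply.
Unshelve. all: by end_near. Qed.

End limit_quotient.
End chart.

(** * The measures on the sphere and on R^N *)

Section limit_measures.
Variables (R : realType) (N : nat).
Local Notation V := 'rV[R]_N.
Local Notation leb := (@lebesgue_rV R N).
Local Notation lam := (@lebesgue_measure R).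

Lemma measurable_sphere : measurable (sphere R N).
Proof.
rewrite (_ : sphere R N = @enorm R N @^-1` [set 1])//.
by apply: measurable_preimage => //; exact: measurable_enorm.
Qed.

Lemma measurable_dot d (T : measurableType d) (f h : T -> V) :
  measurable_fun setT f -> measurable_fun setT h ->
  measurable_fun setT (fun t => dot (f t) (h t)).
Proof.
move=> mf mh; apply: measurable_sum => i; apply: measurable_funM.
  exact: (measurableT_comp (@measurable_coord_rV R N i)).
exact: (measurableT_comp (@measurable_coord_rV R N i)).
Qed.

(** The value at x is changed only if x lies in [Z], or if [nu] charges Z - x; by [null_shift] both
    happen on a null set of x. *)
Lemma limit_energy_vanish (mu nu : {finite_measure set V -> \bar R}) (u : V -> R) (g : V -> V) Z :
  null_borel Z -> limit_energy mu nu u g = limit_energy mu nu (vanish Z u) (vanish Z g).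
Proof.
move=> nZ; have [W nW HW] := null_shift nu nZ.
have [mE E0] := null_borelU nZ nW; have [mZ _] := nZ.
rewrite /limit_energy; congr (_ * _)%E.
apply: (eq_integral_off_null mE E0) => x _ /not_orP[Zx Wx].
congr (_ + _)%E; first by apply: eq_integral => s _; rewrite vanish_out.
have mZx : measurable [set z | Z (x + z)].
  apply: (measurable_preimage (f := fun z => x + z)) => //.
  exact: (measurable_fun_addrV (f := cst x) (g := id)).
apply: (eq_integral_off_null mZx (HW x Wx)) => z _ Zxz.
by rewrite !vanish_out.
Qed.

Lemma limit_energyE (mu nu : {finite_measure set V -> \bar R}) (u : V -> R) (g : V -> V) :
  mu (~` sphere R N) = 0%E -> sqint leb u -> (forall i, sqint leb (fun x => g x 0 i)) ->
  limit_energy mu nu u g =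
  ((2^-1)%:E * (\int[mu]_s sqnorm leb (fun x => dot (g x) s) +
                \int[nu]_z (dq u z ^+ 2)%:E))%E.
Proof.
move=> mu0 su sg; have [mu_ _] := su.
have mg : measurable_fun setT g by apply: measurable_fun_rV => i; have [] := sg i.
rewrite /limit_energy; congr (_ * _)%E.
pose F (p : V * V) := ((dot (g p.1) p.2) ^+ 2)%:E.
pose G (p : V * V) := ((u (p.1 + p.2)%R - u p.1) ^+ 2 * (enorm p.2)^-1 ^+ 2)%:E.
have F0 p : (0 <= F p)%E by rewrite lee_fin sqr_ge0.
have G0 p : (0 <= G p)%E by rewrite lee_fin mulr_ge0 ?sqr_ge0.
have mF : measurable_fun setT F.
  apply/measurable_EFinP; apply: measurable_funX.
  by apply: measurable_dot => //; exact: measurableT_comp.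
have mG : measurable_fun setT G.
  apply/measurable_EFinP; apply: measurable_funM; first exact: measurable_diff2.
  apply: measurable_funX; apply: (measurableT_comp (f := fun z : V => (enorm z)^-1)).
    exact: measurable_enormV.
  exact: measurable_snd.
transitivity (\int[leb]_x (\int[mu]_s F (x, s) + \int[nu]_z G (x, z)))%E.
  apply: eq_integral => x _; congr (_ + _)%E.
    rewrite integral_mkcond.
    apply: (eq_integral_off_null (measurableC measurable_sphere) mu0) => s _ /contrapT Ss.
    by rewrite patchE mem_set// /F /= real_normK ?num_real.
  rewrite integral_mkcond; apply: eq_integral => z _; rewrite patchE; case: ifPn => [_|].
    by rewrite /G /= real_normK ?num_real// exprVn.
  (* At z = 0 the increment vanishes, so the origin may be put back into the domain whatever its
     [nu]-mass. *)
  by rewrite notin_setE => /contrapT/= ->; rewrite /G /= addr0 subrr expr0n/= mul0r.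
rewrite ge0_integralD//; last 4 first.
- by move=> x _; exact: integral_ge0.
- exact: (@measurable_fun_fubini_tonelli_F _ _ _ _ _ mu F mF F0).
- by move=> x _; exact: integral_ge0.
- exact: (@measurable_fun_fubini_tonelli_F _ _ _ _ _ nu G mG G0).
rewrite (@fubini_tonelli _ _ _ _ _ leb mu F mF F0).
rewrite (@fubini_tonelli _ _ _ _ _ leb nu G mG G0).
congr (_ + _)%E; apply: eq_integral => z _.
rewrite dq_sq EFinM -nsqE; last exact: sqint_diff.
rewrite muleC /sqnorm -ge0_integralZl_EFin//; last 3 first.
- by move=> x _; rewrite lee_fin sqr_ge0.
- by apply: measurable_sq; have [] := sqint_diff z su.
- exact: sqr_ge0.
by apply: eq_integral => x _; rewrite /G /= -EFinM mulrC.
Qed.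

(** The interval is cut according to the modulus s of [Y t]. On s <= 0 the image under the direction
    is [mu]; on 0 < s < 1 the image under the point of R^N with these chart coordinates is [nu]; on
    s >= 1, at infinity, the extended quotient is 0. *)
Lemma limit_measures (L : R) (Y : R -> 'rV[R]_N.+1) : 0 <= L -> measurable_fun setT Y ->
  (forall t, 0 <= t < L -> enorm (rsubmx (Y t : 'rV[R]_(1 + N))) = 1) ->
  exists mu nu : {finite_measure set V -> \bar R}, mu (~` sphere R N) = 0%E /\
    forall (u : V -> R) (g : V -> V) Z, null_borel Z -> sqint leb (vanish Z u) ->
      (forall i, sqint leb (fun x => vanish Z g x 0 i)) ->
      measurable_fun `[0, L[%classic (limit_quotient (vanish Z u) (vanish Z g) \o Y) ->
      limit_energy mu nu u g = ((2^-1)%:E *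
        \int[lam]_(t in `[0%R, L[) (limit_quotient (vanish Z u) (vanish Z g) (Y t))%:E)%E.
Proof.
move=> L0 mY Ydir.
pose s t := Y t 0 0; pose sigma t := rsubmx (Y t : 'rV[R]_(1 + N)).
have ms : measurable_fun setT s by exact: (measurableT_comp (@measurable_coord_rV R N.+1 0)).
have msigma : measurable_fun setT sigma.
  apply: measurable_fun_rV => i.
  under eq_fun do rewrite rsubmx_lift.
  exact: (measurableT_comp (@measurable_coord_rV R N.+1 (lift ord0 i))).
(* On 0 < s < 1 the factor is s/(1 - s), the inverse of r/(1 + r); the power of an absolute value is
   measurable on the whole line. *)
pose zeta t := (s t * `|1 - s t| `^ (-1)) *: sigma t.
have mzeta : measurable_fun setT zeta.
  apply: measurable_fun_scalerV => //; apply: measurable_funM => //.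
  apply: (measurableT_comp (measurable_powR _)).
  by apply: (measurableT_comp (@normr_measurable R setT)); exact: measurable_funB.
pose S0 := `[0, L[%classic `&` (s @^-1` `]-oo, 0]%classic).
pose S1 := `[0, L[%classic `&` (s @^-1` `]0, 1[%classic).
have mI : measurable `[0, L[%classic by exact: measurable_itv.
have mS0 : measurable S0 by apply: measurableI => //; exact: measurable_preimage.
have mS1 : measurable S1 by apply: measurableI => //; exact: measurable_preimage.
have Ioo : (lam `[0%R, L[%classic < +oo)%E.
  have /= -> := @lebesgue_measure_itv R `[0, L[.
  by case: ifP => _; rewrite ?ltry// -EFinB ltry.
have S0oo : (lam S0 < +oo)%E.
  by apply: le_lt_trans Ioo; apply: le_measure; rewrite ?inE//; exact: subIsetl.
have S1oo : (lam S1 < +oo)%E.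
  by apply: le_lt_trans Ioo; apply: le_measure; rewrite ?inE//; exact: subIsetl.
pose mu : {finite_measure set V -> \bar R} :=
  @restricted_image _ _ (measurableTypeR R) V R lam S0 mS0 S0oo sigma msigma.
pose nu : {finite_measure set V -> \bar R} :=
  @restricted_image _ _ (measurableTypeR R) V R lam S1 mS1 S1oo zeta mzeta.
have mu0 : mu (~` sphere R N) = 0%E.
  rewrite /mu /= restricted_imageE (_ : _ `&` _ = set0) ?measure0//.
  apply/seteqP; split => // t [/= St []]; rewrite /= in_itv/= => tL _.
  by apply: St; exact: Ydir.
exists mu, nu; split => // u g Z nZ su sg mPhi.
rewrite (limit_energy_vanish _ _ _ _ nZ) limit_energyE//; congr (_ * _)%E.
set ut := vanish Z u in su mPhi *; set gt := vanish Z g in sg mPhi *.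
have mgt : measurable_fun setT gt by apply: measurable_fun_rV => i; have [] := sg i.
have mdot : measurable_fun setT (fun a : V => sqnorm leb (fun x => dot (gt x) a)).
  pose F (p : V * V) := ((dot (gt p.1) p.2) ^+ 2)%:E.
  have mF : measurable_fun setT F.
    apply/measurable_EFinP; apply: measurable_funX.
    by apply: measurable_dot => //; exact: measurableT_comp.
  apply: (@measurable_fun_fubini_tonelli_G _ _ _ _ _ leb F mF) => p.
  by rewrite lee_fin sqr_ge0.
have := @integral_restricted_image _ _ (measurableTypeR R) V R lam S0 mS0 S0oo sigma msigma
  _ mdot (fun a => @sqnorm_ge0 _ _ _ _ _).
rewrite -/mu => ->.
have mdq : measurable_fun setT (fun z : V => (dq ut z ^+ 2)%:E : \bar R).
  by apply/measurable_EFinP; apply: measurable_dq_sq; have [] := su.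
have dq2 z : (0 <= (dq ut z ^+ 2)%:E)%E by rewrite lee_fin sqr_ge0.
have := @integral_restricted_image _ _ (measurableTypeR R) V R lam S1 mS1 S1oo zeta mzeta
  _ mdq dq2.
rewrite -/nu => ->.
pose Phi t := (limit_quotient ut gt (Y t))%:E.
have Phi0 t : (0 <= Phi t)%E by rewrite lee_fin sqr_ge0.
have e0 t : S0 t -> sqnorm leb (fun x => dot (gt x) (sigma t)) = Phi t.
  move=> [_]; rewrite /= in_itv/= => st; rewrite /Phi /limit_quotient /dq_lim st nrm_sq nsqE//.
  exact: sqint_dot.
have e1 t : S1 t -> (dq ut (zeta t) ^+ 2)%:E = Phi t.
  move=> [_]; rewrite /= in_itv/= => /andP[s0 s1].
  rewrite /Phi /limit_quotient /dq_lim -/(s t) leNgt s0/= leNgt s1/=.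
  rewrite /zeta powR_inv1// gtr0_norm ?subr_gt0//.
transitivity (\int[lam]_(t in S0) Phi t + \int[lam]_(t in S1) Phi t)%E.
  by congr (_ + _)%E; apply: eq_integral => t /set_mem; [exact: e0|exact: e1].
have mPhi' : measurable_fun (S0 `|` S1) Phi.
  apply: (measurable_funS mI); last exact/measurable_EFinP.
  by rewrite subUset; split; exact: subIsetl.
have S01 : [disjoint S0 & S1].
  apply/disj_set2P/seteqP; split => // t [[_ +] [_]].
  by rewrite /= !in_itv/= => s0 /andP[]; rewrite ltNge s0.
rewrite -(@ge0_integral_setU _ _ _ lam S0 S1 mS0 mS1 Phi mPhi' (fun t _ => Phi0 t) S01).
rewrite [RHS]integral_mkcond [LHS]integral_mkcond; apply: eq_integral => t _.
rewrite !patchE; case: ifPn => [/set_mem St|St].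
  by rewrite mem_set//; case: St => -[].
case: ifPn => // /set_mem It; rewrite /Phi /limit_quotient /dq_lim -/(s t).
move: St; rewrite notin_setE => /not_orP[St0 St1].
have s0 : ~~ (s t <= 0).
  by apply/negP => s0; apply: St0; split => //=; rewrite in_itv.
have s1 : 1 <= s t.
  rewrite leNgt; apply/negP => s1; apply: St1; split => //=.
  by rewrite in_itv/= s1 ltNge s0.
by rewrite (negbTE s0) s1 expr0n.
Qed.

End limit_measures.

(** * Localisation of the kernels to large balls *)

Section concentration.
Variables (R : realType) (N : nat).
Local Notation V := 'rV[R]_N.
Local Notation leb := (@lebesgue_rV R N).

Lemma limf_esup_right_lt (f : R -> \bar R) (a : \bar R) (d : R) :
  (limf_esup f 0^'+ < a)%E -> 0 < d -> exists2 e, 0 < e < d & (f e < a)%E.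
Proof.
rewrite limf_esupE => /ereal_inf_lt[_ [A A0 <-] fA] d0.
have : (\forall e \near 0^'+, A e /\ 0 < e < d).
  near=> e; split; first by near: e.
  apply/andP; split; near: e; first exact: nbhs_right_gt.
  exact: nbhs_right_lt.
move=> /filter_ex[e [Ae ed]]; exists e => //.
by apply: le_lt_trans fA; apply: ereal_sup_ubound; exists e.
Unshelve. all: by end_near. Qed.

Lemma measurable_eball r : measurable (eball r : set V).
Proof.
rewrite (_ : eball r = @enorm R N @^-1` `]-oo, r[%classic).
  by apply: measurable_preimage => //; exact: measurable_enorm.
by apply/seteqP; split => z /=; rewrite in_itv.
Qed.

Section kernel.
Variables (rho : V -> R) (rho0 : forall z, 0 <= rho z) (C : R).
Variables (r : R) (r0 : 0 < r).
Hypothesis rhoC : (\int[leb]_(z in eball r) (rho z)%:E +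
  (r ^+ 2)%:E * \int[leb]_(z in ~` eball r) (rho z / enorm z ^+ 2)%:E <= C%:E)%E.
Variables (Z : set V) (Z0 : Z 0) (mZ : measurable_fun setT (vanish Z rho)).

Definition localized z : R := vanish Z rho z * \1_(eball r) z.

Lemma vanish_ge0 z : 0 <= vanish Z rho z.
Proof. by rewrite /vanish; case: ifP. Qed.

Lemma vanish_le z : vanish Z rho z <= rho z.
Proof. by rewrite /vanish; case: ifP. Qed.

Lemma localized_ge0 z : 0 <= localized z.
Proof. by rewrite /localized mulr_ge0 ?vanish_ge0. Qed.

Lemma measurable_localized : measurable_fun setT localized.
Proof.
apply: measurable_funM => //; apply: measurable_indic; exact: measurable_eball.
Qed.

Lemma inner_ge0 : (0 <= \int[leb]_(z in eball r) (rho z)%:E)%E.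
Proof. by apply: integral_ge0 => z _; rewrite lee_fin. Qed.

Lemma outer_ge0 : (0 <= \int[leb]_(z in ~` eball r) (rho z / enorm z ^+ 2)%:E)%E.
Proof. by apply: integral_ge0 => z _; rewrite lee_fin divr_ge0 ?sqr_ge0. Qed.

Lemma localized_mass : (\int[leb]_(z in ~` [set 0%R]) (localized z)%:E <= C%:E)%E.
Proof.
apply: (le_trans _ rhoC); apply: (@le_trans _ _ (\int[leb]_(z in eball r) (rho z)%:E)%E).
  rewrite integral_mkcond [leRHS]integral_mkcond; apply: ge0_le_integral_nonmeas => z _.
    by rewrite erestrict_ge0// => ? _; rewrite lee_fin localized_ge0.
  rewrite !patchE /localized indicE; case: (z \in eball r); case: ifP => _ //.
  - by rewrite mulr1 lee_fin vanish_le.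
  - by rewrite lee_fin.
  - by rewrite mulr0.
by rewrite leeDl// mule_ge0 ?outer_ge0// lee_fin sqr_ge0.
Qed.

Lemma tail_mass : (\int[leb]_(z in ~` eball r) (vanish Z rho z * (enorm z)^-1 ^+ 2)%:E
   <= (C / r ^+ 2)%:E)%E.
Proof.
apply: (@le_trans _ _ (\int[leb]_(z in ~` eball r) (rho z / enorm z ^+ 2)%:E)%E).
  apply: ge0_le_integral_nonmeas => z _.
    by rewrite lee_fin mulr_ge0 ?vanish_ge0 ?sqr_ge0.
  by rewrite lee_fin exprVn ler_wpM2r ?vanish_le// invr_ge0 sqr_ge0.
have r20 : 0 < r ^+ 2 by rewrite exprn_gt0.
rewrite EFinM muleC lee_pdivlMl//; apply: (le_trans _ rhoC).
by rewrite leeDr// inner_ge0.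
Qed.

(** [T] is the integral outside the ball. There the quotient is at most 2||w||/|z|, and [rhoC]
    bounds the integral of rho/|z|^2 by C/r^2. *)
Lemma kernel_split (w : V -> R) : sqint leb w -> exists T : \bar R,
  [/\ (0 <= T)%E, (T <= (4 * nsq leb w * (C / r ^+ 2))%:E)%E &
   (\int[leb]_z (vanish Z rho z * dq w z ^+ 2)%:E =
    \int[leb]_(z in ~` [set 0%R]) (localized z * dq w z ^+ 2)%:E + T)%E].
Proof.
move=> sw; pose h z := (vanish Z rho z * dq w z ^+ 2)%:E.
have h0 z : (0 <= h z)%E by rewrite lee_fin mulr_ge0 ?vanish_ge0 ?sqr_ge0.
have mh : measurable_fun setT h.
  apply/measurable_EFinP; apply: measurable_funM => //.
  by apply: measurable_dq_sq; have [] := sw.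
exists (\int[leb]_(z in ~` eball r) h z)%E; split.
- exact: integral_ge0.
- have K0 : 0 <= 4 * nsq leb w by rewrite mulr_ge0 ?nsq_ge0.
  apply: (@le_trans _ _ ((4 * nsq leb w)%:E *
     \int[leb]_(z in ~` eball r) (vanish Z rho z * (enorm z)^-1 ^+ 2)%:E)%E).
    rewrite -ge0_integralZl_EFin//; last 3 first.
    + exact: measurableC (measurable_eball r).
    + by move=> z _; rewrite lee_fin mulr_ge0 ?vanish_ge0 ?sqr_ge0.
    + apply: measurable_funTS; apply/measurable_EFinP; apply: measurable_funM => //.
      by apply: measurable_funX; exact: measurable_enormV.
    apply: ge0_le_integral_nonmeas => z _; first exact: h0.
    rewrite /h -EFinM lee_fin [leRHS]mulrCA; apply: ler_wpM2l; first exact: vanish_ge0.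
    rewrite dq_sq; apply: ler_wpM2r; first exact: sqr_ge0.
    rewrite -!nrm_sq (_ : 4 = 2 ^+ 2); last by ring.
    rewrite -exprMn; apply: lerXn2r; rewrite ?nnegrE ?mulr_ge0 ?nrm_ge0//.
    exact: incr_bound.
  by rewrite (EFinM (4 * _)); apply: lee_wpmul2l; [rewrite lee_fin|exact: tail_mass].
have mB := measurable_eball r.
have mh' : measurable_fun (eball r `|` ~` eball r : set V) h by exact: measurable_funTS.
have dB : [disjoint (eball r : set V) & ~` eball r] by exact/disj_set2P/setICr.
rewrite -[in LHS](setUv (eball r)).
rewrite (@ge0_integral_setU _ _ _ leb _ _ mB (measurableC mB) h mh' (fun z _ => h0 z) dB).
congr (_ + _)%E; rewrite integral_mkcond [RHS]integral_mkcond; apply: eq_integral => z _.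
rewrite !patchE /localized indicE /h in_setC.
case: (boolP (z \in [set 0])) => [|_] /=; last first.
  by case: (z \in eball r); rewrite ?mulr1// mulr0 mul0r.
(* The origin has no place in the chart; the modified kernel vanishes there because [Z] contains
   it. *)
rewrite inE /= => ->; rewrite /vanish (mem_set Z0) mul0r.
by case: ifP.
Qed.

End kernel.

End concentration.

Lemma limit_quotient_bounded (R : realType) (N : nat) (u : 'rV[R]_N -> R) (g : 'rV[R]_N -> 'rV[R]_N)
    (B : R) (y : 'rV[R]_N.+1) :
  sqint (lebesgue_rV R N) u -> (forall i, sqint (lebesgue_rV R N) (fun x => g x 0 i)) ->
  (forall phi, test_function phi -> forall i : 'I_N,
    (\int[lebesgue_rV R N]_x (u x * partial i phi x)%:E =
     - \int[lebesgue_rV R N]_x (g x 0 i * phi x)%:E)%E) ->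
  (forall z, dq u z ^+ 2 <= B) -> adherent (@chart R N) (~` [set 0]) y ->
  limit_quotient u g y <= B.
Proof.
move=> su sg ug uB ady; apply/ler_addgt0Pr => e e0.
have [eta eta0 Heta] := dq_sq_near su sg ug y e0.
have [z z0 /(Heta _ z0)] := ady eta eta0.
by rewrite ler_distlC => /andP[_ /le_trans]; apply; rewrite lerD2r.
Qed.

Theorem theorem1p2 (R : realType) (N : nat) (N1 : (1 <= N)%N)
    (rho : R -> 'rV[R]_N -> R)
    (rho_measurable : forall e, 0 < e < 1 -> lebesgue_measurable_fun (rho e))
    (rho_ge0 : forall e, 0 < e < 1 -> forall z, 0 <= rho e z)
    (M : R) (M0 : 0 <= M)
    (rho_bound : forall r : R, 0 < r ->
      (limf_esup (fun e : R =>
         \int[@lebesgue_rV R N]_(z in eball r) (rho e z)%:E +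
         (r ^+ 2)%:E * \int[@lebesgue_rV R N]_(z in ~` eball r)
                          (rho e z / enorm z ^+ 2)%:E) 0^'+ <= M%:E)%E) :
  exists e : nat -> R,
    [/\ forall k, 0 < e k < 1,
        e k @[k --> \oo] --> (0 : R) &
        exists mu nu : {finite_measure set 'rV[R]_N -> \bar R},
          [/\ radon mu, mu (~` sphere R N) = 0%E, radon nu &
            forall u : 'rV[R]_N -> R, H1 u ->
            forall g : 'rV[R]_N -> 'rV[R]_N, L2_gradient u g ->
              energy (rho (e k)) u @[k --> \oo] --> limit_energy mu nu u g
              /\ (limit_energy mu nu u g < +oo)%E]].
Proof.
pose leb := lebesgue_rV R N.
(* The slack 1 makes the bound on the upper limit strict, so it is met by some [e] below any
   threshold. Radius j+1 and threshold 1/(j+1) are tied to the same index. *)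
pose C : R := M + 1; have C0 : 0 <= C by rewrite /C; lra.
pose rad (j : nat) : R := j.+1%:R; have rad0 j : 0 < rad j by rewrite ltr0n.
have /choice[e_ He] : forall j : nat, exists e, 0 < e < (rad j)^-1 /\
    (\int[leb]_(z in eball (rad j)) (rho e z)%:E +
      (rad j ^+ 2)%:E * \int[leb]_(z in ~` eball (rad j)) (rho e z / enorm z ^+ 2)%:E <= C%:E)%E.
  move=> j; have := rho_bound _ (rad0 j).
  have MC : (M%:E < C%:E)%E by rewrite lte_fin /C; lra.
  have rV0 : 0 < (rad j)^-1 by rewrite invr_gt0.
  move=> /le_lt_trans/(_ MC)/limf_esup_right_lt/(_ rV0)[e ? /ltW ?].
  by exists e.
have e01 j : 0 < e_ j < 1.
  have [/andP[-> ej] _] := He j; apply: (lt_le_trans ej).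
  by rewrite invf_le1 ?rad0// ler1n.
have r0 j z : 0 <= rho (e_ j) z by exact: rho_ge0.
have m0 : measurable [set (0 : 'rV[R]_N)].
  apply: measurable_closed; apply: accessible_closed_set1.
  by apply: hausdorff_accessible; exact: norm_hausdorff.
have /choice[Z HZ] : forall j, exists Z, [/\ null_borel Z, Z 0 &
    measurable_fun setT (vanish Z (rho (e_ j)))].
  move=> j; have [Z nZ HZ] := borel_representative (rho_measurable _ (e01 j)).
  have n0 : null_borel [set (0 : 'rV[R]_N)] by split => //; exact: lebesgue_rV_set1.
  exists (Z `|` [set 0]); split; [exact: null_borelU|by right|apply: HZ].
    by have [] := null_borelU nZ n0.
  by move=> x; left.
pose rl j := localized (rho (e_ j)) (rad j) (Z j).
have mD := measurableC m0.
have mrl j : measurable_fun setT (rl j).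
  by apply: measurable_localized; have [] := HZ j.
have rl0 j z : 0 <= rl j z by exact: (localized_ge0 (r0 j)).
have rlC j : (\int[leb]_(z in ~` [set 0%R]) (rl j z)%:E <= C%:E)%E.
  exact: (localized_mass (r0 j) (He j).2).
have [kap [L [Y [kapj L0 mY Yad Ylim]]]] := weak_limit (@measurable_chart R N) mD
  (fun z _ i => chart_le1 z i) mrl rl0 rlC.
have Ydir t tL := adherent_direction (Yad t tL).
have [mu [nu [mu0 Hmunu]]] := limit_measures L0 mY Ydir.
exists (e_ \o kap); split => [k||]; first exact: e01.
  apply/cvgrPdist_le => d d0; near=> k; rewrite sub0r normrN.
  have [/andP[e0 ek] _] := He (kap k); rewrite gtr0_norm//=; apply: ltW; apply: lt_trans ek _.
  apply: (@le_lt_trans _ _ k.+1%:R^-1).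
    by rewrite lef_pV2 ?posrE ?rad0// ler_nat ltnS.
  by near: k; exact: near_infty_natSinv_lt (PosNum d0).
exists mu, nu; split => //; [exact: finite_measure_radon|exact: finite_measure_radon|].
move=> u Hu g Hg; have [W [nW su sg ug]] := H1_representative Hu Hg.
set ut := vanish W u in su ug *; set gt := vanish W g in sg ug *.
pose A := 3 * \sum_(i < N) nrm leb (fun x => gt x 0 i).
have A0 : 0 <= A by rewrite mulr_ge0// sumr_ge0// => i _; exact: nrm_ge0.
have dqA z : dq ut z ^+ 2 <= A ^+ 2.
  by apply: lerXn2r; rewrite ?nnegrE ?dq_ge0//; exact: (dq_bound su sg ug).
have mdq : measurable_fun setT (fun z => dq ut z ^+ 2) by apply: measurable_dq_sq; have [] := su.
have [] := Ylim (fun z => dq ut z ^+ 2) (limit_quotient ut gt) (A ^+ 2).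
- exact: measurable_funTS.
- exact: sqr_ge0.
- by move=> z _; rewrite sqr_ge0 dqA.
- by move=> y _ e e0; exact: (dq_sq_near su sg ug y e0).
move=> mPhi cPhi.
have lE := Hmunu u g W nW su sg mPhi; rewrite -/ut -/gt in lE.
set I := (X in (_ * X)%E) in lE.
have Ioo : (I < +oo)%E.
  apply: (@le_lt_trans _ _ (\int[lebesgue_measure]_(t in `[0%R, L[) (A ^+ 2)%:E)%E).
    apply: ge0_le_integral_nonmeas => t; rewrite /= in_itv/= => tL; rewrite lee_fin.
      exact: sqr_ge0.
    by apply: (limit_quotient_bounded su sg ug dqA); exact: Yad.
  rewrite integral_cst//=; have /= -> := @lebesgue_measure_itv R `[0, L[.
  by case: ifP => _; rewrite ?mule0 ?ltry// -EFinB -EFinM ltry.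
have I0 : (0 <= I)%E by apply: integral_ge0 => t _; rewrite lee_fin sqr_ge0.
split; last by rewrite lE lte_mul_pinfty// lee_fin.
have /choice[T HT] := fun j => kernel_split (r0 j) (rad0 j) (He j).2
  (let: And3 _ z0 _ := HZ j in z0) (let: And3 _ _ mz := HZ j in mz) su.
have eE k : energy (rho (e_ (kap k))) u = ((2^-1)%:E *
    (\int[leb]_(z in ~` [set 0%R]) (rl (kap k) z * dq ut z ^+ 2)%:E + T (kap k)))%E.
  have [nZ _ mz] := HZ (kap k); have [_ _ <-] := HT (kap k).
  exact: (energyE (r0 _) nZ nW mz su).
rewrite lE; under eq_fun do rewrite /= eE.
apply: cvgeZl => //.
rewrite -[X in _ --> X]adde0; apply: cvgeD => //; first by rewrite fin_num_adde_defl.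
pose K := 4 * nsq leb ut * C.
have K0 : 0 <= K by rewrite !mulr_ge0 ?nsq_ge0.
(* The tail is at most K/(kap k + 1)^2, and kap k >= k. *)
have sq : \forall k \near \oo, (0 <= T (kap k) <= (K * k.+1%:R^-1)%:E)%E.
  near=> k; have [-> Tle _] := HT (kap k); apply: le_trans Tle _.
  rewrite lee_fin mulrA; apply: ler_wpM2l => //.
  rewrite lef_pV2 ?posrE ?exprn_gt0// expr2 -natrM ler_nat.
  by apply: leq_trans (leq_pmulr _ _); rewrite ?ltnS.
have cK : (K * k.+1%:R^-1)%:E @[k --> \oo] --> (0 : \bar R)%E.
  apply: cvg_EFin; first exact: nearW.
  rewrite -[X in _ --> X](mulr0 K); apply: cvgM; first exact: cvg_cst.
  exact: cvg_harmonic.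
exact: (squeeze_cvge sq (cvg_cst _) cK).
Unshelve. all: by end_near. Qed.
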